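(* Let $X_\Sigma$ be a smooth complete toric variety with constant polarization $h=(c,c,\dots,c)\in\mathbb Z^{\Sigma(1)}$, and let $\mu=\deg/\mathrm{rk}$ be the slope function on nonzero objects of the category $\mathbf{MTRS}_\bullet^\Sigma$ of modular tropical toric reflexive sheaves on $\mathrm{trop}(X_\Sigma)$. Then the Harder–Narasimhan filtrations of Khan–Maclagan associated to modular tropical toric reflexive sheaves are given by the categorical slope filtration on $\mathbf{MTRS}_\bullet^\Sigma$ of Li associated to $\mu$. In other words, the Khan–Maclagan Harder–Narasimhan filtration of a modular tropical toric reflexive sheaf is a categorical slope filtration in the sense of Li.
   Context: **$\mathbb T$-matroids.** The tropical hyperfield is the idyll $\mathbb T=\mathbb R\sqcup\{\infty\}$ with multiplication given by addition of reals, zero element $\infty$, $-a=a$, and null set $N_{\mathbb T}$ consisting of the finite formal sums of real numbers which are empty or whose minimum is attained at least twice (terms equal to $\infty$ are discarded). For a tuple $\mathbf x$, $|\mathbf x|$ is its set of entries and $\mathbf x_{\hat k}$ is $\mathbf x$ with the $k$th entry deleted. A Grassmann–Plücker function of rank $r$ on a finite set $E$ is a map $\mu:E^r\to\mathbb T$, not identically $\infty$, symmetric, equal to $\infty$ on tuples with a repeated entry, with $\sum_{k=0}^r\mu(\mathbf x_{\hat k})\cdot\mu(x_k,\mathbf y)\in N_{\mathbb T}$ for all $\mathbf x\in E^{r+1}$, $\mathbf y\in E^{r-1}$. A $\mathbb T$-matroid (valuated matroid) of rank $r$ is a class $M=[\mu]$ up to multiplication by $\mathbb R=\mathbb T^\times$;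 the underlying matroid $\underline M$ has as bases the $\{e_1,\dots,e_r\}$ with $\mu(e_1,\dots,e_r)\neq\infty$. A pointed $\mathbb T$-matroid has ground set $E_M=\tilde E_M\sqcup\{*_M\}$ with $*_M$ a loop of $\underline M$; it is simple if $\underline M$ with $*_M$ deleted has no loops or parallel elements. $\mathcal L(M)$ is the lattice of flats of $\underline M$, with $F\wedge G=F\cap G$ and $F\vee G=\langle F\cup G\rangle$, the smallest flat containing $F\cup G$. Vectors: the dual of $[\mu]$ on $E$, $\#E=n$, is $[\mu^*]$ with $\mu^*(\mathbf x)=\mu(\mathbf x')$ for $|\mathbf x'|=E\setminus|\mathbf x|$ if $\mathbf x\in E^{n-r}$ has distinct entries, and $\infty$ otherwise. Circuits of $M$ are multiples by reals of the vectors $X_{\mathbf y}\in\mathbb T^E$, where $\mathbf y=(y_0,\dots,y_r)$ has distinct entries and some $\mu(\mathbf y_{\hat i})\ne\infty$, $X_{\mathbf y}(y_k)=\mu(\mathbf y_{\hat k})$, and $X_{\mathbf y}(x)=\infty$ otherwise. $\mathcal V_M$ is the set of $X$ with $\sum_eX_eY_e\in N_{\mathbb T}$ for all circuits $Y$ of $M^*$. For pointed $M$, $\mathcal V_M\subseteq\mathbb T^{\tilde E_M}$ is computed after deleting $*_M$. A morphism $f_{\mathbb T}:M\to N$ of pointed $\mathbb T$-matroids is a matrix over $\mathbb T$ with rows indexed by $\tilde E_N$, columns by $\tilde E_M$, at most one non-$\infty$ entry in each row and column, and $f_{\mathbb T}\cdot\mathcal V_M\subseteq\mathcal V_N$. Its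 underlying map $\underline{f_{\mathbb T}}:E_M\to E_N$ sends $i$ to $j$ if the $(j,i)$ entry is not $\infty$, and everything else to $*_N$. Restriction and contraction: $(\mu|A)(\mathbf x)=\mu(\mathbf x,\mathbf c)$ with $\mathbf c$ an ordered basis of $\underline M/A$; $(\mu/A)(\mathbf x)=\mu(\mathbf x,\mathbf a)$ with $\mathbf a$ an ordered basis of $\underline M|A$; the distinguished loop is always kept. **Sheaves.** $\Sigma$ is a complete fan in $L_{\mathbb R}$, $L$ free abelian of finite rank, $\Lambda=\mathrm{Hom}(L,\mathbb Z)$, $\Sigma(1)$ its set of rays, $v_\rho\in L$ the primitive vector of $\rho$. A (pointed) tropical toric reflexive sheaf on $\mathrm{trop}(X_\Sigma)$ is a tuple $\mathcal E=(M,\{E^\rho_\bullet\}_\rho)$ with $M$ a simple pointed $\mathbb T$-matroid and, for each $\rho\in\Sigma(1)$, flats $E^\rho_j\in\mathcal L(M)$ ($j\in\mathbb Z$) with $E^\rho_j\supseteq E^\rho_{j+1}$, $E^\rho_j=\{*_M\}$ for $j\gg0$, $E^\rho_j=E_M$ for $j\ll0$. It is modular if $\mathrm{rk}(F)+\mathrm{rk}(G)=\mathrm{rk}(F\vee G)+\mathrm{rk}(F\wedge G)$ for all flats $F,G$ of $\underline M$ (a flat $F$ is modular if this holds for all $G$). A morphism $(M,\{E^\rho_\bullet\})\to(N,\{G^\rho_\bullet\})$ is a pair $(f_{\mathbb T},u)$ with $f_{\mathbb T}:M\to N$ a morphism and $u\in\Lambda$ such that $\underline{f_{\mathbb T}}(E^\rho_j)\subseteq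 G^\rho_{j+u\cdot v_\rho}$ for all $\rho,j$; composition is $(g_{\mathbb T},w)\circ(f_{\mathbb T},u)=(g_{\mathbb T}f_{\mathbb T},u+w)$. $\mathbf{MTRS}_\bullet^\Sigma$ is the resulting category of modular objects. For $F\in\mathcal L(M)$: $\mathcal E|F=(M|F,\{F\wedge E^\rho_\bullet\}_\rho)$; $\mathcal E/F=(M/F,\{G^\rho_\bullet\}_\rho)$, where $G^\rho_j$ corresponds to $F\vee E^\rho_j$ under $\mathcal L(M/F)\cong[F,E_M]$; these are regarded as objects of the category. Strict subobjects of $\mathcal E$ are, up to isomorphism, the restrictions $\mathcal E|F$ at flats. **Slope.** $\mathrm{rk}(\mathcal E)=\mathrm{rk}(M)$, $\deg(\mathcal E)=\sum_{\rho}h_\rho\sum_{j\in\mathbb Z}j\,(\mathrm{rk}_{\underline M}(E^\rho_j)-\mathrm{rk}_{\underline M}(E^\rho_{j+1}))$, and $\mu(\mathcal E)=\deg(\mathcal E)/\mathrm{rk}(\mathcal E)$ for $\mathcal E\neq0$. $\mathcal E$ is semistable if $\mu(\mathcal F)\le\mu(\mathcal E)$ for every nonzero strict subobject $\mathcal F$. **Khan–Maclagan filtration.** For a nonzero modular $\mathcal E$, Khan and Maclagan show there is a unique filtration $0=\mathcal F_0\rightarrowtail\mathcal F_1\rightarrowtail\cdots\rightarrowtail\mathcal F_k=\mathcal E$, with each $\mathcal F_i=\mathcal E|F_i$ for a flat $F_i$, whose successive quotients $\mathcal F_i/\mathcal F_{i-1}$ are semistable and satisfy $\mu(\mathcal F_1/\mathcal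 F_0)>\cdots>\mu(\mathcal F_k/\mathcal F_{k-1})$. This is the Harder–Narasimhan filtration of $\mathcal E$. **Categorical slope filtration (Li).** A proto-abelian category (André) is a pointed category with all kernels and cokernels such that any morphism with zero kernel (resp. cokernel) is a monomorphism (resp. epimorphism), the pullback of a strict epi (a cokernel) along a strict mono (a kernel) is a strict epi, and the pushout of a strict mono along a strict epi is a strict mono. For strict subobjects $N_1,N_2$ of $M$, $N_1\cap N_2$ is their pullback over $M$, and $N_1+N_2$ is the kernel of $M\to M'$, with $M'$ the pushout of $M/N_1\twoheadleftarrow M\twoheadrightarrow M/N_2$. A function $\mu:\mathrm{Iso}(\mathcal C)\setminus\{0\}\to\mathbb R$ satisfies the strong slope inequality if $\mu(N_1/(N_1\cap N_2))\le\mu((N_1+N_2)/N_2)$ for all strict subobjects $N_1,N_2$ of any object (whenever defined). Li's theorem: if $\mathcal C$ is a small proto-abelian category in which all objects are Artinian and Noetherian (for chains of strict subobjects) and $\mu$ satisfies the strong slope inequality, then every nonzero object $M$ has a filtration $0=N_0\rightarrowtail\cdots\rightarrowtail N_r=M$ by strict subobjects, unique up to isomorphism, with semistable quotients $N_i/N_{i-1}$ of strictly decreasing slopes. A filtration obtained this way is called a categorical slope filtration.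
   Formalization: MTRS is not proto-abelian (zero cokernel need not give an epi), so the other axioms and Li's conclusion are proved; parallel elements allowed; morphisms (0,u) identified; polarization means c>0 and principal divisors have degree 0, else the slope is not isomorphism-invariant. *)

(* Defs.v *)
From HB Require Import structures.
From mathcomp Require Import all_boot all_order all_algebra.
From mathcomp Require Import boolp classical_sets fsbigop reals.

Set Implicit Arguments.
Unset Strict Implicit.
Unset Printing Implicit Defensive.

Import Order.TTheory GRing.Theory Num.Theory.
Local Open Scope ring_scope.

(** [None] is the zero element $\infty$. *)
Definition trop (R : realType) := option R.

Definition tmul (R : realType) (a b : trop R) : trop R :=
  if a is Some x then (if b is Some y then Some (x + y) else None) else None.

(** The hypersum of two elements is multivalued only when they are equal and
    finite; [tmin] is used below only for sums with at most one finite term. *)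
Definition tmin (R : realType) (a b : trop R) : trop R :=
  match a, b with
  | Some x, Some y => Some (Num.min x y)
  | None, _ => b
  | _, None => a
  end.

(** Membership of a finite formal sum in the null set. *)
Definition tnull (R : realType) (s : seq (trop R)) : bool :=
  let t := pmap id s in
  (t == [::]) ||
  has (fun a : R => all (fun b => a <= b) t && (2 <= count_mem a t)%N) t.

Lemma tmulA (R : realType) : associative (@tmul R).
Proof. by case=> [x|] [y|] [z|] //=; rewrite addrA. Qed.

Lemma tmul0l (R : realType) : left_zero None (@tmul R).
Proof. by case. Qed.

Lemma tmul0r (R : realType) : right_zero None (@tmul R).
Proof. by case. Qed.

Lemma tmul1l (R : realType) : left_id (Some 0) (@tmul R).
Proof. by case=> //= x; rewrite add0r. Qed.

Lemma tmul1r (R : realType) : right_id (Some 0) (@tmul R).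
Proof. by case=> //= x; rewrite addr0. Qed.

Lemma tminA (R : realType) : associative (@tmin R).
Proof. by case=> [x|] [y|] [z|] //=; rewrite minA. Qed.

Lemma tminC (R : realType) : commutative (@tmin R).
Proof. by case=> [x|] [y|] //=; rewrite minC. Qed.

Lemma tmin0l (R : realType) : left_id None (@tmin R).
Proof. by case. Qed.

Lemma tmulDl (R : realType) : left_distributive (@tmul R) (@tmin R).
Proof. by case=> [x|] [y|] [z|] //=; rewrite addr_minl. Qed.

Lemma tmulDr (R : realType) : right_distributive (@tmul R) (@tmin R).
Proof. by case=> [x|] [y|] [z|] //=; rewrite addr_minr. Qed.

HB.instance Definition _ (R : realType) :=
  Monoid.isComLaw.Build (trop R) None (@tmin R)
    (@tminA R) (@tminC R) (@tmin0l R).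
HB.instance Definition _ (R : realType) :=
  Monoid.isMulLaw.Build (trop R) None (@tmul R) (@tmul0l R) (@tmul0r R).
HB.instance Definition _ (R : realType) :=
  Monoid.isAddLaw.Build (trop R) (@tmul R) (@tmin R) (@tmulDl R) (@tmulDr R).

(** A map $E^r\to\mathbb T$ is extended by $\infty$ to tuples of all other
    lengths. A $\mathbb T$-matroid $[\mu]$ is handled through a representative;
    everything below is insensitive to rescaling $\mu$. *)
Definition is_gp (R : realType) (E : finType) (r : nat)
    (mu : seq E -> trop R) : Prop :=
  [/\ forall x, mu x != None -> size x = r,
      exists x, mu x != None,
      forall x y, perm_eq x y -> mu x = mu y,
      forall x, ~~ uniq x -> mu x = None
    & forall (e0 : E) (x y : seq E), size x = r.+1 -> (size y).+1 = r ->
        tnull [seq tmul (mu (take k x ++ drop k.+1 x)) (mu (nth e0 x k :: y))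
              | k <- iota 0 r.+1]].

Section Underlying.
Context {R : realType} {E : finType}.
Variable mu : seq E -> trop R.
Implicit Types A B F G : {set E}.

Definition basis B : bool := mu (enum B) != None.

Definition mrank A : nat := \max_(B : {set E} | basis B) #|A :&: B|.

Definition flat F : bool :=
  [forall e, (e \notin F) ==> (mrank F < mrank (e |: F))%N].

Definition cl A : {set E} := \bigcap_(F : {set E} | flat F && (A \subset F)) F.

Definition fmeet F G : {set E} := F :&: G.
Definition fjoin F G : {set E} := cl (F :|: G).

Definition modular : Prop := forall F G, flat F -> flat G ->
  (mrank F + mrank G = mrank (fjoin F G) + mrank (fmeet F G))%N.

(** If $B$ is a basis of $\underline M$ meeting $A$ in as many elements as
    possible, then $B\cap A$ is a basis of $\underline M|A$ and $B\setminus A$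
    a basis of $\underline M/A$. *)
Definition obasis_restr A : seq E :=
  if [pick B : {set E} | basis B && (#|A :&: B| == mrank A)] is Some B
  then enum (B :&: A) else [::].

Definition obasis_contr A : seq E :=
  if [pick B : {set E} | basis B && (#|A :&: B| == mrank A)] is Some B
  then enum (B :\: A) else [::].

Definition dual_gp (x : seq E) : trop R :=
  if uniq x then mu (enum [set e | e \notin x]) else None.

Definition is_circuit (X : {ffun E -> trop R}) : Prop :=
  exists (y : seq E) (c : R),
    [/\ uniq y, exists2 e, e \in y & mu (rem e y) != None
      & forall e, X e = tmul (Some c) (if e \in y then mu (rem e y) else None)].

End Underlying.

Definition is_vector (R : realType) (E : finType) (mu : seq E -> trop R)
    (X : {ffun E -> trop R}) : Prop :=
  forall Y : {ffun E -> trop R}, is_circuit (dual_gp mu) Y ->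
    tnull [seq tmul (X e) (Y e) | e <- enum E].

Section Cones.
Context {R : realType} {d : nat} {I : finType}.
Variable v : I -> 'rV[int]_d.

Definition in_cone (s : {set I}) (x : 'rV[R]_d) : Prop :=
  exists a : I -> R, (forall i, 0 <= a i) /\
    x = \sum_(i in s) a i *: map_mx intr (v i).

Definition is_face (s t : {set I}) : Prop :=
  exists m : 'cV[R]_d,
    (forall i, i \in s -> 0 <= (map_mx intr (v i) *m m) 0 0) /\
    t = [set i in s | (map_mx intr (v i) *m m) 0 0 == 0]%SET.

End Cones.

(** Here $L=\mathbb Z^d$ (row vectors) and $\Lambda=\mathrm{Hom}(L,\mathbb Z)$
    (column vectors). A cone is given by the set of its rays. *)
Record fan (R : realType) (d : nat) := Fan {
  ray : finType;
  gen : ray -> 'rV[int]_d;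
  cones : {set {set ray}};
  gen_primitive : forall rho (n : int) (w : 'rV[int]_d),
    gen rho = n *: w -> `|n| = 1;
  ray_cone : forall rho, [set rho]%SET \in cones;
  cone_pointed : forall s, s \in cones -> forall x : 'rV[R]_d,
    in_cone gen s x -> in_cone gen s (- x) -> x = 0;
  cone_face : forall s t, s \in cones -> is_face (R := R) gen s t -> t \in cones;
  cone_meet : forall s t, s \in cones -> t \in cones ->
    [/\ is_face (R := R) gen s (s :&: t), is_face (R := R) gen t (s :&: t)
      & forall x : 'rV[R]_d, in_cone gen s x -> in_cone gen t x ->
          in_cone gen (s :&: t) x]
}.
Arguments gen {R d}.

Definition complete_fan (R : realType) (d : nat) (S : fan R d) : Prop :=
  forall x : 'rV[R]_d, exists2 s, s \in cones S & in_cone (gen S) s x.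

Definition smooth_fan (R : realType) (d : nat) (S : fan R d) : Prop :=
  forall s, s \in cones S -> exists B : 'M[int]_d,
    B \in unitmx /\ forall rho, rho \in s -> exists i, gen S rho = row i B.

Definition pairing (d : nat) (u : 'cV[int]_d) (v : 'rV[int]_d) : int :=
  (v *m u) 0 0.

(** $h_\rho$ is the degree of the divisor $D_\rho$, e.g. $D_\rho\cdot H^{d-1}$
    with $H$ ample. The second condition says that the principal divisors
    $\mathrm{div}(\chi^u)=\sum_\rho\langle u,v_\rho\rangle D_\rho$ have degree
    $0$, i.e. that $h$ is a function on $\mathrm{Cl}(X_\Sigma)$. *)
Definition polarization (R : realType) (d : nat) (S : fan R d)
    (h : ray S -> int) : Prop :=
  (forall rho, 0 < h rho) /\
  (forall u : 'cV[int]_d, \sum_rho h rho * pairing u (gen S rho) = 0).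

(** [gs] is the ground set without the distinguished loop, [None] the
    distinguished loop. *)
Record tsheaf (R : realType) (d : nat) (S : fan R d) := TSheaf {
  gs : finType;
  gp : seq (option gs) -> trop R;
  fil : ray S -> int -> {set option gs}
}.
Arguments gp {R d S} t x.
Arguments fil {R d S} t rho j.

(** Modular tropical toric reflexive sheaves. Parallel elements are allowed:
    $M/F$ usually has some even when $M$ is simple, and quotients of sheaves
    have to be objects of the category. *)
Record is_mtrs (R : realType) (d : nat) (S : fan R d) (E : tsheaf S) : Prop :=
  IsMtrs {
  mtrs_gp : exists r, is_gp r (gp E);
  mtrs_point : forall x, None \in x -> gp E x = None;
  mtrs_loopless : forall e : gs E, mrank (gp E) [set Some e]%SET = 1%N;
  mtrs_modular : modular (gp E);
  mtrs_flat : forall rho j, flat (gp E) (fil E rho j);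
  mtrs_decr : forall rho j, fil E rho (j + 1) \subset fil E rho j;
  mtrs_bot : forall rho, exists j0 : int, forall j, j0 <= j ->
    fil E rho j = [set None]%SET;
  mtrs_top : forall rho, exists j0 : int, forall j, j <= j0 ->
    fil E rho j = [set: option (gs E)]%SET
}.

(** The $\mathbb T$-matroid on $\tilde E_M$ obtained by deleting $*_M$. *)
Definition del_point (R : realType) (d : nat) (S : fan R d) (E : tsheaf S)
    (x : seq (gs E)) : trop R := gp E (map Some x).
Arguments del_point {R d S} E x.

Definition restr (R : realType) (d : nat) (S : fan R d) (E : tsheaf S)
    (F : {set option (gs E)}) : tsheaf S :=
  let T : finType := {x : gs E | Some x \in F} in
  let emb : option T -> option (gs E) := omap val in
  @TSheaf R d S T
    (fun x => gp E (map emb x ++ obasis_contr (gp E) F))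
    (fun rho j => emb @^-1: fmeet F (fil E rho j)).
Arguments restr {R d S} E F.

Definition contr (R : realType) (d : nat) (S : fan R d) (E : tsheaf S)
    (F : {set option (gs E)}) : tsheaf S :=
  let T : finType := {x : gs E | Some x \notin F} in
  let emb : option T -> option (gs E) := omap val in
  @TSheaf R d S T
    (fun x => gp E (map emb x ++ obasis_restr (gp E) F))
    (fun rho j => emb @^-1: fjoin (gp E) F (fil E rho j)).
Arguments contr {R d S} E F.

(** $(\mathcal E|G)/F$ for flats $F\subseteq G$. *)
Definition subquo (R : realType) (d : nat) (S : fan R d) (E : tsheaf S)
    (F G : {set option (gs E)}) : tsheaf S :=
  contr (restr E G) (omap val @^-1: F).
Arguments subquo {R d S} E F G.

Definition srank (R : realType) (d : nat) (S : fan R d) (E : tsheaf S) : nat :=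
  mrank (gp E) [set: option (gs E)]%SET.

Definition sdeg (R : realType) (d : nat) (S : fan R d) (h : ray S -> int)
    (E : tsheaf S) : int :=
  \sum_rho h rho * \sum_(j \in [set: int]%classic)
    j * ((mrank (gp E) (fil E rho j))%:Z
         - (mrank (gp E) (fil E rho (j + 1)))%:Z).

Definition sslope (R : realType) (d : nat) (S : fan R d) (h : ray S -> int)
    (E : tsheaf S) : R := (sdeg h E)%:~R / (srank E)%:R.

Definition km_semistable (R : realType) (d : nat) (S : fan R d)
    (h : ray S -> int) (E : tsheaf S) : Prop :=
  srank E <> 0%N /\
  forall F, flat (gp E) F -> srank (restr E F) <> 0%N ->
    sslope h (restr E F) <= sslope h E.

(** Only $F_0,\dots,F_k$ are relevant. *)
Definition km_filtration (R : realType) (d : nat) (S : fan R d)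
    (h : ray S -> int) (E : tsheaf S) (k : nat)
    (F : nat -> {set option (gs E)}) : Prop :=
  [/\ forall i, (i <= k)%N -> flat (gp E) (F i),
      F 0%N = [set None]%SET /\ F k = [set: option (gs E)]%SET,
      forall i, (i < k)%N -> F i \subset F i.+1,
      forall i, (i < k)%N -> km_semistable h (subquo E (F i) (F i.+1))
    & forall i, (i.+1 < k)%N ->
        sslope h (subquo E (F i.+1) (F i.+2)) < sslope h (subquo E (F i) (F i.+1))].

Arguments km_filtration {R d S} h E k F.

(** Rows are indexed by [J], columns by [I]. *)
Definition tmatrix (R : realType) (J I : finType) := {ffun J * I -> trop R}.

Definition tzero (R : realType) (J I : finType) : tmatrix R J I :=
  [ffun=> None].

Definition tid (R : realType) (I : finType) : tmatrix R I I :=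
  [ffun p => if p.1 == p.2 then Some 0 else None].

Definition tmulmx (R : realType) (K J I : finType)
    (B : tmatrix R K J) (A : tmatrix R J I) : tmatrix R K I :=
  [ffun p => \big[@tmin R/None]_j tmul (B (p.1, j)) (A (j, p.2))].

Definition tapp (R : realType) (J I : finType) (A : tmatrix R J I)
    (X : {ffun I -> trop R}) : {ffun J -> trop R} :=
  [ffun j => \big[@tmin R/None]_i tmul (A (j, i)) (X i)].

Definition submonomial (R : realType) (J I : finType) (A : tmatrix R J I) :=
  (forall i j j', A (j, i) != None -> A (j', i) != None -> j = j') /\
  (forall j i i', A (j, i) != None -> A (j, i') != None -> i = i').

Definition under (R : realType) (J I : finType) (A : tmatrix R J I)
    (x : option I) : option J :=
  if x is Some i then [pick j | A (j, i) != None] else None.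

Record mtrs_ob (R : realType) (d : nat) (S : fan R d) := Mtrs {
  sheaf :> tsheaf S;
  sheafP : is_mtrs sheaf
}.

(** The pairs $(0,u)$, $u\in\Lambda$, all represent the zero morphism (else
    the category would not be pointed); $u=0$ is the normal form. *)
Record mtrs_hom (R : realType) (d : nat) (S : fan R d) (M N : mtrs_ob S) :=
  MtrsHom {
  hmat : tmatrix R (gs N) (gs M);
  hshift : 'cV[int]_d;
  hmat_submonomial : submonomial hmat;
  hmat_vector : forall X : {ffun gs M -> trop R},
    is_vector (del_point M) X ->
    is_vector (del_point N) (tapp hmat X);
  hmat_fil : forall rho (j : int),
    under hmat @: fil M rho j
      \subset fil N rho (j + pairing hshift (gen S rho));
  hshift_norm : hmat = tzero R (gs N) (gs M) -> hshift = 0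
}.

Record category := Category {
  ob :> Type;
  hom : ob -> ob -> Type;
  idm : forall x, hom x x;
  compose : forall x y z, hom y z -> hom x y -> hom x z;
  comp_idl : forall x y (f : hom x y), compose (idm y) f = f;
  comp_idr : forall x y (f : hom x y), compose f (idm x) = f;
  compA : forall x y z w (f : hom x y) (g : hom y z) (k : hom z w),
    compose k (compose g f) = compose (compose k g) f
}.
Arguments hom {c}.
Arguments idm {c}.
Arguments compose {c x y z}.

Section CategoryNotions.
Variable C : category.

Definition is_zero (Z : C) : Prop :=
  forall X : C, (exists! f : hom X Z, True) /\ (exists! f : hom Z X, True).

Definition is_zerom (X Y : C) (f : hom X Y) : Prop :=
  exists (Z : C) (a : hom X Z) (b : hom Z Y), is_zero Z /\ f = compose b a.

Definition is_mono (X Y : C) (f : hom X Y) : Prop :=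
  forall (W : C) (a b : hom W X), compose f a = compose f b -> a = b.

Definition is_iso (X Y : C) (f : hom X Y) : Prop :=
  exists g : hom Y X, compose g f = idm X /\ compose f g = idm Y.

Definition is_kernel (X Y : C) (f : hom X Y) (K : C) (k : hom K X) : Prop :=
  is_zerom (compose f k) /\
  forall (W : C) (a : hom W X), is_zerom (compose f a) ->
    exists! t : hom W K, compose k t = a.

Definition is_cokernel (X Y : C) (f : hom X Y) (Q : C) (q : hom Y Q) : Prop :=
  is_zerom (compose q f) /\
  forall (W : C) (a : hom Y W), is_zerom (compose a f) ->
    exists! t : hom Q W, compose t q = a.

Definition strict_mono (K X : C) (k : hom K X) : Prop :=
  exists (Y : C) (f : hom X Y), is_kernel f k.

Definition strict_epi (Y Q : C) (q : hom Y Q) : Prop :=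
  exists (X : C) (f : hom X Y), is_cokernel f q.

Definition is_pullback (X Y Z P : C) (f : hom X Z) (g : hom Y Z)
    (p : hom P X) (q : hom P Y) : Prop :=
  compose f p = compose g q /\
  forall (W : C) (a : hom W X) (b : hom W Y), compose f a = compose g b ->
    exists! t : hom W P, compose p t = a /\ compose q t = b.

Definition is_pushout (X Y Z P : C) (f : hom Z X) (g : hom Z Y)
    (p : hom X P) (q : hom Y P) : Prop :=
  compose p f = compose q g /\
  forall (W : C) (a : hom X W) (b : hom Y W), compose a f = compose b g ->
    exists! t : hom P W, compose t p = a /\ compose t q = b.

(** The axioms of a proto-abelian category except that morphisms with zero
    cokernel are epimorphisms. This one fails for modular tropical toric
    reflexive sheaves: for constant filtrations and trivially valued uniform
    matroids, the inclusion $U_{2,2}\to U_{2,3}$ has zero cokernel, but two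
    different injections $U_{2,3}\to U_{2,4}$ agree on $U_{2,2}$. *)
Definition quasi_proto_abelian : Prop :=
  [/\ exists Z : C, is_zero Z,
      (forall (X Y : C) (f : hom X Y), exists (K : C) (k : hom K X),
         is_kernel f k) /\
      (forall (X Y : C) (f : hom X Y), exists (Q : C) (q : hom Y Q),
         is_cokernel f q),
      forall (X Y : C) (f : hom X Y) (K : C) (k : hom K X),
        is_kernel f k -> is_zero K -> is_mono f,
      forall (X Y Z P : C) (f : hom X Z) (g : hom Y Z)
             (p : hom P X) (q : hom P Y),
        strict_epi f -> strict_mono g -> is_pullback f g p q -> strict_epi q
    & forall (X Y Z P : C) (f : hom Z X) (g : hom Z Y)
             (p : hom X P) (q : hom Y P),
        strict_mono f -> strict_epi g -> is_pushout f g p q -> strict_mono q].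

Record sub (M : C) := Sub { sdom : C; sarr : hom sdom M }.

Definition sub_le (M : C) (N N' : sub M) : Prop :=
  exists t : hom (sdom N) (sdom N'), compose (sarr N') t = sarr N.

Definition sub_eq (M : C) (N N' : sub M) : Prop := sub_le N N' /\ sub_le N' N.

Definition is_quotient (M : C) (N N' : sub M) (Q : C) : Prop :=
  exists (t : hom (sdom N) (sdom N')) (q : hom (sdom N') Q),
    compose (sarr N') t = sarr N /\ is_cokernel t q.

Definition noetherian (M : C) : Prop :=
  forall N : nat -> sub M, (forall i, strict_mono (sarr (N i))) ->
    (forall i, sub_le (N i) (N i.+1)) ->
    exists m, forall i, (m <= i)%N -> sub_eq (N i) (N m).

Definition artinian (M : C) : Prop :=
  forall N : nat -> sub M, (forall i, strict_mono (sarr (N i))) ->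
    (forall i, sub_le (N i.+1) (N i)) ->
    exists m, forall i, (m <= i)%N -> sub_eq (N i) (N m).

Definition is_intersection (M : C) (N1 N2 I : sub M) : Prop :=
  exists (p1 : hom (sdom I) (sdom N1)) (p2 : hom (sdom I) (sdom N2)),
    is_pullback (sarr N1) (sarr N2) p1 p2 /\ sarr I = compose (sarr N1) p1.

Definition is_sum (M : C) (N1 N2 S : sub M) : Prop :=
  exists (Q1 Q2 M' : C) (q1 : hom M Q1) (q2 : hom M Q2)
         (r1 : hom Q1 M') (r2 : hom Q2 M'),
    [/\ is_cokernel (sarr N1) q1, is_cokernel (sarr N2) q2,
        is_pushout q1 q2 r1 r2 & is_kernel (compose r1 q1) (sarr S)].

Section Slope.
Context {R : realType}.
(** The value of the slope function at zero objects is irrelevant. *)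
Variable mu : C -> R.

Definition iso_invariant : Prop :=
  forall (X Y : C) (f : hom X Y), ~ is_zero X -> is_iso f -> mu X = mu Y.

Definition strong_slope_inequality : Prop :=
  forall (M : C) (N1 N2 I S : sub M) (Q1 Q2 : C),
    strict_mono (sarr N1) -> strict_mono (sarr N2) ->
    is_intersection N1 N2 I -> is_sum N1 N2 S ->
    is_quotient I N1 Q1 -> is_quotient N2 S Q2 ->
    ~ is_zero Q1 -> ~ is_zero Q2 -> mu Q1 <= mu Q2.

Definition semistable (M : C) : Prop :=
  ~ is_zero M /\
  forall N : sub M, strict_mono (sarr N) -> ~ is_zero (sdom N) ->
    mu (sdom N) <= mu M.

(** Only $N_0,\dots,N_r$ are relevant. *)
Definition slope_filtration (M : C) (r : nat) (N : nat -> sub M) : Prop :=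
  [/\ forall i, (i <= r)%N -> strict_mono (sarr (N i)),
      is_zero (sdom (N 0%N)) /\ is_iso (sarr (N r)),
      forall i, (i < r)%N -> sub_le (N i) (N i.+1)
    & exists Q : nat -> C,
        [/\ forall i, (i < r)%N -> is_quotient (N i) (N i.+1) (Q i),
            forall i, (i < r)%N -> semistable (Q i)
          & forall i, (i.+1 < r)%N -> mu (Q i.+1) < mu (Q i)]].

End Slope.
End CategoryNotions.

Section MTRS.
Context {R : realType} {d : nat} {S : fan R d}.

Lemma bigtmin_neq0 (I : finType) (F : I -> trop R) :
  \big[@tmin R/None]_i F i != None -> exists i, F i != None.
Proof.
move=> h; case: (pickP (fun i => F i != None)) => [i hi|h0]; first by exists i.
move: h; rewrite big1 // => i _.
by move/eqP: (negbFE (h0 i)).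
Qed.

Lemma tmul_neq0 (a b : trop R) :
  (tmul a b != None) = (a != None) && (b != None).
Proof. by case: a b => [a|] [b|]. Qed.

Lemma tmulmx_neq0 (K J I : finType) (B : tmatrix R K J) (A : tmatrix R J I) k i :
  tmulmx B A (k, i) != None ->
  exists j, B (k, j) != None /\ A (j, i) != None.
Proof.
rewrite ffunE /= => /bigtmin_neq0 [j]; rewrite tmul_neq0 => /andP[hB hA].
by exists j.
Qed.

Lemma tmulmxA (L K J I : finType)
    (C : tmatrix R L K) (B : tmatrix R K J) (A : tmatrix R J I) :
  tmulmx C (tmulmx B A) = tmulmx (tmulmx C B) A.
Proof.
apply/ffunP=> -[l i]; rewrite !ffunE /=.
under eq_bigr do rewrite ffunE /= big_distrr /=.
rewrite exchange_big /=; apply: eq_bigr => j _.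
by rewrite ffunE /= big_distrl /=; apply: eq_bigr => k _; rewrite tmulA.
Qed.

Lemma tmulmx1l (J I : finType) (A : tmatrix R J I) : tmulmx (tid R J) A = A.
Proof.
apply/ffunP=> -[j i]; rewrite !ffunE /= (bigD1 j) //= ffunE /= eqxx tmul1l.
rewrite big1 ?Monoid.mulm1 // => k kj.
by rewrite ffunE /= eq_sym (negbTE kj) tmul0l.
Qed.

Lemma tmulmx1r (J I : finType) (A : tmatrix R J I) : tmulmx A (tid R I) = A.
Proof.
apply/ffunP=> -[j i]; rewrite !ffunE /= (bigD1 i) //= ffunE /= eqxx tmul1r.
rewrite big1 ?Monoid.mulm1 // => k ki.
by rewrite ffunE /= (negbTE ki) tmul0r.
Qed.

Lemma tmulmx0l (K J I : finType) (A : tmatrix R J I) :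
  tmulmx (tzero R K J) A = tzero R K I.
Proof.
by apply/ffunP=> -[k i]; rewrite !ffunE /= big1 // => j _; rewrite ffunE.
Qed.

Lemma tmulmx0r (K J I : finType) (B : tmatrix R K J) :
  tmulmx B (tzero R J I) = tzero R K I.
Proof.
apply/ffunP=> -[k i]; rewrite !ffunE /= big1 // => j _.
by rewrite ffunE tmul0r.
Qed.

Lemma tappM (K J I : finType) (B : tmatrix R K J) (A : tmatrix R J I) X :
  tapp (tmulmx B A) X = tapp B (tapp A X).
Proof.
apply/ffunP=> k; rewrite !ffunE.
under eq_bigr do rewrite ffunE /= big_distrl /=.
rewrite exchange_big /=; apply: eq_bigr => j _.
by rewrite ffunE big_distrr /=; apply: eq_bigr => i _; rewrite tmulA.
Qed.

Lemma tapp1 (I : finType) (X : {ffun I -> trop R}) : tapp (tid R I) X = X.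
Proof.
apply/ffunP=> j; rewrite !ffunE (bigD1 j) //= ffunE /= eqxx tmul1l.
rewrite big1 ?Monoid.mulm1 // => k kj.
by rewrite ffunE /= eq_sym (negbTE kj) tmul0l.
Qed.

Lemma submonomialM (K J I : finType) (B : tmatrix R K J) (A : tmatrix R J I) :
  submonomial B -> submonomial A -> submonomial (tmulmx B A).
Proof.
move=> [B1 B2] [A1 A2]; split.
  move=> i k k' /tmulmx_neq0 [j [hB hA]] /tmulmx_neq0 [j' [hB' hA']].
  by move: hB'; rewrite -(A1 _ _ _ hA hA') => hB'; apply: B1 hB hB'.
move=> k i i' /tmulmx_neq0 [j [hB hA]] /tmulmx_neq0 [j' [hB' hA']].
by move: hA'; rewrite -(B2 _ _ _ hB hB') => hA'; apply: A2 hA hA'.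
Qed.

Lemma submonomial1 (I : finType) : submonomial (tid R I).
Proof.
have tidP i j : tid R I (i, j) != None -> i = j.
  by rewrite ffunE /=; case: (i =P j).
by split=> i j k /tidP -> /tidP ->.
Qed.

Lemma under1 (I : finType) (x : option I) : under (tid R I) x = x.
Proof.
case: x => //= i; case: pickP => [j|/(_ i)]; rewrite ffunE /= ?eqxx //.
by case: (j =P i) => // ->.
Qed.

Lemma underE (J I : finType) (A : tmatrix R J I) i j :
  submonomial A -> A (j, i) != None -> under A (Some i) = Some j.
Proof.
move=> [A1 _] h /=; case: pickP => [j' h'|/(_ j)]; last by rewrite h.
by rewrite (A1 _ _ _ h h').
Qed.

Lemma underM (K J I : finType) (B : tmatrix R K J) (A : tmatrix R J I) x :
  submonomial B -> submonomial A ->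
  under (tmulmx B A) x = None \/ under (tmulmx B A) x = under B (under A x).
Proof.
move=> hB hA; case: x => [i|]; last by left.
rewrite [under (tmulmx B A) _]/under.
case: pickP => [k hk|_]; last by left.
right; have [j [kj ji]] := tmulmx_neq0 hk.
by rewrite (underE hA ji) (underE hB kj).
Qed.

Lemma fil_point (E : mtrs_ob S) rho j : None \in fil E rho j.
Proof.
have [_ pt _ _ hfl _ _ _] := sheafP E.
have /forallP/(_ None) := hfl rho j; apply: contraLR => hN.
rewrite hN /= -leqNgt; apply/bigmax_leqP => B hB.
suff -> : (None |: fil E rho j) :&: B = fil E rho j :&: B.
  exact: (leq_bigmax_cond (F := fun B => #|_ :&: B|)).
apply/setP=> x; rewrite !inE; case: eqP => //= ->; rewrite (negbTE hN) /=.
apply/negbTE; apply/negP => xB; move: hB; rewrite /basis.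
by rewrite pt // mem_enum.
Qed.

Lemma pairingD (u w : 'cV[int]_d) v : pairing (u + w) v = pairing u v + pairing w v.
Proof. by rewrite /pairing mulmxDr mxE. Qed.

Lemma pairing0 v : pairing (0 : 'cV[int]_d) v = 0.
Proof. by rewrite /pairing mulmx0 mxE. Qed.

Lemma mtrs_hom_eq (M N : mtrs_ob S) (f g : mtrs_hom M N) :
  hmat f = hmat g -> hshift f = hshift g -> f = g.
Proof.
case: f g => [A u ? ? ? ?] [B w ? ? ? ?] /= eA eu.
by subst; congr MtrsHom; apply: Prop_irrelevance.
Qed.

Section Compose.
Variables (M N P : mtrs_ob S) (g : mtrs_hom N P) (f : mtrs_hom M N).

Definition comp_mat := tmulmx (hmat g) (hmat f).
Definition comp_shift : 'cV[int]_d :=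
  if comp_mat == tzero R (gs P) (gs M) then 0 else hshift f + hshift g.

Lemma comp_vector (X : {ffun gs M -> trop R}) :
  is_vector (del_point M) X ->
  is_vector (del_point P) (tapp comp_mat X).
Proof. by move=> hX; rewrite tappM; do 2 apply: hmat_vector. Qed.

Lemma comp_fil rho (j : int) :
  under comp_mat @: fil M rho j
    \subset fil P rho (j + pairing comp_shift (gen S rho)).
Proof.
apply/fintype.subsetP=> _ /imsetP[x hx ->].
have [->|] := @underM _ _ _ (hmat g) (hmat f) x
  (hmat_submonomial g) (hmat_submonomial f); first exact: fil_point.
rewrite /comp_shift; case: eqP => [-> _|_ ->].
  case: x hx => [i|] _ /=; last exact: fil_point.
  by case: pickP => [k|_]; rewrite ?ffunE //; exact: fil_point.
rewrite pairingD addrA; apply: (fintype.subsetP (hmat_fil g rho _)); apply: imset_f.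
by apply: (fintype.subsetP (hmat_fil f rho _)); apply: imset_f.
Qed.

Lemma comp_norm : comp_mat = tzero R (gs P) (gs M) -> comp_shift = 0.
Proof. by rewrite /comp_shift => ->; rewrite eqxx. Qed.

Definition mtrs_comp : mtrs_hom M P :=
  MtrsHom (submonomialM (hmat_submonomial g) (hmat_submonomial f))
          comp_vector comp_fil comp_norm.

End Compose.

Section Identity.
Variable M : mtrs_ob S.

Lemma id_vector (X : {ffun gs M -> trop R}) :
  is_vector (del_point M) X ->
  is_vector (del_point M) (tapp (tid R (gs M)) X).
Proof. by rewrite tapp1. Qed.

Lemma id_fil rho (j : int) :
  under (tid R (gs M)) @: fil M rho j
    \subset fil M rho (j + pairing (0 : 'cV[int]_d) (gen S rho)).
Proof.
by rewrite pairing0 addr0; apply/fintype.subsetP=> _ /imsetP[x hx ->]; rewrite under1.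
Qed.

Definition mtrs_id : mtrs_hom M M :=
  MtrsHom (submonomial1 (gs M)) id_vector id_fil (fun=> erefl).

End Identity.

Lemma mtrs_idl (M N : mtrs_ob S) (f : mtrs_hom M N) :
  mtrs_comp (mtrs_id N) f = f.
Proof.
apply: mtrs_hom_eq; rewrite /= /comp_shift /comp_mat /= tmulmx1l //.
by case: eqP => [/hshift_norm-> //|_]; rewrite addr0.
Qed.

Lemma mtrs_idr (M N : mtrs_ob S) (f : mtrs_hom M N) :
  mtrs_comp f (mtrs_id M) = f.
Proof.
apply: mtrs_hom_eq; rewrite /= /comp_shift /comp_mat /= tmulmx1r //.
by case: eqP => [/hshift_norm-> //|_]; rewrite add0r.
Qed.

Lemma mtrs_compA (M N P Q : mtrs_ob S) (f : mtrs_hom M N) (g : mtrs_hom N P)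
    (k : mtrs_hom P Q) :
  mtrs_comp k (mtrs_comp g f) = mtrs_comp (mtrs_comp k g) f.
Proof.
have eA : comp_mat k (mtrs_comp g f) = comp_mat (mtrs_comp k g) f.
  exact: tmulmxA.
apply: mtrs_hom_eq => //=; rewrite /comp_shift -eA.
case: eqP => // nz; rewrite /= /comp_shift.
have /eqP/negbTE-> : comp_mat g f <> tzero R (gs P) (gs M).
  by move=> gf0; apply: nz; rewrite /comp_mat [hmat (mtrs_comp g f)]gf0 tmulmx0r.
have /eqP/negbTE-> : comp_mat k g <> tzero R (gs Q) (gs N).
  move=> kg0; apply: nz; rewrite eA /comp_mat.
  by rewrite [hmat (mtrs_comp k g)]kg0 tmulmx0l.
by rewrite addrA.
Qed.

End MTRS.

Definition MTRS (R : realType) (d : nat) (S : fan R d) : category :=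
  @Category (mtrs_ob S) (@mtrs_hom R d S) (@mtrs_id R d S) (@mtrs_comp R d S)
    (@mtrs_idl R d S) (@mtrs_idr R d S) (@mtrs_compA R d S).

Definition mtrs_slope (R : realType) (d : nat) (S : fan R d)
    (h : ray S -> int) (E : MTRS S) : R := sslope h (sheaf E).

Definition incl_mat (R : realType) (d : nat) (S : fan R d) (E : tsheaf S)
    (F : {set option (gs E)}) : tmatrix R (gs E) (gs (restr E F)) :=
  [ffun p => if p.1 == val p.2 then Some 0 else None].
Arguments incl_mat {R d S} E F.

(** [N] is $\mathcal E|F$ with its inclusion into $\mathcal E$. *)
Definition is_restriction (R : realType) (d : nat) (S : fan R d) (E : MTRS S)
    (F : {set option (gs (sheaf E))}) (N : sub E) : Prop :=
  exists (p : is_mtrs (restr E F)) (f : hom (Mtrs p : MTRS S) E),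
    [/\ N = Sub f, hmat f = incl_mat E F & hshift f = 0].
Arguments is_restriction {R d S} E F N.

(* Main.v *)
Require Import Defs.
From mathcomp Require Import all_boot all_order all_algebra.
From mathcomp Require Import boolp classical_sets fsbigop reals.
From mathcomp Require Import fintype finset zify lra.

Set Implicit Arguments.
Unset Strict Implicit.
Unset Printing Implicit Defensive.

Import Order.TTheory GRing.Theory Num.Theory.
Local Open Scope ring_scope.

(** The categorical axioms are checked by describing the category through flats,
    and the two filtrations are then the same chain of flats.

    The link between the category and the lattice of flats is the set of vectors.
    Every vector of a valuated matroid is a minimum of scaled circuits
    ([vec_circuit]); so flats, independent sets and ranks can be read off the
    vectors ([flat_vecP], [indep_vecP]), and vectors behave well under restriction
    and contraction ([evec_restr], [evec_contr], [evec_contr_lift]). In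
    particular a morphism pulls flats back to flats ([flat_preim]), and its kernel
    is the restriction to the preimage of the loop, while its cokernel is the
    contraction by the closure of its image. The strict monomorphisms are then
    the maps called embeddings below, and the strict epimorphisms the projections
    ([strict_monoP], [strict_epiP]). Strict subobjects of $\mathcal E$ are
    flats, which gives the chain conditions.

    Modularity enters through the modular law
    $F\vee(G\wedge E_j)=G\wedge(F\vee E_j)$ for $F\subseteq G$
    ([modular_law]): it says that restricting and then contracting gives the same
    filtration as contracting and then restricting, and this is the stability of
    strict epimorphisms under pullback and of strict monomorphisms under pushout
    ([pullback_projection], [pushout_embedding]). It also makes the degree
    additive along contractions and supermodular on flats, while the rank is
    modular ([contr_fdeg], [fdeg_supermod]); this is the strong slope inequality. Slopes are invariant
    under isomorphism, although these may shift the filtrations by a character,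
    because principal divisors have degree $0$ ([iso_sslope]).

    Finally, quotients of strict subobjects are the subquotients of pairs of flats
    ([quotient_iso]), and semistability means the same for both
    ([semistable_km]). Both kinds of filtration are therefore chains of flats with
    semistable steps of decreasing slopes. In a modular lattice with a
    supermodular degree exactly one such chain exists ([hn_chain_exists],
    [hn_chain_unique]): its first step is the largest flat of maximal slope. *)

(** * Tropical order and null sums *)

Section Tropical.
Context {R : realType}.
Implicit Types a b c : trop R.

Definition tle a b : bool :=
  if b is Some y then (if a is Some x then x <= y else false) else true.

Lemma tle_refl a : tle a a. Proof. by case: a => /=. Qed.

Lemma tle_trans b a c : tle a b -> tle b c -> tle a c.
Proof. by case: a b c => [x|] [y|] [z|] //=; exact: le_trans. Qed.

Lemma tle_anti a b : tle a b -> tle b a -> a = b.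
Proof. by case: a b => [x|] [y|] //= h1 h2; rewrite (le_anti (introT andP (conj h1 h2))). Qed.

Lemma tle_neq0 a b : tle a b -> b != None -> a != None.
Proof. by case: a b => [x|] [y|]. Qed.

Lemma tmulC : commutative (@tmul R).
Proof. by case=> [x|] [y|] //=; rewrite addrC. Qed.

Lemma tmulCA a b c : tmul a (tmul b c) = tmul b (tmul a c).
Proof. by rewrite !tmulA (tmulC a). Qed.

Lemma tle_mul a a' b b' : tle a a' -> tle b b' -> tle (tmul a b) (tmul a' b').
Proof. by case: a a' b b' => [x|] [x'|] [y|] [y'|] //=; exact: lerD. Qed.

Lemma tle_mull c a b : c != None -> tle (tmul c a) (tmul c b) = tle a b.
Proof. by case: c a b => [z|] [x|] [y|] //= _; rewrite lerD2l. Qed.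

(** The minimum of a family is attained twice, or the family is empty, iff no
    finite member is strictly below all the others; this form has no minimum
    in it and passes directly to rescalings and to pointwise minima. *)
Definition fnull (I : eqType) (f : I -> trop R) : Prop :=
  forall i, f i != None -> exists2 j, j != i & tle (f j) (f i).

Lemma pmap_id_some (s : seq (trop R)) (x : R) :
  (x \in pmap id s) = (Some x \in s).
Proof. by elim: s => //= -[y|] s IH /=; rewrite !inE IH. Qed.

Lemma count_pmap_id (s : seq (trop R)) (x : R) :
  count_mem x (pmap id s) = count_mem (Some x) s.
Proof. by elim: s => //= -[y|] s IH /=; rewrite IH. Qed.

Lemma count_gt1P (T : eqType) (x0 x : T) (s : seq T) :
  reflect (exists i j, [/\ (i < size s)%N, (j < size s)%N, i != j,
             nth x0 s i = x & nth x0 s j = x])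
          (2 <= count_mem x s)%N.
Proof.
have -> : count_mem x s = #|[set i : 'I_(size s) | nth x0 s i == x]|.
  rewrite -sum1_count (big_nth x0) big_mkord -sum1_card.
  by apply: eq_bigl => i; rewrite inE.
apply: (iffP card_gt1P) => [[i [j []]]|[i [j [hi hj ij ei ej]]]].
  rewrite !inE => /eqP ei /eqP ej ij.
  by exists (val i), (val j); split; rewrite ?ltn_ord.
exists (Ordinal hi), (Ordinal hj).
by rewrite !inE /= ei ej !eqxx -val_eqE.
Qed.

Lemma min_in_seq (s : seq R) : s != [::] -> exists2 a : R, a \in s & all (fun b : R => (a : R) <= b) s.
Proof.
elim: s => // a s IH _; case: (altP (s =P [::])) => [->|/IH [b bs hb]].
  by exists a; rewrite ?inE ?eqxx //= lexx.
case: (leP a b) => ab.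
  exists a; rewrite ?inE ?eqxx //= lexx /=.
  by apply/allP => c /(allP hb); exact: le_trans.
by exists b; rewrite ?inE ?bs ?orbT //= hb (ltW ab).
Qed.

Lemma tnull_nthP (s : seq (trop R)) : tnull s <-> fnull (nth None s).
Proof.
have nth_some k x : nth None s k = Some x -> x \in pmap id s.
  move=> e; rewrite pmap_id_some -e mem_nth // ltnNge.
  by apply/negP => h; rewrite nth_default in e.
split.
  move=> /orP[/eqP h|/hasP[a _ /andP[/allP ha hc]]] i.
    by case e: (nth None s i) => [x|] //; move: (nth_some _ _ e); rewrite h.
  have {hc} : (2 <= count_mem (Some a) s)%N by rewrite -count_pmap_id.
  move=> /(count_gt1P None)[j [k [_ _ jk ej ek]]].
  case e: (nth None s i) => [x|] // _; have {}ha := ha _ (nth_some _ _ e).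
  case: (altP (j =P i)) => [ji|]; last by exists j; rewrite // ej.
  by exists k; rewrite ?ek // -ji eq_sym.
move=> h; rewrite /tnull; case: (altP (pmap id s =P [::])) => //= /min_in_seq[a ha hall].
apply/hasP; exists a => //; rewrite hall /=.
suff : (2 <= count_mem (Some a) s)%N by rewrite -count_pmap_id.
apply/(count_gt1P None); rewrite pmap_id_some in ha.
have ea := nth_index None ha; set i := index _ _ in ea.
have [|j ji] := h i; first by rewrite ea.
rewrite ea; case ej: (nth None s j) => [b|] //= ba.
exists i, j; split=> //; rewrite ?index_mem //.
- by rewrite ltnNge; apply/negP => hs; rewrite nth_default in ej.
- by rewrite eq_sym.
by rewrite ej; congr Some; apply: le_anti; rewrite ba (allP hall) // (nth_some j).
Qed.

Lemma tnull_mapP (I : eqType) (f : I -> trop R) (s : seq I) : uniq s ->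
  tnull (map f s) <->
  forall i, i \in s -> f i != None -> exists2 j, (j \in s) && (j != i) & tle (f j) (f i).
Proof.
move=> us; rewrite tnull_nthP; split=> h i.
  move=> si fi; have e : nth None (map f s) (index i s) = f i.
    by rewrite (nth_map i) ?index_mem // nth_index.
  have [|k ki] := h (index i s); rewrite e //.
  case: (ltnP k (size s)) => ks; last by rewrite nth_default ?size_map //=; case: (f i) fi.
  rewrite (nth_map i) // => le; exists (nth i s k) => //.
  rewrite mem_nth //=; apply: contraNneq ki => <-.
  by rewrite index_uniq.
case: (ltnP i (size s)) => si; last by rewrite nth_default ?size_map.
have x0 : I by case: s {us h} si => [|x].
rewrite (nth_map x0) // => /(h _ (mem_nth x0 si))[j /andP[js ji] le].
exists (index j s); last by rewrite (nth_map x0) ?index_mem // nth_index.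
by apply: contraNneq ji => <-; rewrite nth_index.
Qed.

Lemma tnull_enumP (I : finType) (f : I -> trop R) :
  tnull [seq f e | e <- enum I] <-> fnull f.
Proof.
rewrite tnull_mapP ?enum_uniq //; split=> h i.
  by move=> /(h i (mem_enum _ _))[j /andP[_ ji] le]; exists j.
by move=> _ /h[j ji le]; exists j; rewrite ?mem_enum ?ji.
Qed.

End Tropical.

(** * Valuated matroids: exchange, rank and closure *)

Section Matroid.
Context {R : realType} {T : finType}.
Variables (mu : seq T -> trop R) (r : nat).
Hypothesis gpP : is_gp r mu.
Implicit Types (A B C D F G H I : {set T}) (X : T -> trop R).

Local Notation w B := (mu (enum B)).
Local Notation basis := (basis mu).
Local Notation rk := (mrank mu).

Lemma gp_size x : mu x != None -> size x = r. Proof. by case: gpP => h _ _ _ _; exact: h. Qed.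
Lemma gp_perm x y : perm_eq x y -> mu x = mu y. Proof. by case: gpP => _ _ h _ _; exact: h. Qed.
Lemma gp_uniq x : mu x != None -> uniq x.
Proof. by case: gpP => _ _ _ h _; apply: contraR => /h ->. Qed.

Lemma gp_set x A : uniq x -> x =i A -> mu x = w A.
Proof.
move=> ux xA; apply: gp_perm; apply: uniq_perm; rewrite ?enum_uniq //.
by move=> y; rewrite xA mem_enum.
Qed.

Lemma basis_card B : basis B -> #|B| = r.
Proof. by move=> /gp_size; rewrite -cardE. Qed.

Lemma gp_cons e C : mu (e :: enum C) = if e \in C then None else w (e |: C).
Proof.
case: ifP => eC.
  apply/eqP; apply: contraT => /gp_uniq /=; by rewrite mem_enum eC.
apply: gp_set; first by rewrite /= mem_enum eC enum_uniq.
by move=> y; rewrite !inE mem_enum.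
Qed.

Lemma basis_exists : exists B, basis B.
Proof.
have [_ [x hx] _ _ _] := gpP; exists [set y in x]; rewrite /Defs.basis.
by rewrite -(@gp_set x) // ?gp_uniq // => y; rewrite inE.
Qed.

(** The Grassmann--Pluecker relation of $B_1\cup i$ against $B_2\setminus i$:
    its term at $i$ is finite, so another term is at most as large. *)
Lemma exchange B1 B2 i : basis B1 -> basis B2 -> i \in B2 :\: B1 ->
  exists2 j, j \in B1 :\: B2 &
    tle (tmul (w (i |: B1 :\ j)) (w (j |: B2 :\ i))) (tmul (w B1) (w B2)).
Proof.
move=> b1 b2 /setDP[i2 i1].
have w1 : w B1 != None := b1; have w2 : w B2 != None := b2.
have [_ _ _ _ h] := gpP.
have sx : size (i :: enum B1) = r.+1 by rewrite /= -cardE basis_card.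
have sy : (size (enum (B2 :\ i))).+1 = r.
  by rewrite -cardE -(basis_card b2) (cardsD1 i B2) i2.
have /tnull_mapP := h i _ _ sx sy => /(_ (iota_uniq _ _) 0%N).
rewrite mem_iota /= drop0 gp_cons in_setD1 eqxx /= setD1K // => /(_ isT).
rewrite tmul_neq0 w1 w2 => /(_ isT)[k].
case/andP; rewrite -[_ :: _]/(iota 0 r.+1) mem_iota add0n; case: k => // k; rewrite ltnS => kr _ /=.
set j := nth i (enum B1) k.
have ks : (k < size (enum B1))%N by rewrite -cardE basis_card.
have j1 : j \in B1 by rewrite -mem_enum mem_nth.
have ji : j != i by apply: contraNneq i1 => <-.
rewrite gp_cons; case: ifP => j2; first
  by rewrite tmul0r => /tle_neq0; rewrite tmul_neq0 w1 w2 => /(_ isT).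
have -> : mu (i :: take k (enum B1) ++ drop k.+1 (enum B1)) = w (i |: B1 :\ j).
  have jk : k = index j (enum B1) by rewrite index_uniq ?enum_uniq.
  have -> : take k (enum B1) ++ drop k.+1 (enum B1) = rem j (enum B1).
    by rewrite jk -remE.
  apply: gp_set.
    rewrite /= rem_uniq ?enum_uniq // andbT.
    by apply: contra i1 => /mem_rem; rewrite mem_enum.
  by move=> y; rewrite !inE (mem_rem_uniq _ (enum_uniq _)) !inE mem_enum.
move=> le; exists j => //; rewrite inE j1 andbT.
by apply: contraFN j2 => jB2; rewrite !inE ji.
Qed.

(** Exchange [B] against a basis that is optimal for [C] and, among those,
    closest to the one being improved: the element that leaves cannot lie in
    [C], or the optimal basis could be brought closer. Keeping [B :&: C] is what
    lets one basis be optimal for all members of a chain of sets. *)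
Lemma basis_augment B C : basis B ->
  exists B', [/\ basis B', B :&: C \subset B', B' :\: C \subset B & #|C :&: B'| = rk C].
Proof.
move=> bB.
pose P B' := [&& basis B', B :&: C \subset B' & B' :\: C \subset B].
have PB : P B by rewrite /P bB subsetIl subsetDl.
case: (arg_maxnP (fun B' => #|C :&: B'|) PB) => B1 /and3P[b1 s1 t1] m1.
exists B1; split=> //; apply/eqP; rewrite eqn_leq.
rewrite (leq_bigmax_cond (F := fun B => #|C :&: B|)) //= leqNgt; apply/negP => lt.
have [B2 b2 e2] : exists2 B2, basis B2 & rk C = #|C :&: B2|.
  by have [B2] := eq_bigmax_cond (fun B => #|C :&: B|) (introT card_gt0P (ex_intro _ B bB)); exists B2.
pose Q B' := basis B' && (#|C :&: B'| == rk C).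
have Q2 : Q B2 by rewrite /Q b2 e2 /=.
case: (arg_maxnP (fun B' => #|B1 :&: B'|) Q2) => B3 /andP[b3 /eqP e3] m3.
have [i] : exists i, i \in (C :&: B3) :\: (C :&: B1).
  apply/set0Pn; rewrite setD_eq0; apply/negP => /subset_leq_card.
  by rewrite leqNgt e3 lt.
rewrite !inE => /andP[]; case iC : (i \in C) => //= i1 i3.
have [|j] := @exchange B1 B3 i b1 b3; first by rewrite !inE i1.
rewrite !inE => /andP[j3 j1] /tle_neq0; rewrite !tmul_neq0 -!/(Defs.basis mu _) b1 b3 => /(_ isT)/andP[b1' b3'].
have ij : i != j by apply: contraNneq i1 => ->.
have ji : j != i by rewrite eq_sym.
case jC : (j \in C).
  have := m3 (j |: B3 :\ i); rewrite /Q b3' /=.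
  have -> : #|C :&: (j |: B3 :\ i)| = rk C.
    have -> : C :&: (j |: B3 :\ i) = j |: (C :&: B3) :\ i.
      by apply/setP => x; rewrite !inE; case: eqP => [->|]; case: eqP => [->|]; rewrite ?jC ?iC ?(negbTE ji) //= ?andbF.
    by rewrite cardsU1 !inE (negbTE j3) !andbF -e3 (cardsD1 i (C :&: B3)) !inE iC i3.
  move=> /(_ (eqxx _)); apply/negP; rewrite -ltnNge; apply: proper_card; apply/properP; split.
    apply/subsetP => x; rewrite !inE => /andP[x1 x3]; rewrite x1 x3 andbT /=.
    by apply/orP; right; apply: contraTneq x1 => ->.
  by exists j; rewrite !inE ?j1 ?eqxx //= (negbTE j3).
have := m1 (i |: B1 :\ j); rewrite /P b1' /=.
have -> : (B :&: C \subset i |: B1 :\ j) && ((i |: B1 :\ j) :\: C \subset B).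
  apply/andP; split; apply/subsetP => x; rewrite !inE.
    move=> /andP[xB xC]; rewrite (subsetP s1) ?inE ?xB //.
    by case: (altP (x =P j)) xC => [->|]; rewrite ?jC ?orbT.
  move=> /andP[xC]; case: (altP (x =P i)) xC => [->|_ xC /=]; first by rewrite iC.
  by move=> /andP[_ x1]; rewrite (subsetP t1) // !inE xC.
move=> /(_ isT); apply/negP; rewrite -ltnNge; apply: proper_card; apply/properP; split.
  apply/subsetP => x; rewrite !inE => /andP[xC ->]; rewrite xC andbT /=.
  by apply/orP; right; apply: contraTneq xC => ->; rewrite jC.
by exists i; rewrite !inE ?iC ?eqxx //= (negbTE i1).
Qed.

Lemma rk_ge B A : basis B -> (#|A :&: B| <= rk A)%N.
Proof. by move=> bB; exact: (leq_bigmax_cond (F := fun B => #|A :&: B|)). Qed.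

Lemma basis_chain3 A C D : A \subset C -> C \subset D ->
  exists B, [/\ basis B, #|A :&: B| = rk A, #|C :&: B| = rk C & #|D :&: B| = rk D].
Proof.
move=> sAC CD; have [B0 b0] := basis_exists.
have [B1 [b1 _ _ e1]] := basis_augment A b0.
have [B2 [b2 s2 _ e2]] := basis_augment C b1.
have [B3 [b3 s3 _ e3]] := basis_augment D b2.
have keep A' C' B B' : A' \subset C' -> B :&: C' \subset B' -> basis B' ->
    #|A' :&: B| = rk A' -> #|A' :&: B'| = rk A'.
  move=> sA sB bB' e; apply/eqP; rewrite eqn_leq rk_ge //= -e subset_leq_card //.
  apply/subsetP => x; rewrite !inE => /andP[xA xB].
  by rewrite xA (subsetP sB) // inE xB (subsetP sA).
exists B3; split=> //; last exact: (keep _ _ _ _ CD s3).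
apply: (keep _ _ _ _ (subset_trans sAC CD) s3) => //.
exact: (keep _ _ _ _ sAC s2).
Qed.

Lemma basis_chain2 A C : A \subset C ->
  exists B, [/\ basis B, #|A :&: B| = rk A & #|C :&: B| = rk C].
Proof. by move=> sAC; have [B [? ? ? _]] := basis_chain3 sAC (subxx C); exists B. Qed.

Lemma basis_chain1 A : exists2 B, basis B & #|A :&: B| = rk A.
Proof. by have [B [? ? _]] := basis_chain2 (subxx A); exists B. Qed.

Lemma rkS A C : A \subset C -> (rk A <= rk C)%N.
Proof.
move=> sAC; have [B bB <-] := basis_chain1 A.
by apply: leq_trans (rk_ge C bB); apply: subset_leq_card; exact: setSI.
Qed.

Lemma rk_card A : (rk A <= #|A|)%N.
Proof. by have [B _ <-] := basis_chain1 A; rewrite subset_leq_card ?subsetIl. Qed.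

Lemma rkT : rk [set: T] = r.
Proof. by have [B bB <-] := basis_chain1 [set: T]; rewrite setTI basis_card. Qed.

Lemma rk_le_r A : (rk A <= r)%N. Proof. by rewrite -rkT rkS. Qed.

Lemma rk_submod A C : (rk (A :|: C) + rk (A :&: C) <= rk A + rk C)%N.
Proof.
have IU : A :&: C \subset A :|: C := subset_trans (subsetIl _ _) (subsetUl _ _).
have [B [bB e1 e2]] := basis_chain2 IU.
rewrite -e1 -e2; apply: leq_trans (leq_add (rk_ge A bB) (rk_ge C bB)).
by rewrite setIUl setIIl cardsUI.
Qed.

Lemma rkU_card A C : (rk (A :|: C) <= rk A + #|C|)%N.
Proof.
apply: leq_trans (leq_trans _ (rk_submod A C)) _; first exact: leq_addr.
by rewrite leq_add2l rk_card.
Qed.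

Lemma rkU1 e A : (rk (e |: A) <= (rk A).+1)%N.
Proof. by rewrite setUC -addn1 -(cards1 e) rkU_card. Qed.

Lemma basis_rk B : basis B = (#|B| == r) && (rk B == r).
Proof.
apply/idP/andP => [bB|[/eqP cB /eqP rB]].
  rewrite basis_card // eqxx; split=> //; rewrite eqn_leq rk_le_r.
  by rewrite -{1}(basis_card bB) -{1}(setIid B) rk_ge.
have [B' b' e] := basis_chain1 B.
suff -> : B = B' by [].
apply/eqP; rewrite eqEcard (basis_card b') -cB leqnn andbT; apply/setIidPl.
by apply/eqP; rewrite eqEcard subsetIl e rB cB leqnn.
Qed.

Lemma rk_absorb A C : (forall e, e \in C -> rk (e |: A) = rk A) -> rk (A :|: C) = rk A.
Proof.
move: {2}#|C| (leqnn #|C|) => n; elim: n C => [|n IH] C.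
  by rewrite leqn0 cards_eq0 => /eqP -> _; rewrite setU0.
case: (set_0Vmem C) => [-> _ _|[e eC]]; first by rewrite setU0.
rewrite (cardsD1 e) eC add1n ltnS => /IH {}IH h.
have {}IH : rk (A :|: C :\ e) = rk A by apply: IH => x /setD1P[_ /h].
apply/eqP; rewrite eqn_leq [X in _ && X]rkS ?subsetUl // andbT.
have := rk_submod (A :|: C :\ e) (e |: A); rewrite IH (h _ eC).
have -> : (A :|: C :\ e) :|: (e |: A) = A :|: C.
  apply/setP => x; rewrite !inE; case: eqP => [->|]; rewrite ?eC ?orbT //=.
  by case: (x \in A) => //=; rewrite orbF.
move=> le; rewrite -(leq_add2r (rk A)); apply: leq_trans le; rewrite leq_add2l.
by rewrite rkS // subsetI subsetUl subsetUr.
Qed.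

Definition span A : {set T} := [set e | rk (e |: A) == rk A].

Lemma sub_span A : A \subset span A.
Proof. by apply/subsetP => e eA; rewrite inE (setUidPr _) // sub1set. Qed.

Lemma rk_span A : rk (span A) = rk A.
Proof.
rewrite -[RHS](@rk_absorb A (span A)); last by move=> e; rewrite inE => /eqP.
by rewrite (setUidPr _) // sub_span.
Qed.

Lemma flatP F : reflect (forall e, rk (e |: F) = rk F -> e \in F) (flat mu F).
Proof.
apply: (iffP forallP) => h e.
  move=> re; apply: contraT => /(implyP (h e)); by rewrite re ltnn.
apply/implyP => /negP eF; rewrite ltn_neqAle rkS ?subsetU1 // andbT.
by apply/eqP => re; apply: eF; apply: h.
Qed.

Lemma span_flat A : flat mu (span A).
Proof.
apply/flatP => e; rewrite rk_span => h; rewrite inE eqn_leq [X in _ && X]rkS ?subsetU1 // andbT.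
by rewrite -h rkS // setUS // sub_span.
Qed.

Lemma span_min A F : flat mu F -> A \subset F -> span A \subset F.
Proof.
move=> /flatP hF AF; apply/subsetP => e; rewrite inE => /eqP he; apply: hF.
apply/eqP; rewrite eqn_leq [X in _ && X]rkS ?subsetU1 // andbT.
have := rk_submod F (e |: A); rewrite he.
have -> : F :|: (e |: A) = e |: F.
  by rewrite setUCA (setUidPl AF).
move=> le; rewrite -(leq_add2r (rk A)); apply: leq_trans le; rewrite leq_add2l.
by rewrite rkS // subsetI AF subsetUr.
Qed.

Lemma clE A : cl mu A = span A.
Proof.
apply/eqP; rewrite eqEsubset; apply/andP; split.
  by apply: bigcap_inf; rewrite span_flat sub_span.
by apply/bigcapsP => F /andP[fF AF]; exact: span_min.
Qed.

Lemma cl_flat A : flat mu (cl mu A). Proof. by rewrite clE span_flat. Qed.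
Lemma sub_cl A : A \subset cl mu A. Proof. by rewrite clE sub_span. Qed.
Lemma cl_min A F : flat mu F -> A \subset F -> cl mu A \subset F.
Proof. by rewrite clE; exact: span_min. Qed.
Lemma rk_cl A : rk (cl mu A) = rk A. Proof. by rewrite clE rk_span. Qed.

Lemma clS A C : A \subset C -> cl mu A \subset cl mu C.
Proof. by move=> sAC; apply: cl_min (cl_flat _) (subset_trans sAC (sub_cl _)). Qed.

Lemma cl_id F : flat mu F -> cl mu F = F.
Proof. by move=> fF; apply/eqP; rewrite eqEsubset sub_cl cl_min. Qed.

Lemma mem_cl A e : (e \in cl mu A) = (rk (e |: A) == rk A).
Proof. by rewrite clE inE. Qed.

Lemma rkU_cl A C : rk (cl mu A :|: C) = rk (A :|: C).
Proof.
apply/eqP; rewrite eqn_leq [X in _ && X]rkS ?setSU ?sub_cl // andbT.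
rewrite -(rk_cl (A :|: C)) rkS // subUset (subset_trans (subsetUr A C)) ?sub_cl //.
by rewrite clS // subsetUl.
Qed.

Lemma flatI F G : flat mu F -> flat mu G -> flat mu (F :&: G).
Proof.
move=> fF fG; suff <- : cl mu (F :&: G) = F :&: G by exact: cl_flat.
by apply/eqP; rewrite eqEsubset sub_cl subsetI !cl_min ?subsetIl ?subsetIr.
Qed.

Lemma flatT : flat mu [set: T]. Proof. by apply/flatP => e; rewrite inE. Qed.

Lemma flat_rk_lt F G : flat mu F -> F \proper G -> (rk F < rk G)%N.
Proof.
move=> /flatP fF /properP[FG [x xG xF]].
rewrite ltn_neqAle rkS // andbT; apply: contra xF => /eqP e; apply: fF.
by apply/eqP; rewrite eqn_leq [X in _ && X]rkS ?subsetU1 // andbT e rkS // subUset sub1set xG.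
Qed.

Lemma flat_rk_eq F G : flat mu F -> F \subset G -> (rk G <= rk F)%N -> F = G.
Proof.
move=> fF FG le; apply/eqP; apply: contraT => ne.
by move: (flat_rk_lt fF (G := G)); rewrite properEneq ne FG ltnNge le => /(_ isT).
Qed.

(** ** Modular lattices of flats *)

Section Modular.
Hypothesis modP : modular mu.

Lemma modular_rk F G : flat mu F -> flat mu G ->
  (rk F + rk G = rk (F :|: G) + rk (F :&: G))%N.
Proof. by move=> fF fG; rewrite (modP fF fG) /fjoin rk_cl. Qed.

Lemma modular_rk3 F G H : flat mu F -> flat mu G -> flat mu H -> F \subset G ->
  (rk (F :|: (G :&: H)) + rk (F :&: H) = rk F + rk (G :&: H))%N.
Proof.
move=> fF fG fH FG; rewrite (modular_rk fF (flatI fG fH)) setIA (setIidPl FG) //.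
Qed.

(** Both sides are flats, one inclusion is formal, and the ranks agree. *)
Lemma modular_law F G H : flat mu F -> flat mu G -> flat mu H -> F \subset G ->
  cl mu (F :|: (G :&: H)) = G :&: cl mu (F :|: H).
Proof.
move=> fF fG fH FG; apply: flat_rk_eq; first exact: cl_flat.
  rewrite subsetI cl_min // ?subUset ?FG ?subsetIl //.
  by rewrite clS // setUS // subsetIr.
have e1 := modular_rk fG (cl_flat (F :|: H)).
have e2 : rk (G :|: cl mu (F :|: H)) = rk (G :|: H).
  by rewrite setUC rkU_cl setUAC (setUidPr FG) .
have e3 := modular_rk fF fH; have e4 := modular_rk fG fH.
have e5 := modular_rk3 fF fG fH FG.
move: e1; rewrite e2 rk_cl => e1; rewrite rk_cl.
by lia.
Qed.

End Modular.
End Matroid.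

(** * Vectors of a valuated matroid *)

Section TropicalMin.
Context {R : realType} {K : finType}.

Lemma tle_bigmin (F : K -> trop R) k : tle (\big[@tmin R/None]_k F k) (F k).
Proof.
rewrite (bigD1 k) //=; case: (F k) => [x|] //.
by case: (\big[_/_]_(_ | _) _) => [y|] //=; rewrite ge_min lexx.
Qed.

Lemma bigmin_attained (F : K -> trop R) :
  \big[@tmin R/None]_k F k != None -> exists k, \big[@tmin R/None]_k F k = F k.
Proof.
move=> nz; suff [//|[k e]] : \big[@tmin R/None]_k F k = None \/
    exists k, \big[@tmin R/None]_k F k = F k; [by move=> e; rewrite e in nz|by exists k|].
elim/big_rec: _ => [|k x _ [->|[l ->]]]; first by left.
  by right; exists k; case: (F k).
case ea: (F k) => [a|]; case eb: (F l) => [b|] /=; last by left.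
- by right; case: (leP a b) => _; [exists k; rewrite ea|exists l; rewrite eb].
- by right; exists k; rewrite ea.
- by right; exists l; rewrite eb.
Qed.

End TropicalMin.

Section Vectors.
Context {R : realType} {T : finType}.
Variables (mu : seq T -> trop R) (r : nat).
Hypothesis gpP : is_gp r mu.
Implicit Types (A B C F G I : {set T}) (X : T -> trop R).

Local Notation w B := (mu (enum B)).
Local Notation basis := (basis mu).
Local Notation rk := (mrank mu).

(** The functions $e\mapsto\mu(e,\mathbf c)$ are, up to scaling, the circuits
    of the dual, together with the zero function. *)
Definition vec X : Prop :=
  forall C, fnull (fun e => tmul (X e) (mu (e :: enum C))).

Definition circ A : T -> trop R := fun e => if e \in A then w (A :\ e) else None.

(** Orthogonality of the circuit of $A$ and the cocircuit of $C$ is the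
    exchange property of the bases $A\setminus i$ and $C\cup i$. *)
Lemma circ_vec A : vec (circ A).
Proof.
move=> C i; rewrite /circ (gp_cons gpP) //; case: ifP => iA; last by rewrite tmul0l.
case: ifP => iC; rewrite ?tmul0r // => nz.
have /andP[b1 b2] : basis (A :\ i) && basis (i |: C) by rewrite /Defs.basis -tmul_neq0.
have [|j] := exchange gpP b1 b2 (i := i); first by rewrite !inE eqxx.
rewrite !inE => /andP[jC /andP[ji jA]] le; exists j => //.
rewrite (gp_cons gpP) // jA; move: jC; rewrite (negbTE ji) /= => /negbTE jC; rewrite jC.
move: le; have -> : i |: A :\ i :\ j = A :\ j.
  by apply/setP => x; rewrite !inE; case: eqP => [->|]; rewrite ?iA ?(eq_sym i) ?ji //= andbC.
by have -> // : (i |: C) :\ i = C by rewrite setU1K ?iC.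
Qed.

Lemma vec_scale (c : R) X : vec X -> vec (fun e => tmul (Some c) (X e)).
Proof.
move=> vX C i; rewrite -tmulA => h; have [|j ji le] := vX C i.
  by move: h; rewrite !tmul_neq0 /=.
by exists j => //; rewrite -!tmulA tle_mull.
Qed.

Lemma vec_bigmin (K : finType) (X : K -> T -> trop R) : (forall k, vec (X k)) ->
  vec (fun e => \big[@tmin R/None]_k X k e).
Proof.
move=> vX C i; rewrite tmul_neq0 => /andP[mz nz].
have [k ek] := bigmin_attained mz; rewrite ek in mz *.
have [|j ji le] := vX k C i; first by rewrite tmul_neq0 mz.
exists j => //; apply: tle_trans le.
by apply: tle_mul; [exact: tle_bigmin|exact: tle_refl].
Qed.

(** After rescaling the matroid by $X$, take a basis with as many elements as
    possible in the support of $X$ and, among those, of least value.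
    Orthogonality of $X$ to the cocircuit of $B\setminus e$ produces such a basis
    that avoids $e$; the fundamental circuit of $e$ lies above $X$ because that
    basis has least value. Hence every vector is a minimum of scaled circuits,
    and statements about vectors reduce to circuits. *)
Lemma vec_circuit X e : vec X -> X e != None ->
  exists A (c : R), [/\ circ A e != None, X e = tmul (Some c) (circ A e)
    & forall f, tle (X f) (tmul (Some c) (circ A f))].
Proof.
move=> vX Xe.
have [S inS] : exists S : {set T}, forall f, (f \in S) = (X f != None).
  by exists [set f | X f != None] => f; rewrite inE.
pose x f : R := odflt 0 (X f).
pose v B : R := odflt 0 (w B) + \sum_(b in B) x b.
pose P B := basis B && (#|S :&: B| == rk S).
have xE f : f \in S -> X f = Some (x f).
  by rewrite inS /x; case: (X f).
have wE B : basis B -> w B = Some (odflt 0 (w B)).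
  by rewrite /Defs.basis; case: (mu _).
have eS : e \in S by rewrite inS.
suff [B [PB minB eB]] : exists B, [/\ P B, forall B', P B' -> v B <= v B' & e \notin B].
  have /andP[bB /eqP sB] := PB.
  have circe : circ (e |: B) e = w B by rewrite /circ setU11 setU1K.
  exists (e |: B), (x e - odflt 0 (w B)); rewrite circe; split=> //.
    by rewrite (wE _ bB) (xE e) //= subrK.
  move=> f; have [->|fe] := eqVneq f e.
    by rewrite circe (wE _ bB) (xE e) //= subrK.
  rewrite /circ !inE (negbTE fe) /=; case: ifP => fB; last by case: (X f).
  set B' := (e |: B) :\ f; case wB' : (w B') => [y|]; last by case: (X f).
  have bB' : basis B' by rewrite /Defs.basis wB'.
  have SB' : S :&: B' = (e |: (S :&: B)) :\ f.
    apply/setP => z; rewrite !inE.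
    by have [->|_] := eqVneq z e; rewrite ?eS ?andbT //= andbCA.
  have := rk_ge S bB'; rewrite SB' -sB.
  have eSB : e \notin S :&: B by rewrite inE (negbTE eB) andbF.
  have cU : #|e |: S :&: B| = #|S :&: B|.+1 by rewrite cardsU1 eSB.
  have [fS _|fS] := boolP (f \in S); last first.
    have -> : (e |: S :&: B) :\ f = e |: S :&: B.
      by apply/setDidPl; rewrite disjoint_sym disjoints1 !inE negb_or fe negb_and fS.
    by rewrite cU ltnn.
  have PB' : P B'.
    rewrite /P bB' SB' -sB /=; have := cardsD1 f (e |: S :&: B).
    by rewrite cU !inE fB andbT (negbTE fe) fS /= add1n => -[->].
  have e1 : \sum_(b in e |: B) x b = x e + \sum_(b in B) x b by rewrite big_setU1.
  have e2 : \sum_(b in e |: B) x b = x f + \sum_(b in B') x b.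
    by rewrite (big_setD1 f) // !inE fB orbT.
  have := minB _ PB'; rewrite (xE f fS) /v wB' /=; lra.
have [B0 b0 s0] := basis_chain1 gpP S.
have P0 : P B0 by rewrite /P b0 s0 eqxx.
have [B PB minB] : exists2 B, P B & forall B', P B' -> v B <= v B'.
  by case: (Order.TotalTheory.arg_minP v P0) => B PB minB; exists B.
have /andP[bB /eqP sB] := PB.
case: (boolP (e \in B)) => eB; last by exists B.
have [|j je] := vX (B :\ e) e.
  by rewrite tmul_neq0 Xe (gp_cons gpP) // !inE eqxx /= setD1K.
rewrite !(gp_cons gpP) // !inE eqxx /= setD1K //; case: ifP => jB.
  by rewrite tmul0r; move: Xe bB; rewrite /Defs.basis; case: (X e) => // ? _; case: (mu _).
set B' := j |: B :\ e => le.
have : tmul (X j) (w B') != None by apply: tle_neq0 le _; rewrite tmul_neq0 Xe.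
rewrite tmul_neq0 => /andP[jX bB'].
have jS : j \in S by rewrite inS.
have jB0 : j \notin B by apply: contraFN jB => ->; rewrite je.
have eSB : e \in S :&: B by rewrite inE eS.
exists B'; split.
- rewrite /P /Defs.basis bB' -sB /=.
  have -> : S :&: B' = j |: (S :&: B) :\ e.
    apply/setP => z; rewrite !inE; case: (eqVneq z j) => [->|] //=; last by rewrite andbCA.
    by rewrite jS.
  by rewrite cardsU1 !inE (negbTE jB0) !andbF (cardsD1 e (S :&: B)) eSB.
- move=> B2 /minB; apply: le_trans; rewrite /v.
  rewrite (big_setD1 e eB) /= big_setU1 /=; last by rewrite !inE (negbTE jB0) andbF.
  by move: le; rewrite (xE j) // (xE e) // (wE _ bB) (wE _ bB') /=; lra.
- by rewrite !inE eqxx /= orbF eq_sym.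
Qed.

Lemma fundamental_circuit A e : e \notin A -> rk (e |: A) = rk A ->
  exists2 X, vec X & X e != None /\ forall f, X f != None -> f \in e |: A.
Proof.
move=> eA re; have [B bB sB] := basis_chain1 gpP A.
have eB : e \notin B.
  apply/negP => eB; have := rk_ge (e |: A) bB; rewrite re -sB.
  have -> : (e |: A) :&: B = e |: (A :&: B).
    by apply/setP => z; rewrite !inE; case: eqP => [->|].
  by rewrite cardsU1 !inE (negbTE eA) ltnn.
exists (circ (e |: B)); first exact: circ_vec.
split; first by rewrite /circ setU11 setU1K.
move=> f; rewrite /circ !inE; have [//|fe /=] := eqVneq f e.
case: ifP => // fB bB'; apply: contraT => fA.
have := rk_ge (e |: A) bB'; rewrite re -sB.
suff -> : (e |: A) :&: ((e |: B) :\ f) = e |: (A :&: B).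
  by rewrite cardsU1 !inE (negbTE eA) ltnn.
apply/setP => z; rewrite !inE; have [->|_ /=] := eqVneq z e; first by rewrite eq_sym fe.
by have [->|//] := eqVneq z f; rewrite (negbTE fA).
Qed.

(** Left to right, $X$ is orthogonal to the cocircuit of a hyperplane that
    contains $F$ and avoids $e$; right to left, an element of the closure has a
    fundamental circuit. The point is that flats depend on the set of vectors
    only, so that maps of vectors act on flats. *)
Lemma flat_vecP F : flat mu F <->
  forall X, vec X -> forall e, e \notin F -> X e != None ->
    exists e', [/\ e' != e, e' \notin F & X e' != None].
Proof.
split=> [fF X vX e eF Xe|h]; last first.
  apply/(flatP gpP) => e re; apply: contraT => eF.
  have [X vX [Xe sX]] := fundamental_circuit eF re.
  have [f [fe fF /sX]] := h _ vX _ eF Xe.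
  by rewrite !inE (negbTE fe) (negbTE fF).
have [B [bB sF seF]] := basis_chain2 gpP (subsetU1 e F).
have lt : (rk F < rk (e |: F))%N by move/forallP/(_ e)/implyP: fF; apply.
have eB : e \in B.
  apply: contraTT lt => eB; rewrite -sF -seF -leqNgt subset_leq_card //.
  apply/subsetP => x; rewrite !inE => /andP[/orP[/eqP->|->] //].
  by rewrite (negbTE eB).
have [|j je le] := vX (B :\ e) e; first by rewrite tmul_neq0 Xe (gp_cons gpP) // !inE eqxx /= setD1K.
have : tmul (X j) (mu (j :: enum (B :\ e))) != None.
  by apply: tle_neq0 le _; rewrite tmul_neq0 Xe (gp_cons gpP) // !inE eqxx /= setD1K.
rewrite tmul_neq0 (gp_cons gpP) //; case: ifP => jB; rewrite ?andbF // => /andP[Xj bB'].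
exists j; split=> //; apply/negP => jF.
have := rk_ge F bB'; rewrite -sF.
have -> : F :&: (j |: B :\ e) = j |: (F :&: B).
  apply/setP => z; rewrite !inE; have [->|_ /=] := eqVneq z j; first by rewrite jF.
  by have [->|] := eqVneq z e; rewrite //= (negbTE eF).
have jB0 : j \notin B by apply: contraFN jB => jB0; rewrite !inE je.
by rewrite cardsU1 !inE (negbTE jB0) andbF ltnn.
Qed.

(** Ranks are recovered from the vectors in the same way. *)
Lemma indep_vecP A : rk A = #|A| <->
  forall X, vec X -> (forall e, X e != None -> e \in A) -> forall e, X e = None.
Proof.
split=> [rA X vX sX e|h].
  apply/eqP; apply: contraT => Xe; have eA := sX e Xe.
  have [B bB sB] := basis_chain1 gpP A.
  have AB : A \subset B by apply/setIidPl/eqP; rewrite eqEcard subsetIl sB rA leqnn.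
  have eB := subsetP AB _ eA.
  have nz : tmul (X e) (mu (e :: enum (B :\ e))) != None.
    by rewrite tmul_neq0 Xe (gp_cons gpP) // !inE eqxx /= setD1K.
  have [j je /tle_neq0/(_ nz)] := vX (B :\ e) e nz.
  rewrite tmul_neq0 => /andP[/sX/(subsetP AB) jB].
  by rewrite (gp_cons gpP) // !inE je jB.
apply/eqP; rewrite eqn_leq (rk_card gpP) /= leqNgt; apply/negP => lt.
have [B bB sB] := basis_chain1 gpP A.
have [e eA eB] : exists2 e, e \in A & e \notin B.
  apply/subsetPn; apply: contraTN lt => AB.
  by rewrite -sB (setIidPl AB) ltnn.
have re : rk (e |: A :\ e) = rk (A :\ e).
  apply/eqP; rewrite eqn_leq [X in _ && X](rkS gpP) ?subsetU1 // andbT setD1K // -sB.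
  apply: leq_trans (rk_ge (A :\ e) bB); rewrite subset_leq_card //.
  apply/subsetP => x; rewrite !inE => /andP[-> xB]; rewrite xB !andbT.
  by apply: contraTneq xB => ->.
have [|X vX [Xe sX]] := @fundamental_circuit (A :\ e) e _ re; first by rewrite !inE eqxx.
by move/eqP: Xe; apply; apply: h => // f /sX; rewrite setD1K.
Qed.

Lemma rk_indep A : exists I, [/\ I \subset A, #|I| = rk A & rk I = #|I|].
Proof.
have [B bB sB] := basis_chain1 gpP A; exists (A :&: B); split=> //; first exact: subsetIl.
apply/eqP; rewrite eqn_leq (rk_card gpP) //=.
by apply: leq_trans (rk_ge _ bB); rewrite -setIA setIid.
Qed.

End Vectors.

(** * Minors *)

Section Minor.
Context {R : realType} {T T' : finType}.
Variables (mu : seq T -> trop R) (r : nat).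
Hypothesis gpP : is_gp r mu.
Variables (emb : T' -> T) (p : {set T}) (B0 : {set T}).
Hypotheses (emb_inj : injective emb) (emb_p : forall x, emb x \notin p).
Hypotheses (bB0 : basis mu B0) (pB0 : p \subset B0) (B0p : B0 \subset emb @: setT :|: p).
Implicit Types (A B C : {set T'}).

(** Minors fix part of a basis: restrictions to a flat and contractions are the
    cases in which [p] is a basis of the contraction, or of the restriction. *)
Definition minor (x : seq T') : trop R := mu (map emb x ++ enum p).

Lemma uniq_emb_p x : uniq x -> uniq (map emb x ++ enum p).
Proof.
move=> ux; rewrite cat_uniq map_inj_uniq // ux enum_uniq andbT /=.
by apply/hasPn => y; rewrite mem_enum => yp; apply/mapP => -[z _ e]; move: (emb_p z); rewrite -e yp.
Qed.

Lemma minor_set A : minor (enum A) = mu (enum (emb @: A :|: p)).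
Proof.
apply: (gp_set gpP); first exact: (uniq_emb_p (enum_uniq _)).
move=> y; rewrite mem_cat inE mem_enum; congr (_ || _).
by apply/mapP/imsetP => -[z]; rewrite ?mem_enum => zA ->; exists z; rewrite ?mem_enum.
Qed.

Lemma minor_cons e A : minor (e :: enum A) = mu (emb e :: enum (emb @: A :|: p)).
Proof.
rewrite [RHS](gp_cons gpP) in_setU mem_imset // (negbTE (emb_p e)) orbF.
case: ifP => eA.
  by apply/eqP; apply: contraT => /(gp_uniq gpP) /=; rewrite mem_cat map_f // mem_enum.
apply: (gp_set gpP); first by apply: (@uniq_emb_p (e :: enum A)); rewrite /= mem_enum eA enum_uniq.
move=> y; rewrite /= !inE mem_cat mem_enum; congr [|| _, _ | _].
by apply/mapP/imsetP => -[z]; rewrite ?mem_enum => zA ->; exists z; rewrite ?mem_enum.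
Qed.

Lemma minor_basis A : basis minor A = basis mu (emb @: A :|: p).
Proof. by rewrite /basis minor_set. Qed.

Lemma sub_emb_p (B : {set T}) : p \subset B -> B \subset emb @: setT :|: p ->
  emb @: (emb @^-1: B) :|: p = B.
Proof.
move=> pB Bp; apply/setP => x; rewrite inE; apply/orP/idP.
  case=> [/imsetP[z]|/(subsetP pB) //]; by rewrite inE => zB ->.
move=> xB; have := subsetP Bp x xB; rewrite inE => /orP[/imsetP[z _ e]|]; last by right.
by left; rewrite e imset_f // inE -e.
Qed.

Lemma minor_gp : is_gp (r - #|p|) minor.
Proof.
split.
- move=> x /(gp_size gpP); rewrite size_cat size_map -cardE => <-.
  by rewrite addnK.
- exists (enum (emb @^-1: B0)).
  by rewrite minor_set sub_emb_p.
- by move=> x y xy; apply: (gp_perm gpP); rewrite perm_cat2r perm_map.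
- move=> x ux; apply/eqP; apply: contraT => /(gp_uniq gpP).
  by rewrite cat_uniq map_inj_uniq // (negbTE ux).
move=> e0 x y sx sy; have [_ _ _ _ h] := gpP.
(* The relation for the minor is the one for $\mathbf x,\mathbf p$ and
   $\mathbf y,\mathbf p$: the terms that move an element of [p] vanish, the
   element being repeated in the second factor. *)
have pr : (#|p| <= r)%N by rewrite -(basis_card gpP bB0) subset_leq_card.
have sxp : size (map emb x ++ enum p) = r.+1.
  by rewrite size_cat size_map sx -cardE addSn subnK.
have syp : (size (map emb y ++ enum p)).+1 = r.
  by rewrite size_cat size_map -cardE -addSn sy subnK.
have /tnull_mapP := h (emb e0) _ _ sxp syp => /(_ (iota_uniq _ _)) {}h.
apply/tnull_mapP; first exact: iota_uniq.
have termE k : (k < size x)%N ->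
  tmul (minor (take k x ++ drop k.+1 x)) (minor (nth e0 x k :: y)) =
  tmul (mu (take k (map emb x ++ enum p) ++ drop k.+1 (map emb x ++ enum p)))
       (mu (nth (emb e0) (map emb x ++ enum p) k :: map emb y ++ enum p)).
  move=> kx; rewrite /minor map_cat map_take map_drop /= nth_cat size_map kx (nth_map e0) //.
  by rewrite take_cat drop_cat !size_map kx -catA; case: ltnP => // kx2;
     rewrite (@drop_oversize _ _ (map emb x)) ?size_map // (_ : (k.+1 - size x = 0)%N) ?drop0 //; lia.
move=> i; rewrite mem_iota add0n -sx => /andP[_ ix]; rewrite termE // => nz.
have [|j /andP[]] := h i _ nz; first by rewrite mem_iota add0n -sxp size_cat size_map ltn_addr.
rewrite mem_iota add0n -sxp => /andP[_ jx] ji le.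
have jx' : (j < size x)%N.
  rewrite ltnNge; apply/negP => xj; move/tle_neq0: le => /(_ nz).
  rewrite tmul_neq0 => /andP[_ /(gp_uniq gpP)] /=; rewrite nth_cat size_map ltnNge xj /=.
  rewrite mem_cat mem_nth ?orbT //.
  by move: jx; rewrite size_cat size_map ltn_subLR.
by exists j; rewrite ?termE // mem_iota add0n jx'.
Qed.

Lemma minor_rank A : (mrank minor A + #|p| = mrank mu (emb @: A :|: p))%N.
Proof.
have cardU B : #|emb @: B :|: p| = (#|B| + #|p|)%N.
  rewrite cardsU card_imset // (_ : _ :&: p = set0) ?cards0 ?subn0 //.
  by apply/setP => x; rewrite !inE; apply/negP => /andP[/imsetP[z _ ->]]; rewrite (negbTE (emb_p z)).
have capU B C : (emb @: B :|: p) :&: (emb @: C :|: p) = emb @: (B :&: C) :|: p.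
  by rewrite -setUIl imsetI //; apply: in2W.
have rp : mrank mu p = #|p|.
  apply/eqP; rewrite eqn_leq (rk_card gpP) -{1}(setIidPl pB0); exact: rk_ge.
have rT : mrank mu (emb @: setT :|: p) = r.
  apply/eqP; rewrite eqn_leq (rk_le_r gpP) -(basis_card gpP bB0) -{1}(setIidPr B0p); exact: rk_ge.
apply/eqP; rewrite eqn_leq; apply/andP; split.
  have [B bB <-] := basis_chain1 minor_gp A.
  rewrite -cardU -capU; apply: (rk_ge); by rewrite -minor_basis.
(* A basis that is optimal for the three sets contains [p] and lies in the
   largest of them, so it comes from a basis of the minor. *)
have [|| B [bB b1 b2 b3]] := @basis_chain3 _ _ _ _ gpP p (emb @: A :|: p) (emb @: setT :|: p).
- exact: subsetUr.
- by rewrite setSU // imsetS.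
have pB : p \subset B by apply/setIidPl/eqP; rewrite eqEcard subsetIl b1 rp leqnn.
have Bp : B \subset emb @: setT :|: p.
  by apply/setIidPr/eqP; rewrite eqEcard subsetIr b3 rT (basis_card gpP bB) leqnn.
rewrite -b2 -(sub_emb_p pB Bp) capU cardU leq_add2r.
by apply: rk_ge; rewrite minor_basis sub_emb_p.
Qed.

Lemma minor_circ A e : circ minor A e = circ mu (emb @: A :|: p) (emb e).
Proof.
rewrite /circ in_setU mem_imset // (negbTE (emb_p e)) orbF minor_set; case: ifP => // eA.
rewrite -[in RHS](setD1K eA) imsetU1 -setUA setU1K //.
by rewrite inE mem_imset // !inE eqxx (negbTE (emb_p e)).
Qed.

End Minor.

Section MinorVectors.
Context {R : realType} {T T' : finType}.
Variables (mu : seq T -> trop R) (r : nat).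
Hypothesis gpP : is_gp r mu.
Variables (emb : T' -> T) (p : {set T}).
Hypotheses (emb_inj : injective emb) (emb_p : forall x, emb x \notin p).

Lemma rk_sub_basis (B A : {set T}) : basis mu B -> A \subset B -> mrank mu A = #|A|.
Proof.
move=> bB AB; apply/eqP; rewrite eqn_leq (rk_card gpP) -{1}(setIidPl AB); exact: rk_ge.
Qed.

Lemma minor_vec (X : T -> trop R) : vec mu X ->
  (forall e, X e != None -> (exists x, e = emb x) \/ mrank mu (e |: p) = mrank mu p) ->
  vec (minor mu emb p) (X \o emb).
Proof.
move=> vX sX C i /=; rewrite (minor_cons gpP) // => nz.
have [j ji le] := vX (emb @: C :|: p) _ nz.
have /= := tle_neq0 le nz; rewrite tmul_neq0 => /andP[/sX[[j' ej]|rj]].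
  by subst j; exists j'; rewrite ?(minor_cons gpP) //; apply: contraNneq ji => ->.
rewrite (gp_cons gpP) inE; case: ifP => // /norP[_ jp] bB.
have e1 : mrank mu (j |: p) = #|j |: p| by apply: (rk_sub_basis bB); rewrite setUS // subsetUr.
have := rk_card gpP p; rewrite -rj e1 cardsU1 jp; lia.
Qed.

Lemma circ_supp A f : circ mu A f != None -> f \in A.
Proof. by rewrite /circ; case: ifP. Qed.

Variable B0 : {set T}.
Hypotheses (bB0 : basis mu B0) (pB0 : p \subset B0) (B0p : B0 \subset emb @: setT :|: p).

(** A vector of a minor is a minimum of scaled circuits, and a circuit of the
    minor extends to a circuit of the matroid. The last clause is the case of a
    restriction: the extended circuits then avoid [p], because a circuit of the
    minor has one element more than the rank of the flat. *)
Lemma minor_vec_lift (Y : T' -> trop R) : vec (minor mu emb p) Y ->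
  exists X, [/\ vec mu X, forall i, X (emb i) = Y i
    & (mrank mu (emb @: setT) + #|p|)%N = r ->
      forall f, X f != None -> exists i, f = emb i].
Proof.
move=> vY; have gpm := minor_gp gpP emb_inj emb_p bB0 pB0 B0p.
have loc e : exists Z : T -> trop R, [/\ vec mu Z, Y e != None -> Z (emb e) = Y e,
    forall i, tle (Y i) (Z (emb i)) & (mrank mu (emb @: setT) + #|p|)%N = r ->
      forall f, Z f != None -> exists i, f = emb i].
  case Ye : (Y e == None).
    by exists (fun=> None); split.
  have [A [c [nz eY leY]]] := vec_circuit gpm vY (negbT Ye).
  rewrite (minor_circ gpP) // in nz eY.
  exists (fun f => tmul (Some c) (circ mu (emb @: A :|: p) f)); split.
  - by apply: vec_scale; apply: (circ_vec gpP).
  - by move=> _; rewrite eY.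
  - by move=> i; have := leY i; rewrite (minor_circ gpP).
  move=> rr f; rewrite tmul_neq0 /= => nf.
  have := circ_supp nf; rewrite inE => /orP[/imsetP[i _ ->]|fp]; first by exists i.
  have := nf; have := nz; rewrite /circ; case: ifP => // eA; case: ifP => // fA b1 b2.
  have sA : emb @: A \subset (emb @: A :|: p) :\ f.
    apply/subsetP => x xA; rewrite !inE xA andbT /=; apply: contraTneq xA => ->.
    by apply/imsetP => -[z _ e']; move: (emb_p z); rewrite -e' fp.
  have e1 := rk_sub_basis b2 sA.
  have e2 := basis_card gpP b1; have := cardsD1 (emb e) (emb @: A :|: p).
  rewrite eA e2 cardsU (_ : _ :&: p = set0) ?cards0.
    by have := rkS gpP (imsetS emb (subsetT A)); rewrite e1; lia.
  by apply/setP => x; rewrite !inE; apply/negP => /andP[/imsetP[z _ ->]]; rewrite (negbTE (emb_p z)).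
have [Z hZ] := choice loc.
exists (fun f => \big[@tmin R/None]_k Z k f); split.
- by apply: vec_bigmin => k; case: (hZ k).
- move=> i; apply: tle_anti.
    have [->|Yi] := eqVneq (Y i) None; first by [].
    by have [_ h _ _] := hZ i; rewrite -(h Yi); exact: tle_bigmin.
  have [->|/bigmin_attained[k ->]] := eqVneq (\big[@tmin R/None]_k Z k (emb i)) None; first by case: (Y i).
  by case: (hZ k).
move=> rr f /[dup] nz /bigmin_attained[k e]; rewrite e in nz.
by have [_ _ _ h] := hZ k; apply: h rr _ nz.
Qed.

End MinorVectors.

(** * Pointed matroids *)

Section Pointed.
Context {R : realType} {gs : finType}.
Variables (mu : seq (option gs) -> trop R) (r : nat).
Hypothesis gpP : is_gp r mu.
Hypothesis ptP : forall x, None \in x -> mu x = None.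

Local Notation nu := (fun x : seq gs => mu (map Some x)).

Lemma nu_perm x y : perm_eq x y -> nu x = nu y.
Proof. by move=> xy; apply: (gp_perm gpP); rewrite perm_map. Qed.

Lemma nu_uniq x : nu x != None -> uniq x.
Proof. by move/(gp_uniq gpP); apply: map_uniq. Qed.

Lemma dual_gpE (y z : seq gs) e : uniq y -> uniq z -> (forall x, (x \in z) = (x \notin y)) ->
  (if e \in y then dual_gp nu (rem e y) else None) = nu (e :: z).
Proof.
move=> uy uz yz; case: ifP => ey; last first.
  by apply/esym/eqP; apply: contraT => /nu_uniq /=; rewrite yz ey.
rewrite /dual_gp rem_uniq //; apply: nu_perm; apply: uniq_perm.
- exact: enum_uniq.
- by rewrite /= yz ey uz.
move=> x; rewrite mem_enum in_set in_cons yz mem_rem_uniq // !inE negb_and negbK.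
by case: eqP.
Qed.

(** The circuit of the dual on $\mathbf y$ is the cocircuit of the complement
    of $\mathbf y$. *)
Lemma is_vector_nuP (X : {ffun gs -> trop R}) : is_vector nu X <->
  forall y : seq gs, uniq y -> fnull (fun e => tmul (X e) (nu (e :: y))).
Proof.
split=> h.
  move=> z uz i nz.
  pose y := enum [set x | x \notin z].
  have uy : uniq y by exact: enum_uniq.
  have yz x : (x \in z) = (x \notin y) by rewrite mem_enum inE negbK.
  pose Y := [ffun e => if e \in y then dual_gp nu (rem e y) else None].
  have YE e : Y e = nu (e :: z) by rewrite ffunE (@dual_gpE y z).
  have cY : is_circuit (dual_gp nu) Y.
    exists y, 0; split=> //; last by move=> e; rewrite ffunE tmul1l.
    move: nz; rewrite tmul_neq0 -YE ffunE => /andP[_]; case: ifP => // iy ne.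
    by exists i.
  have /tnull_enumP/(_ i) := h Y cY; rewrite YE => /(_ nz)[j ji].
  by rewrite YE; exists j.
move=> Y [y [c [uy _ YE]]]; apply/tnull_enumP => i.
pose z := enum [set x | x \notin y].
have uz : uniq z by exact: enum_uniq.
have yz x : (x \in z) = (x \notin y) by rewrite mem_enum inE.
have {}YE e : Y e = tmul (Some c) (nu (e :: z)) by rewrite YE (@dual_gpE y z).
rewrite YE tmulCA tmul_neq0 => /andP[_ nz].
have [j ji le] := h z uz i nz; exists j => //.
by rewrite YE !(tmulCA (X _)) tle_mull.
Qed.

(** The loop may be kept: it lies in no cocircuit. *)
Lemma is_vectorP (X : {ffun gs -> trop R}) : is_vector nu X <-> vec mu (oapp X None).
Proof.
rewrite is_vector_nuP; split=> h.
  move=> C [i|] //=; rewrite tmul_neq0 => /andP[Xi].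
  case: (boolP (None \in C)) => NC; first by rewrite ptP // inE mem_enum NC orbT.
  have CE e : mu (e :: enum C) = mu (e :: map Some (enum (Some @^-1: C))).
    apply: (gp_perm gpP); rewrite perm_cons; apply: uniq_perm.
    - exact: enum_uniq.
    - by rewrite map_inj_uniq ?enum_uniq //; exact: Some_inj.
    move=> x; rewrite mem_enum; apply/idP/mapP.
      by case: x => [x|] xC; [exists x; rewrite // mem_enum inE|rewrite xC in NC].
    by case=> z; rewrite mem_enum inE => zC ->.
  rewrite CE => nz; have [|j ji le] := h _ (enum_uniq (Some @^-1: C)) i; first by rewrite tmul_neq0 Xi.
  by exists (Some j) => //=; rewrite !CE.
move=> y uy i nz.
have CE e : mu (e :: enum [set x in map Some y]) = mu (e :: map Some y).
  apply: (gp_perm gpP); rewrite perm_cons; apply: uniq_perm.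
  - exact: enum_uniq.
  - by rewrite map_inj_uniq //; exact: Some_inj.
  by move=> x; rewrite mem_enum inE.
have [|[j|] ji] := h [set x in map Some y] (Some i); rewrite ?CE //.
  by move=> le; exists j => //; apply: contraNneq ji => ->.
by move=> /tle_neq0/(_ nz).
Qed.

Lemma flat_point F : flat mu F -> None \in F.
Proof.
move/(flatP gpP); apply; apply/eqP; rewrite eqn_leq [X in _ && X](rkS gpP) ?subsetU1 // andbT.
have [B bB <-] := basis_chain1 gpP (None |: F).
apply: leq_trans (rk_ge F bB); rewrite subset_leq_card //; apply/subsetP => x.
rewrite !inE; case: eqP => [->|] //= /negP; case/negP.
by move: bB; rewrite /basis; case: (boolP (None \in B)) => // NB; rewrite ptP ?eqxx // mem_enum.
Qed.

Lemma obasisP (F : {set option gs}) : exists B, [/\ basis mu B, #|F :&: B| = mrank mu F,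
  obasis_contr mu F = enum (B :\: F) & obasis_restr mu F = enum (B :&: F)].
Proof.
rewrite /obasis_contr /obasis_restr; case: pickP => [B /andP[bB /eqP sB]|h].
  by exists B.
by have [B bB sB] := basis_chain1 gpP F; move: (h B); rewrite bB sB eqxx.
Qed.

End Pointed.

(** * Restrictions and contractions of sheaves *)

Lemma omap_val_inj (T : Type) (P : pred T) :
  injective (omap val : option {x : T | P x} -> option T).
Proof. by case=> [x|] [y|] //= [] /val_inj ->. Qed.

Lemma modular_of_rk (R : realType) (T : finType) (mu : seq T -> trop R) r :
  is_gp r mu ->
  (forall F G, flat mu F -> flat mu G ->
    (mrank mu F + mrank mu G = mrank mu (F :|: G) + mrank mu (F :&: G))%N) ->
  modular mu.
Proof. by move=> gpP h F G fF fG; rewrite /fjoin (rk_cl gpP) h. Qed.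

Section Sheaf.
Context {R : realType} {d : nat} {S : fan R d}.
Variable E : tsheaf S.
Hypothesis EP : is_mtrs E.

Local Notation mu := (gp E).
Local Notation rk := (mrank mu).
Implicit Types F G H : {set option (gs E)}.

Lemma mtrs_gpP : is_gp (srank E) mu.
Proof. by have [r gpP] := mtrs_gp EP; rewrite /srank (rkT gpP). Qed.
Local Notation gpP := mtrs_gpP.
Local Notation ptP := (mtrs_point EP).

Lemma mtrs_flat_point F : flat mu F -> None \in F.
Proof. exact: (flat_point gpP ptP). Qed.

Lemma basis_point B : basis mu B -> None \notin B.
Proof. by apply: contraL => NB; rewrite /basis ptP ?mem_enum. Qed.

Lemma rk_point : rk [set None] = 0%N.
Proof.
apply/eqP; rewrite -leqn0; apply/bigmax_leqP => B /basis_point NB.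
rewrite leqn0 cards_eq0; apply/eqP/setP => x; rewrite !inE.
by case: eqP => [->|]; rewrite ?(negbTE NB).
Qed.

Lemma flat_bot : flat mu [set None].
Proof.
apply/(flatP gpP) => -[e|]; last by rewrite inE.
have := rkS gpP (subsetUl [set Some e] [set None]).
by rewrite (mtrs_loopless EP) rk_point => h e0; rewrite e0 in h.
Qed.

Lemma rk_gt0 e F : Some e \in F -> (0 < rk F)%N.
Proof.
move=> eF; rewrite -(mtrs_loopless EP e); apply: (rkS gpP).
by rewrite sub1set.
Qed.

Lemma srank0P : srank E = 0%N <-> (gs E -> False).
Proof.
rewrite /srank; split=> [r0 e|h].
  by have := @rk_gt0 e setT; rewrite inE r0 => /(_ isT).
suff -> : [set: option (gs E)] = [set None] by rewrite rk_point.
by apply/setP => -[e|]; rewrite !inE.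
Qed.

Definition evec (X : {ffun gs E -> trop R}) : Prop := is_vector (del_point E) X.

Lemma evecP X : evec X <-> vec mu (oapp X None).
Proof. exact: (is_vectorP gpP ptP). Qed.

Lemma vec_forget (X : option (gs E) -> trop R) : vec mu X ->
  evec [ffun e => X (Some e)].
Proof.
move=> vX; apply/evecP => C [i|] //=; rewrite ffunE => nz.
have [[j|] ji le] := vX C _ nz; first by exists (Some j); rewrite //= ffunE.
move/tle_neq0: le => /(_ nz); rewrite tmul_neq0 => /andP[_].
by rewrite ptP ?inE ?eqxx.
Qed.

Lemma flat_evecP F : None \in F -> flat mu F <->
  forall X, evec X -> forall e, Some e \notin F -> X e != None ->
    exists e', [/\ e' != e, Some e' \notin F & X e' != None].
Proof.
move=> NF; split=> [/(flat_vecP gpP) h X /evecP vX e eF Xe|h].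
  by have [[e'|] [ne eF' Xe']] := h _ vX _ eF Xe; rewrite // in Xe' *; exists e'.
apply/(flat_vecP gpP) => X vX [e|] eF Xe; last by rewrite NF in eF.
have [|e' [ne eF']] := h _ (vec_forget vX) e eF; rewrite ffunE // => Xe'.
by exists (Some e').
Qed.

Lemma indep_evecP (I : {set gs E}) : rk (Some @: I) = #|I| <->
  forall X, evec X -> (forall e, X e != None -> e \in I) -> forall e, X e = None.
Proof.
rewrite -(card_imset I (@Some_inj _)); split=> [/(indep_vecP gpP) h X /evecP vX sX e|h].
  by apply: (h _ vX _ (Some e)) => -[f|] //= /sX fI; rewrite imset_f.
apply/(indep_vecP gpP) => X vX sX.
have sS e : X (Some e) != None -> e \in I by move/sX; rewrite mem_imset //; exact: Some_inj.
case=> [e|].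
  by have := h _ (vec_forget vX) _ e; rewrite ffunE; apply=> f; rewrite ffunE; exact: sS.
by apply/eqP; apply: contraT => /sX /imsetP[].
Qed.

(** ** Restriction *)

Section Restriction.
Variable F : {set option (gs E)}.
Hypothesis fF : flat mu F.
Local Notation emb := (omap val : option (gs (restr E F)) -> option (gs E)).

Lemma remb_in x : emb x \in F.
Proof. by case: x => [[x xF]|] //=; exact: mtrs_flat_point. Qed.

Lemma remb_img : emb @: setT = F.
Proof.
apply/setP => x; apply/imsetP/idP => [[y _ ->]|]; first exact: remb_in.
by case: x => [x|] xF; [exists (Some (Sub x xF))|exists None].
Qed.

Lemma remb_preimK H : None \in H -> emb @: (emb @^-1: H) = F :&: H.
Proof.
move=> NH; apply/setP => x; rewrite inE; apply/imsetP/andP.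
  by move=> [y]; rewrite inE => yH ->; rewrite remb_in.
by move=> []; rewrite -{1}remb_img => /imsetP[y _ ->] yH; exists y; rewrite ?inE.
Qed.

Lemma restr_minorP : exists B0, [/\ basis mu B0, gp (restr E F) = minor mu emb (B0 :\: F),
  (forall x, emb x \notin B0 :\: F), B0 \subset emb @: setT :|: B0 :\: F
  & (rk F + #|B0 :\: F|)%N = srank E].
Proof.
have [B [bB sB eB _]] := obasisP gpP F.
exists B; split=> //.
- by rewrite /restr /= eB.
- by move=> x; rewrite inE remb_in.
- by apply/subsetP => x xB; rewrite remb_img !inE xB andbT orbN.
by rewrite -sB setIC cardsID (basis_card gpP bB).
Qed.

Lemma restr_gp : exists r, is_gp r (gp (restr E F)).
Proof.
have [B0 [b0 -> ep sp _]] := restr_minorP.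
exists (srank E - #|B0 :\: F|)%N.
exact: (minor_gp gpP (@omap_val_inj _ _) ep b0 (subsetDl _ _) sp).
Qed.

Lemma rk_restr (A : {set option (gs (restr E F))}) : mrank (gp (restr E F)) A = rk (emb @: A).
Proof.
have [B0 [b0 -> ep sp c0]] := restr_minorP.
have e1 := minor_rank gpP (@omap_val_inj _ _) ep b0 (subsetDl _ _) sp A.
have e2 := rkU_card gpP (emb @: A) (B0 :\: F).
have e3 := rk_submod gpP (emb @: A :|: B0 :\: F) F.
have e4 : (srank E <= rk ((emb @: A :|: B0 :\: F) :|: F))%N.
  rewrite -(basis_card gpP b0); have := b0; rewrite (basis_rk gpP) => /andP[/eqP-> /eqP <-].
  apply: (rkS gpP); apply/subsetP => x xB; rewrite !inE xB.
  by case: (x \in F); rewrite !orbT.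
have e5 : (rk (emb @: A) <= rk ((emb @: A :|: B0 :\: F) :&: F))%N.
  apply: (rkS gpP); rewrite subsetI subsetUl /=.
  by apply/subsetP => x /imsetP[y _ ->]; exact: remb_in.
move: e1 e2 e3 e4 e5 c0; set a := rk (emb @: A); set b := rk (emb @: A :|: _); set c := #|_|.
set m := mrank (minor _ _ _) A; set x := rk (_ :|: F); set y := rk (_ :&: F).
move: (rk F) (srank E) => f s; move: a b c m x y; lia.
Qed.

Lemma flat_restr (A : {set option (gs (restr E F))}) : flat (gp (restr E F)) A = flat mu (emb @: A).
Proof.
have [r gpr] := restr_gp.
have emb_inj := @omap_val_inj _ (fun x => Some x \in F).
apply/(flatP gpr)/(flatP gpP) => h e.
  move=> re; have eF : e \in F.
    apply: (subsetP (cl_min gpP fF (A := emb @: A) _)); last by rewrite (mem_cl gpP) re.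
    by apply/subsetP => x /imsetP[y _ ->]; exact: remb_in.
  move: eF re; rewrite -{1}remb_img => /imsetP[y _ ->]; rewrite -imsetU1 -!rk_restr.
  by move/h => yA; rewrite imset_f.
by rewrite !rk_restr imsetU1 => /h; rewrite mem_imset.
Qed.

Lemma flat_restr_preim H : flat mu H -> flat (gp (restr E F)) (emb @^-1: H).
Proof.
move=> fH; rewrite flat_restr remb_preimK ?mtrs_flat_point //.
exact: (flatI gpP).
Qed.

Lemma restr_mtrs : is_mtrs (restr E F).
Proof.
have emb_inj := @omap_val_inj _ (fun x => Some x \in F).
split.
- exact: restr_gp.
- move=> x Nx; rewrite /restr /=; apply: ptP.
  by rewrite mem_cat; apply/orP; left; apply/mapP; exists None.
- by move=> e; rewrite rk_restr imset_set1 /= (mtrs_loopless EP).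
- have [r gpr] := restr_gp; apply: (modular_of_rk gpr) => A B.
  rewrite !flat_restr !rk_restr imsetU imsetI; last exact: in2W.
  exact: (modular_rk gpP (mtrs_modular EP)).
- move=> rho j; rewrite /restr /=; apply: flat_restr_preim.
  by apply: (flatI gpP) => //; exact: (mtrs_flat EP).
- by move=> rho j; rewrite /restr /= preimsetS // setIS // (mtrs_decr EP).
- move=> rho; have [j0 hj] := mtrs_bot EP rho; exists j0 => j /hj hj'.
  apply/setP => x; rewrite /restr /= inE /fmeet hj' !inE.
  by case: x => [x|] //=; rewrite ?andbF // mtrs_flat_point.
move=> rho; have [j0 hj] := mtrs_top EP rho; exists j0 => j /hj hj'.
apply/setP => x; rewrite /restr /= !inE /fmeet hj' !inE andbT.
exact: remb_in.
Qed.

Lemma evec_restr (X : {ffun gs E -> trop R}) : (forall e, X e != None -> Some e \in F) ->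
  evec X <-> is_vector (del_point (restr E F)) [ffun i => X (val i)].
Proof.
move=> sX; have [B0 [b0 eg ep sp c0]] := restr_minorP.
have emb_inj := @omap_val_inj _ (fun x => Some x \in F).
have [r gpr] := restr_gp; have rmt := restr_mtrs.
rewrite evecP (is_vectorP gpr (mtrs_point rmt)).
have eX : oapp [ffun i : gs (restr E F) => X (val i)] None = oapp X None \o emb.
  by apply/funext => -[x|] //=; rewrite ffunE.
rewrite eX eg; split=> vX.
  apply: (minor_vec gpP emb_inj ep vX) => -[e|] //= /sX eF; left.
  by exists (Some (Sub e eF)).
have [X' [vX' X'E sX']] := minor_vec_lift gpP emb_inj ep b0 (subsetDl _ _) sp vX.
suff -> : oapp X None = X' by [].
rewrite remb_img in sX'; apply/funext => -[e|] /=; last by rewrite (X'E None).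
case: (boolP (Some e \in F)) => eF; first by rewrite (X'E (Some (Sub e eF))).
have -> : X e = None by apply/eqP; apply: contraNT eF; exact: sX.
apply/esym/eqP; apply: contraNT eF => /(sX' c0)[i ->]; exact: remb_in.
Qed.

End Restriction.

(** ** Contraction *)

Section Contraction.
Variable F : {set option (gs E)}.
Hypothesis fF : flat mu F.
Local Notation emb := (omap val : option (gs (contr E F)) -> option (gs E)).

Lemma cemb_in x : (emb x \in F) = (x == None).
Proof.
case: x => [[x xF]|] /=; last by rewrite (mtrs_flat_point fF).
exact: negbTE.
Qed.

Lemma cemb_img : emb @: setT :|: F = setT.
Proof.
apply/setP => x; rewrite !inE; case: (boolP (x \in F)) => xF; rewrite ?orbT // orbF.
case: x xF => [x|] xF; last by rewrite mtrs_flat_point in xF.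
by apply/imsetP; exists (Some (Sub x xF)).
Qed.

Lemma cemb_out x : x \notin F -> exists y, x = emb y.
Proof.
have := in_setT x; rewrite -cemb_img inE => /orP[/imsetP[y _ ->]|->//].
by exists y.
Qed.

Lemma cemb_preimK H : F \subset H -> emb @: (emb @^-1: H) :|: F = H.
Proof.
move=> FH; apply/setP => x; rewrite inE; apply/orP/idP.
  by case=> [/imsetP[y]|/(subsetP FH)//]; rewrite inE => yH ->.
move=> xH; case: (boolP (x \in F)) => xF; [by right|left].
by have [y e] := cemb_out xF; rewrite e imset_f // inE -e.
Qed.

Lemma contr_minorP : exists B0, [/\ basis mu B0, gp (contr E F) = minor mu emb (B0 :&: F),
  (forall x, emb x \notin B0 :&: F), B0 \subset emb @: setT :|: B0 :&: F
  & #|B0 :&: F| = rk F].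
Proof.
have [B [bB sB _ eB]] := obasisP gpP F.
exists B; split=> //.
- by rewrite /contr /= eB.
- move=> x; rewrite inE cemb_in negb_and orbC.
  by case: eqP => // ->; rewrite basis_point.
- by apply/subsetP => x xB; have := in_setT x; rewrite -cemb_img !inE xB.
by rewrite setIC.
Qed.

Lemma contr_gp : exists r, is_gp r (gp (contr E F)).
Proof.
have [B0 [b0 -> ep sp _]] := contr_minorP.
exists (srank E - #|B0 :&: F|)%N.
exact: (minor_gp gpP (@omap_val_inj _ _) ep b0 (subsetIl _ _) sp).
Qed.

Lemma rk_full_subset (p : {set option (gs E)}) : p \subset F -> (rk F <= rk p)%N ->
  F \subset cl mu p.
Proof.
move=> pF le; apply/subsetP => e eF.
rewrite (mem_cl gpP) eqn_leq [X in _ && X](rkS gpP) ?subsetU1 // andbT.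
by apply: leq_trans le; apply: (rkS gpP); rewrite subUset sub1set eF.
Qed.

Lemma rk_contr (A : {set option (gs (contr E F))}) :
  (mrank (gp (contr E F)) A + rk F)%N = rk (emb @: A :|: F).
Proof.
have [B0 [b0 -> ep sp c0]] := contr_minorP.
rewrite -c0 (minor_rank gpP (@omap_val_inj _ _) ep b0 (subsetIl _ _) sp A).
apply/eqP; rewrite eqn_leq (rkS gpP) ?setUS ?subsetIr //=.
rewrite setUC [X in (_ <= mrank mu X)%N]setUC -(rkU_cl gpP (B0 :&: F)).
apply: (rkS gpP); apply: setSU; apply: rk_full_subset; first exact: subsetIr.
by rewrite -c0 (rk_sub_basis gpP b0) // subsetIl.
Qed.

Lemma flat_contr (A : {set option (gs (contr E F))}) : None \in A ->
  flat (gp (contr E F)) A = flat mu (emb @: A :|: F).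
Proof.
move=> NA; have [r gpr] := contr_gp.
have emb_inj := @omap_val_inj _ (fun x => Some x \notin F).
have reE e : (mrank (gp (contr E F)) (e |: A) == mrank (gp (contr E F)) A)
     = (rk (emb e |: (emb @: A :|: F)) == rk (emb @: A :|: F)).
  by rewrite -(eqn_add2r (rk F)) !rk_contr imsetU1 setUA.
apply/(flatP gpr)/(flatP gpP) => h e.
  case: (boolP (e \in F)) => eF; first by rewrite !inE eF orbT.
  have [y ey] := cemb_out eF; rewrite ey => /eqP; rewrite -reE => /eqP/h yA.
  by rewrite inE imset_f.
move=> /eqP; rewrite reE => /eqP/h; rewrite inE mem_imset // cemb_in.
by case: eqP => [->|]; rewrite ?NA ?orbF.
Qed.

Lemma flat_contr_preim H : flat mu H -> F \subset H -> flat (gp (contr E F)) (emb @^-1: H).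
Proof.
move=> fH FH; rewrite flat_contr ?cemb_preimK //.
by rewrite inE /= mtrs_flat_point.
Qed.

Lemma contr_mtrs : is_mtrs (contr E F).
Proof.
have emb_inj := @omap_val_inj _ (fun x => Some x \notin F).
have [r gpr] := contr_gp.
have ptr x : None \in x -> gp (contr E F) x = None.
  move=> Nx; rewrite /contr /=; apply: ptP.
  by rewrite mem_cat; apply/orP; left; apply/mapP; exists None.
split=> //.
- by exists r.
- move=> e; apply/eqP; rewrite -(eqn_add2r (rk F)) rk_contr imset_set1 add1n eqn_leq (rkU1 gpP) /=.
  move/forallP/(_ (emb (Some e)))/implyP: fF; apply.
  by rewrite cemb_in.
- apply: (modular_of_rk gpr) => A B fA fB.
  have NA := flat_point gpr ptr fA; have NB := flat_point gpr ptr fB.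
  move: fA fB; rewrite !flat_contr // => fA fB.
  have := modular_rk gpP (mtrs_modular EP) fA fB.
  rewrite -setUUl -setUIl -imsetU -imsetI; last exact: in2W.
  rewrite -!rk_contr; move: (rk F) => f e.
  by apply/eqP; rewrite -(eqn_add2r (f + f)) addnACA e addnACA.
- move=> rho j; rewrite /contr /=; apply: flat_contr_preim; first exact: (cl_flat gpP).
  exact: subset_trans (subsetUl _ _) (sub_cl gpP _).
- move=> rho j; rewrite /contr /= preimsetS // (clS gpP) // setUS //.
  exact: (mtrs_decr EP).
- move=> rho; have [j0 hj] := mtrs_bot EP rho; exists j0 => j /hj hj'.
  apply/setP => x; rewrite /contr /= inE /fjoin hj' (setUidPl _) ?sub1set ?mtrs_flat_point //.
  by rewrite (cl_id gpP fF) cemb_in inE.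
move=> rho; have [j0 hj] := mtrs_top EP rho; exists j0 => j /hj hj'.
apply/setP => x; rewrite /contr /= !inE /fjoin hj' setUT (cl_id gpP) ?inE //.
exact: (flatT gpP).
Qed.

Lemma evec_contr (X : {ffun gs E -> trop R}) : evec X ->
  is_vector (del_point (contr E F)) [ffun i => X (val i)].
Proof.
have [B0 [b0 eg ep sp c0]] := contr_minorP.
have emb_inj := @omap_val_inj _ (fun x => Some x \notin F).
have [r gpr] := contr_gp; have rmt := contr_mtrs.
rewrite evecP (is_vectorP gpr (mtrs_point rmt)) => vX.
have -> : oapp [ffun i : gs (contr E F) => X (val i)] None = oapp X None \o emb.
  by apply/funext => -[x|] //=; rewrite ffunE.
rewrite eg; apply: (minor_vec gpP emb_inj ep vX) => e _.
case: (boolP (e \in F)) => eF; [right|left]; last exact: cemb_out.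
apply/eqP; rewrite -(mem_cl gpP); apply: (subsetP (rk_full_subset _ _)) eF; first exact: subsetIr.
by rewrite -c0 (rk_sub_basis gpP b0) // subsetIl.
Qed.

Lemma evec_contr_lift (Y : {ffun gs (contr E F) -> trop R}) :
  is_vector (del_point (contr E F)) Y ->
  exists2 X : {ffun gs E -> trop R}, evec X & forall i, X (val i) = Y i.
Proof.
have [B0 [b0 eg ep sp c0]] := contr_minorP.
have emb_inj := @omap_val_inj _ (fun x => Some x \notin F).
have [r gpr] := contr_gp; have rmt := contr_mtrs.
rewrite (is_vectorP gpr (mtrs_point rmt)) eg => vY.
have [X [vX XE _]] := minor_vec_lift gpP emb_inj ep b0 (subsetIl _ _) sp vY.
exists [ffun e => X (Some e)]; first exact: vec_forget.
by move=> i; rewrite ffunE (XE (Some i)).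
Qed.

End Contraction.
End Sheaf.

(** * Submonomial matrices *)

Section Matrices.
Context {R : realType}.

Definition tinvmx (J I : finType) (A : tmatrix R J I) : tmatrix R I J :=
  [ffun p => omap -%R (A (p.2, p.1))].

Lemma tinvmx_neq0 (J I : finType) (A : tmatrix R J I) i j :
  (tinvmx A (i, j) != None) = (A (j, i) != None).
Proof. by rewrite ffunE /=; case: (A _). Qed.

Lemma tinvmx_sub (J I : finType) (A : tmatrix R J I) : submonomial A -> submonomial (tinvmx A).
Proof.
move=> [A1 A2]; split=> i j j'; rewrite !tinvmx_neq0; [exact: A2|exact: A1].
Qed.

Lemma bigtmin_only (I : finType) (F : I -> trop R) i : (forall k, k != i -> F k = None) ->
  \big[@tmin R/None]_k F k = F i.
Proof. by move=> h; rewrite (bigD1 i) //= big1 ?Monoid.mulm1. Qed.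

Section Submonomial.
Variables (J I : finType) (A : tmatrix R J I).
Hypothesis hA : submonomial A.

Lemma sub_row j i i' : A (j, i) != None -> i' != i -> A (j, i') = None.
Proof. by move=> h; apply: contraNeq => h'; apply/eqP; exact: (hA.2 _ _ _ h' h). Qed.

Lemma sub_col j j' i : A (j, i) != None -> j' != j -> A (j', i) = None.
Proof. by move=> h; apply: contraNeq => h'; apply/eqP; exact: (hA.1 _ _ _ h' h). Qed.

Lemma tappE X j i : A (j, i) != None -> tapp A X j = tmul (A (j, i)) (X i).
Proof. by move=> h; rewrite ffunE (@bigtmin_only _ _ i) // => k /(sub_row h) ->. Qed.

Lemma tapp_neq0 X j : tapp A X j != None -> exists2 i, A (j, i) != None & X i != None.
Proof.
by rewrite ffunE => /bigtmin_neq0[i]; rewrite tmul_neq0 => /andP[]; exists i.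
Qed.

Lemma tmulmx_col (K : finType) (B : tmatrix R K J) k j i : A (j, i) != None ->
  tmulmx B A (k, i) = tmul (B (k, j)) (A (j, i)).
Proof.
by move=> h; rewrite ffunE (@bigtmin_only _ _ j) //= => l /(sub_col h) ->; rewrite tmul0r.
Qed.

Lemma tmulmx_row (K : finType) (B : tmatrix R I K) k j i : A (j, i) != None ->
  tmulmx A B (j, k) = tmul (A (j, i)) (B (i, k)).
Proof.
by move=> h; rewrite ffunE (@bigtmin_only _ _ i) //= => l /(sub_row h) ->.
Qed.

Lemma under_some x j : (under A x == Some j) = (if x is Some i then A (j, i) != None else false).
Proof.
case: x => [i|] //; apply/eqP/idP => [|h]; last exact: underE.
by rewrite /under; case: pickP => // j' h [<-].
Qed.

Lemma underNP i : reflect (forall j, A (j, i) = None) (under A (Some i) == None).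
Proof.
apply: (iffP eqP) => [h j|h].
  by apply/eqP; rewrite -[_ == _]negbK -(under_some (Some i)) h.
by rewrite /under; case: pickP => // j; rewrite h.
Qed.

Lemma under_inj x y : under A x = under A y -> under A x != None -> x = y.
Proof.
case e: (under A x) => [j|] // e' _; move/eqP: e; move/esym/eqP: e'.
rewrite !under_some; case: x y => [x|] [y|] // hy hx.
by rewrite (hA.2 _ _ _ hx hy).
Qed.

Lemma tmulmx_invr j j' : tmulmx A (tinvmx A) (j, j') =
  if (j == j') && [exists i, A (j, i) != None] then Some 0 else None.
Proof.
case: existsP => [[i h]|h]; last first.
  rewrite andbF; apply/eqP; apply: contraT => /tmulmx_neq0[i [hi _]].
  by case: h; exists i.
rewrite andbT (tmulmx_row _ _ h) ffunE /=; case: eqP => [<-|/eqP ne].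
  by case: (A _) h => //= x; rewrite subrr.
by rewrite (@sub_col j j' i h) 1?eq_sym // tmul0r.
Qed.

Lemma tmulmx_invl i i' : tmulmx (tinvmx A) A (i, i') =
  if (i == i') && [exists j, A (j, i) != None] then Some 0 else None.
Proof.
case: existsP => [[j h]|h]; last first.
  rewrite andbF; apply/eqP; apply: contraT => /tmulmx_neq0[j []].
  by rewrite tinvmx_neq0 => hj _; case: h; exists j.
rewrite andbT [LHS]ffunE (@bigtmin_only _ _ j) /=.
  rewrite ffunE /=; case: eqP => [<-|/eqP ne].
    by case: (A _) h => //= x; rewrite addNr.
  by rewrite (@sub_row j i i' h) 1?eq_sym // tmul0r.
by move=> l lj; rewrite ffunE /= (sub_col h lj).
Qed.

Lemma tmulmx_invrK (K : finType) (B : tmatrix R J K) :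
  (forall j k, B (j, k) != None -> exists i, A (j, i) != None) ->
  tmulmx A (tmulmx (tinvmx A) B) = B.
Proof.
move=> h; rewrite tmulmxA; apply/ffunP => -[j k]; rewrite ffunE (@bigtmin_only _ _ j) /=.
  rewrite tmulmx_invr eqxx /=; case: existsP => [_|h']; first by rewrite tmul1l.
  by apply/esym/eqP; apply: contraT => /h[i hi]; case: h'; exists i.
by move=> l lj; rewrite tmulmx_invr eq_sym (negbTE lj).
Qed.

Lemma tmulmx_invlK (K : finType) (B : tmatrix R K I) :
  (forall k i, B (k, i) != None -> exists j, A (j, i) != None) ->
  tmulmx (tmulmx B (tinvmx A)) A = B.
Proof.
move=> h; rewrite -tmulmxA; apply/ffunP => -[k i]; rewrite ffunE (@bigtmin_only _ _ i) /=.
  rewrite tmulmx_invl eqxx /=; case: existsP => [_|h']; first by rewrite tmul1r.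
  rewrite tmul0r; apply/esym/eqP; apply: contraT => /h[j hj]; case: h'; by exists j.
by move=> l lj; rewrite tmulmx_invl (negbTE lj) tmul0r.
Qed.

End Submonomial.

Lemma underMs (K J I : finType) (B : tmatrix R K J) (A : tmatrix R J I) x :
  submonomial B -> submonomial A ->
  under (tmulmx B A) x = under B (under A x).
Proof.
move=> hB hA; have hBA := submonomialM hB hA.
have [e|//] := @underM R K J I B A x hB hA; rewrite e.
case: x e => [i|] // /eqP/(underNP hBA) h; case e: (under A (Some i)) => [j|] //.
have nA : A (j, i) != None by move/eqP: e; rewrite under_some.
apply/esym/eqP/(underNP hB) => k; apply/eqP; apply: contraT => nB.
by have := h k; rewrite (tmulmx_col hA _ _ nA) => /eqP; rewrite -[_ == _]negbK tmul_neq0 nB nA.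
Qed.

End Matrices.

(** * The category of modular sheaves *)

Section Category.
Context {R : realType} {d : nat} {S : fan R d}.
Implicit Types M N P K W X Y Z Q : mtrs_ob S.

Local Notation "g 'oc' f" := (@compose (MTRS S) _ _ _ g f) (at level 50, left associativity).
Local Notation gpP M := (mtrs_gpP (sheafP M)).

Definition act M N (f : mtrs_hom M N) (x : option (gs M)) : option (gs N) := under (hmat f) x.

Definition ker M N (f : mtrs_hom M N) : {set option (gs M)} := act f @^-1: [set None].
Definition img M N (f : mtrs_hom M N) : {set option (gs N)} := act f @: setT.

Section Morphism.
Variables (M N : mtrs_ob S) (f : mtrs_hom M N).
Let hf := hmat_submonomial f.

Lemma actN : act f None = None. Proof. by []. Qed.

Lemma act_someP i j : act f (Some i) = Some j <-> hmat f (j, i) != None.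
Proof. by rewrite -(under_some hf (Some i)); split=> /eqP. Qed.

Lemma act_inj x y : act f x = act f y -> act f x != None -> x = y.
Proof. exact: under_inj. Qed.

Lemma mem_ker x : (x \in ker f) = (act f x == None).
Proof. by rewrite !inE. Qed.

Lemma mem_img x : act f x \in img f. Proof. exact: imset_f. Qed.

Lemma img_point : None \in img f. Proof. by rewrite -actN mem_img. Qed.

(** A vector that leaves the preimage in one element maps to one that leaves
    the flat in one element. So the underlying maps of morphisms are strong maps
    of matroids. *)
Lemma flat_preim H : flat (gp N) H -> flat (gp M) (act f @^-1: H).
Proof.
move=> fH; have NH := mtrs_flat_point (sheafP N) fH.
apply/(flat_evecP (sheafP M)); first by rewrite inE actN.
move=> X vX e; rewrite inE => eH Xe.
case ea : (act f (Some e)) => [j|]; last by rewrite ea NH in eH.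
rewrite ea in eH; move/act_someP: ea => ae.
have vfX : evec (tapp (hmat f) X) := hmat_vector f vX.
have [|j' [jj' j'H]] := (flat_evecP (sheafP N) NH).1 fH _ vfX j eH.
  by rewrite (tappE hf _ ae) tmul_neq0 ae.
move=> /tapp_neq0[e' ae' Xe']; exists e'; split=> //.
  by apply: contraNneq jj' => ee'; rewrite ee' in ae'; rewrite (hf.1 _ _ _ ae' ae).
by rewrite inE; have -> : act f (Some e') = Some j' by apply/act_someP.
Qed.

Lemma ker_flat : flat (gp M) (ker f).
Proof. apply: flat_preim; exact: (flat_bot (sheafP N)). Qed.

Lemma act_cl A x : x \in cl (gp M) A -> act f x \in cl (gp N) (act f @: A).
Proof.
have fc : flat (gp N) (cl (gp N) (act f @: A)) := cl_flat (gpP N) _.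
have := cl_min (gpP M) (flat_preim fc) (A := A).
move=> /(_ _)/subsetP h xA; have := h _ x xA; rewrite inE; apply.
apply/subsetP => y yA; rewrite inE; apply: (subsetP (sub_cl (gpP N) _)).
exact: imset_f.
Qed.

Lemma act_fil rho j x : x \in fil M rho j ->
  act f x \in fil N rho (j + pairing (hshift f) (gen S rho)).
Proof. by move=> xj; apply: (subsetP (hmat_fil f rho j)); exact: imset_f. Qed.

Lemma hmat0P : hmat f = tzero R (gs N) (gs M) <-> forall i, act f (Some i) = None.
Proof.
split=> [h i|h].
  by apply/eqP/(underNP hf) => j; rewrite h ffunE.
by apply/ffunP => -[j i]; rewrite ffunE; apply: (underNP hf _); apply/eqP; exact: h.
Qed.

End Morphism.

Lemma act_comp M N P (g : mtrs_hom N P) (f : mtrs_hom M N) x :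
  act (g oc f) x = act g (act f x).
Proof. by rewrite /act /= underMs //; exact: hmat_submonomial. Qed.

Lemma act_id M x : act (mtrs_id M) x = x.
Proof. exact: under1. Qed.

Lemma shift_comp M N P (g : mtrs_hom N P) (f : mtrs_hom M N) i :
  act (g oc f) (Some i) != None -> hshift (g oc f) = hshift f + hshift g.
Proof.
move=> h /=; rewrite /comp_shift; case: eqP => // e.
have /hmat0P e' : hmat (g oc f) = tzero R (gs P) (gs M) := e.
by rewrite e' in h.
Qed.

Lemma act_fil_comp M N P (g : mtrs_hom N P) (f : mtrs_hom M N) rho j x :
  act (g oc f) x \in fil P rho (j + pairing (hshift (g oc f)) (gen S rho)) ->
  act g (act f x) \in fil P rho (j + pairing (hshift f) (gen S rho) + pairing (hshift g) (gen S rho)).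
Proof.
case: x => [i|] h; last exact: fil_point.
have [e|ne] := eqVneq (act (g oc f) (Some i)) None.
  by rewrite -act_comp e fil_point.
by move: h; rewrite act_comp (shift_comp ne) pairingD addrA.
Qed.

(** ** Zero objects and zero morphisms *)

Lemma zero_vector M N (X : {ffun gs M -> trop R}) :
  is_vector (del_point M) X -> is_vector (del_point N) (tapp (tzero R (gs N) (gs M)) X).
Proof.
move=> _ Y _; apply/tnull_enumP => j; rewrite ffunE big1 ?tmul0l // => i _.
by rewrite ffunE.
Qed.

Lemma zero_fil M N rho (j : int) :
  under (tzero R (gs N) (gs M)) @: fil M rho j
    \subset fil N rho (j + pairing (0 : 'cV[int]_d) (gen S rho)).
Proof.
apply/subsetP => _ /imsetP[x _ ->]; have -> : under (tzero R (gs N) (gs M)) x = None.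
  by case: x => [x|] //=; case: pickP => // k; rewrite ffunE.
exact: fil_point.
Qed.

Lemma zero_sub (I J : finType) : submonomial (tzero R I J).
Proof. by split=> ? ? ?; rewrite ffunE. Qed.

Definition zero_hom M N : mtrs_hom M N :=
  MtrsHom (zero_sub _ _) (@zero_vector M N) (@zero_fil M N) (fun=> erefl).

Definition zero_sheaf : tsheaf S :=
  @TSheaf R d S void (fun x => if x is [::] then Some 0 else None) (fun _ _ => setT).

Lemma zero_sheafP : is_mtrs zero_sheaf.
Proof.
have voidT (A : {set option void}) : None \in A -> A = setT.
  by move=> NA; apply/setP => -[[]|]; rewrite inE.
have gp0 : is_gp 0 (gp zero_sheaf).
  split=> //=.
  - by case.
  - by exists [::].
  - by move=> x y /perm_size; case: x y => [|? ?] [|? ?].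
  - by case.
have pt0 x : None \in x -> gp zero_sheaf x = None by case: x.
split=> //.
- by exists 0%N.
- apply: (modular_of_rk gp0) => F G fF fG.
  rewrite (voidT F (flat_point gp0 pt0 fF)) (voidT G (flat_point gp0 pt0 fG)).
  by rewrite setUid setIid.
- by move=> rho j; exact: (flatT gp0).
- by move=> rho; exists 0 => j _; apply: esym; apply: voidT; rewrite inE.
- by move=> rho; exists 0 => j _.
Qed.

Lemma is_zeroP X : @is_zero (MTRS S) X <-> (gs X -> False).
Proof.
split=> [/(_ X)[[f [_ hf]] _] e|h W].
  have e1 : zero_hom X X = mtrs_id X.
    by rewrite -(hf (zero_hom X X)) // -(hf (mtrs_id X)).
  have /(congr1 (fun g => hmat g (e, e))) := e1.
  by rewrite /= !ffunE /= eqxx.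
split; [exists (zero_hom W X)|exists (zero_hom X W)]; split=> // f _; apply: mtrs_hom_eq.
- by apply/ffunP => -[j i]; case: (h j).
- by rewrite [RHS]hshift_norm //; apply/ffunP => -[j i]; case: (h j).
- by apply/ffunP => -[j i]; case: (h i).
- by rewrite [RHS]hshift_norm //; apply/ffunP => -[j i]; case: (h i).
Qed.

Lemma is_zerom_hmat X Y (f : mtrs_hom X Y) : @is_zerom (MTRS S) X Y f <-> hmat f = tzero R (gs Y) (gs X).
Proof.
split=> [[Z [a [b [/is_zeroP h ->]]]]|f0].
  apply/ffunP => -[j i]; rewrite !ffunE big1 // => k _; by case: (h k).
have Z0 : @is_zero (MTRS S) (Mtrs zero_sheafP) by apply/is_zeroP.
exists (Mtrs zero_sheafP), (zero_hom X (Mtrs zero_sheafP)), (zero_hom (Mtrs zero_sheafP) Y).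
split=> //; have e0 : tmulmx (tzero R (gs Y) void) (tzero R void (gs X)) = tzero R (gs Y) (gs X).
  exact: tmulmx0l.
apply: mtrs_hom_eq => /=; first by rewrite /comp_mat f0 [RHS]e0.
by rewrite hshift_norm // /comp_shift /comp_mat [tmulmx _ _]e0 eqxx.
Qed.

Lemma is_zeromP X Y (f : mtrs_hom X Y) :
  @is_zerom (MTRS S) X Y f <-> forall x, act f x = None.
Proof.
rewrite is_zerom_hmat hmat0P; split=> h x //; by case: x.
Qed.

(** ** Monomorphisms and epimorphisms *)

Lemma act_neq0_mono X Y (f : mtrs_hom X Y) : (forall i, act f (Some i) != None) ->
  @is_mono (MTRS S) X Y f.
Proof.
move=> hf W a b e.
have fK (A : tmatrix R (gs X) (gs W)) : tmulmx (tinvmx (hmat f)) (tmulmx (hmat f) A) = A.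
  rewrite tmulmxA; have -> : tmulmx (tinvmx (hmat f)) (hmat f) = tid R (gs X).
    apply/ffunP => -[i i']; rewrite (tmulmx_invl (hmat_submonomial f)) ffunE /=.
    rewrite (_ : [exists j, _] = true) ?andbT //; apply/existsP.
    by case ej : (act f (Some i)) (hf i) => [j|] // _; exists j; apply/act_someP.
  exact: tmulmx1l.
have eh : hmat a = hmat b.
  rewrite -(fK (hmat a)) -(fK (hmat b)); congr (tmulmx _ _).
  exact: (congr1 (fun g : mtrs_hom W Y => hmat g) e).
apply: mtrs_hom_eq => //.
case: (pselect (hmat a = tzero R (gs X) (gs W))) => a0.
  by rewrite !hshift_norm // -eh.
have [i ai] : exists i, act a (Some i) != None.
  apply: contra_notP a0 => h; apply/hmat0P => i; apply/eqP; apply: contra_notT h => h.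
  by exists i.
have nz : act (f oc a) (Some i) != None by rewrite act_comp; case: (act a _) ai.
have := shift_comp nz; rewrite e in nz *; rewrite (shift_comp nz).
by move/addIr.
Qed.

Lemma act_onto_epi X Y (f : mtrs_hom X Y) W (a b : mtrs_hom Y W) :
  (forall j, exists i, act f (Some i) = Some j) -> a oc f = b oc f -> a = b.
Proof.
move=> hf e.
have fK (A : tmatrix R (gs W) (gs Y)) : tmulmx (tmulmx A (hmat f)) (tinvmx (hmat f)) = A.
  rewrite -tmulmxA; have -> : tmulmx (hmat f) (tinvmx (hmat f)) = tid R (gs Y).
    apply/ffunP => -[j j']; rewrite (tmulmx_invr (hmat_submonomial f)) ffunE /=.
    rewrite (_ : [exists i, _] = true) ?andbT //; apply/existsP.
    by have [i /act_someP] := hf j; exists i.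
  exact: tmulmx1r.
have eh : hmat a = hmat b.
  rewrite -(fK (hmat a)) -(fK (hmat b)); congr (tmulmx _ _).
  exact: (congr1 (fun g : mtrs_hom X W => hmat g) e).
apply: mtrs_hom_eq => //.
case: (pselect (hmat a = tzero R (gs W) (gs Y))) => a0.
  by rewrite !hshift_norm // -eh.
have [j aj] : exists j, act a (Some j) != None.
  apply: contra_notP a0 => h; apply/hmat0P => i; apply/eqP; apply: contra_notT h => h.
  by exists i.
have [i fi] := hf j.
have nz : act (a oc f) (Some i) != None by rewrite act_comp fi.
have := shift_comp nz; rewrite e in nz *; rewrite (shift_comp nz).
by move/addrI.
Qed.

End Category.

(** * Strict monomorphisms and strict epimorphisms *)

Section Strict.
Context {R : realType} {d : nat} {S : fan R d}.
Implicit Types M N P K W X Y Z Q : mtrs_ob S.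

Local Notation "g 'oc' f" := (@compose (MTRS S) _ _ _ g f) (at level 50, left associativity).
Local Notation gpP M := (mtrs_gpP (sheafP M)).
Local Notation ide M := (@idm (MTRS S) M).

Lemma ocA M N P Q (f : mtrs_hom M N) (g : mtrs_hom N P) (k : mtrs_hom P Q) :
  k oc (g oc f) = (k oc g) oc f.
Proof. exact: mtrs_compA. Qed.

Lemma oc1l M N (f : mtrs_hom M N) : ide N oc f = f.
Proof. exact: mtrs_idl. Qed.

Lemma oc1r M N (f : mtrs_hom M N) : f oc ide M = f.
Proof. exact: mtrs_idr. Qed.

(** Embeddings are the strict monomorphisms and projections the strict
    epimorphisms, described without reference to other objects: a vector in the
    image, respectively any vector, has a preimage, and the filtration is the
    one induced by restriction, respectively by contraction. *)
Definition embedding K X (f : mtrs_hom K X) : Prop :=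
  [/\ forall i, act f (Some i) != None, flat (gp X) (img f),
      forall V, evec V -> (forall j, V j != None -> Some j \in img f) ->
        exists2 U : {ffun gs K -> trop R}, evec U & tapp (hmat f) U = V
    & forall rho j x, act f x \in fil X rho (j + pairing (hshift f) (gen S rho)) ->
        x \in fil K rho j].

Definition projection X Z (f : mtrs_hom X Z) : Prop :=
  [/\ forall z, exists i, act f (Some i) = Some z,
      forall V, evec V -> exists2 U : {ffun gs X -> trop R}, evec U & tapp (hmat f) U = V
    & forall rho j z, z \in fil Z rho (j + pairing (hshift f) (gen S rho)) ->
        exists2 x, x \in cl (gp X) (ker f :|: fil X rho j) & act f x = z].

(** ** Restrictions are embeddings *)

Section Inclusion.
Variables (M : mtrs_ob S) (F : {set option (gs M)}) (fF : flat (gp M) F).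

Definition restr_ob : mtrs_ob S := Mtrs (restr_mtrs (sheafP M) fF).

Lemma incl_neq0 j i : (incl_mat M F (j, i) != None) = (j == val i).
Proof. by rewrite ffunE /=; case: (j == val i). Qed.

Lemma incl_sub : submonomial (incl_mat M F).
Proof.
by split=> i j j'; rewrite !incl_neq0 => /eqP e /eqP e'; [rewrite e e'|apply: val_inj; rewrite -e -e'].
Qed.

Lemma incl_under x : under (incl_mat M F) x = omap val x.
Proof.
case: x => [i|] //; apply/eqP; rewrite (under_some incl_sub) incl_neq0.
exact: eqxx.
Qed.

Lemma tapp_incl (X : {ffun gs restr_ob -> trop R}) i : tapp (incl_mat M F) X (val i) = X i.
Proof.
rewrite (tappE incl_sub _ (i := i)) ?incl_neq0 // ffunE /= eqxx.
exact: tmul1l.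
Qed.

Lemma incl_vector (X : {ffun gs restr_ob -> trop R}) :
  is_vector (del_point restr_ob) X -> is_vector (del_point M) (tapp (incl_mat M F) X).
Proof.
move=> vX; apply/(evec_restr (sheafP M) fF).
  by move=> e /tapp_neq0[i]; rewrite incl_neq0 => /eqP -> _; exact: (valP i).
by congr (is_vector _ _): vX; apply/ffunP => i; rewrite ffunE tapp_incl.
Qed.

Lemma incl_fil rho (j : int) :
  under (incl_mat M F) @: fil restr_ob rho j
    \subset fil M rho (j + pairing (0 : 'cV[int]_d) (gen S rho)).
Proof.
rewrite pairing0 addr0; apply/subsetP => _ /imsetP[x xj ->]; rewrite incl_under.
by move: xj; rewrite /= !inE => /andP[].
Qed.

Definition incl_hom : mtrs_hom restr_ob M :=
  @MtrsHom R d S restr_ob M (incl_mat M F) 0 incl_sub incl_vector incl_fil (fun=> erefl).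

Lemma act_incl x : act incl_hom x = omap val x.
Proof. exact: incl_under. Qed.

Lemma img_incl : img incl_hom = F.
Proof.
rewrite -[RHS](remb_img (sheafP M) fF); apply: eq_imset => x; exact: act_incl.
Qed.

Lemma incl_embedding : embedding incl_hom.
Proof.
split.
- by move=> i; rewrite act_incl.
- by rewrite img_incl.
- move=> V vV; rewrite img_incl => sV.
  exists [ffun i => V (val i)]; first by apply/(evec_restr (sheafP M) fF).
  apply/ffunP => j; case: (boolP (Some j \in F)) => jF.
    by rewrite -[j]/(val (Sub j jF : gs restr_ob)) tapp_incl ffunE.
  have -> : V j = None by apply/eqP; apply: contraNT jF; exact: sV.
  apply/eqP; apply: contraNT jF => /tapp_neq0[i]; rewrite incl_neq0 => /eqP -> _.
  exact: (valP i).
move=> rho j x; rewrite pairing0 addr0 act_incl => xj.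
by rewrite /= !inE xj (remb_in (sheafP M) fF).
Qed.

End Inclusion.

(** ** Contractions are projections *)

Section Projection.
Variables (M : mtrs_ob S) (F : {set option (gs M)}) (fF : flat (gp M) F).

Definition contr_ob : mtrs_ob S := Mtrs (contr_mtrs (sheafP M) fF).

Definition proj_mat : tmatrix R (gs contr_ob) (gs M) :=
  [ffun p => if p.2 == val p.1 then Some 0 else None].

Lemma proj_neq0 j i : (proj_mat (j, i) != None) = (i == val j).
Proof. by rewrite ffunE /=; case: (i == val j). Qed.

Lemma proj_sub : submonomial proj_mat.
Proof.
by split=> i j j'; rewrite !proj_neq0 => /eqP e /eqP e'; [apply: val_inj; rewrite -e -e'|rewrite e e'].
Qed.

Lemma proj_underP x z : under proj_mat x = Some z <-> x = Some (val z).
Proof.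
case: x => [i|] //; split=> [/eqP|[->]].
  by rewrite (under_some proj_sub) proj_neq0 => /eqP ->.
by apply/eqP; rewrite (under_some proj_sub) proj_neq0.
Qed.

Lemma tapp_proj (X : {ffun gs M -> trop R}) : tapp proj_mat X = [ffun i => X (val i)].
Proof.
apply/ffunP => i; rewrite (tappE proj_sub _ (i := val i)) ?proj_neq0 // ffunE /= eqxx ffunE.
exact: tmul1l.
Qed.

Lemma proj_vector (X : {ffun gs M -> trop R}) :
  is_vector (del_point M) X -> is_vector (del_point contr_ob) (tapp proj_mat X).
Proof. by move=> vX; rewrite tapp_proj; exact: (evec_contr (sheafP M) fF). Qed.

Lemma proj_fil rho (j : int) :
  under proj_mat @: fil M rho j
    \subset fil contr_ob rho (j + pairing (0 : 'cV[int]_d) (gen S rho)).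
Proof.
rewrite pairing0 addr0; apply/subsetP => _ /imsetP[x xj ->].
case e : (under proj_mat x) => [z|]; last exact: fil_point.
move/proj_underP: e xj => -> xj; rewrite /= inE.
by apply: (subsetP (sub_cl (gpP M) _)); rewrite inE xj orbT.
Qed.

Definition proj_hom : mtrs_hom M contr_ob :=
  @MtrsHom R d S M contr_ob proj_mat 0 proj_sub proj_vector proj_fil (fun=> erefl).

Lemma act_projP x z : act proj_hom x = Some z <-> x = Some (val z).
Proof. exact: proj_underP. Qed.

Lemma ker_proj : ker proj_hom = F.
Proof.
apply/setP => x; rewrite mem_ker; apply/eqP/idP => [h|xF].
  apply: contraT => xF; have [[z|] e] := cemb_out (sheafP M) fF xF.
    by have /act_projP := e; rewrite h.
  by rewrite e /= (mtrs_flat_point (sheafP M) fF) in xF.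
case e : (act _ x) => [z|] //; move/act_projP: e xF => -> xF.
by have := cemb_in (sheafP M) fF (Some z); rewrite /= xF.
Qed.

Lemma proj_projection : projection proj_hom.
Proof.
split.
- by move=> z; exists (val z); apply/act_projP.
- move=> V /(evec_contr_lift (sheafP M) fF)[U vU UV]; exists U => //.
  by rewrite tapp_proj; apply/ffunP => i; rewrite ffunE UV.
move=> rho j z; rewrite pairing0 addr0 => zj; exists (omap val z).
  by rewrite ker_proj; move: zj; rewrite /= inE.
by case: z {zj} => [z|] //; apply/act_projP.
Qed.

End Projection.

(** ** Factorizations *)

(** The factorization is composition with the inverse matrix; preimages of
    vectors show that it maps vectors to vectors. *)
Lemma embedding_lift K X W (f : mtrs_hom K X) (a : mtrs_hom W X) : embedding f ->
  (forall x, act a x \in img f) -> exists t : mtrs_hom W K, f oc t = a.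
Proof.
move=> [inj _ lift fi] im.
have hf := hmat_submonomial f; have ha := hmat_submonomial a.
pose A := tmulmx (tinvmx (hmat f)) (hmat a).
pose u : 'cV[int]_d := if A == tzero R (gs K) (gs W) then 0 else hshift a - hshift f.
have hA : submonomial A by apply: submonomialM => //; exact: tinvmx_sub.
have fA : tmulmx (hmat f) A = hmat a.
  apply: (tmulmx_invrK hf) => j k ajk.
  have /act_someP e := ajk; have := im (Some k); rewrite e => /imsetP[[i|] _ // e'].
  by exists i; apply/act_someP.
have invf (U : {ffun gs K -> trop R}) : tapp (tinvmx (hmat f)) (tapp (hmat f) U) = U.
  rewrite -tappM; have -> : tmulmx (tinvmx (hmat f)) (hmat f) = tid R (gs K); last exact: tapp1.
  apply/ffunP => -[i i']; rewrite (tmulmx_invl hf) ffunE /=.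
  rewrite (_ : [exists j, _] = true) ?andbT //; apply/existsP.
  by case ej : (act f (Some i)) (inj i) => [j|] // _; exists j; apply/act_someP.
have vA (V : {ffun gs W -> trop R}) : is_vector (del_point W) V -> is_vector (del_point K) (tapp A V).
  move=> vV; rewrite tappM; have [||U vU <-] := lift (tapp (hmat a) V); last by rewrite invf.
    exact: (hmat_vector a).
  by move=> j /tapp_neq0[i /act_someP <- _].
have filA rho (j : int) : under A @: fil W rho j \subset fil K rho (j + pairing u (gen S rho)).
  apply/subsetP => _ /imsetP[x xj ->].
  case: x xj => [i|] xj; last exact: fil_point.
  case e : (under A (Some i)) => [k|]; last exact: fil_point.
  have uE : u = hshift a - hshift f.
    rewrite /u; case: eqP => // A0.
    by move/eqP: e; rewrite (under_some hA) A0 ffunE.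
  apply: fi; have -> : act f (Some k) = act a (Some i).
    by rewrite /act -fA -e -underMs.
  rewrite -addrA -pairingD uE subrK; exact: act_fil.
have normA : A = tzero R (gs K) (gs W) -> u = 0 by rewrite /u => ->; rewrite eqxx.
exists (@MtrsHom R d S _ _ A u hA vA filA normA); apply: mtrs_hom_eq => //=.
rewrite /comp_shift /comp_mat /= fA; case: eqP => [/hshift_norm //|nz].
rewrite /u; case: eqP => [A0|_]; last by rewrite subrK.
by case: nz; rewrite -fA A0 tmulmx0r.
Qed.

Lemma projection_lift X Z W (f : mtrs_hom X Z) (h : mtrs_hom X W) : projection f ->
  ker f \subset ker h -> exists t : mtrs_hom Z W, t oc f = h.
Proof.
move=> [onto lift fi] /subsetP kf.
have hf := hmat_submonomial f; have hh := hmat_submonomial h.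
pose A := tmulmx (hmat h) (tinvmx (hmat f)).
pose u : 'cV[int]_d := if A == tzero R (gs W) (gs Z) then 0 else hshift h - hshift f.
have hA : submonomial A by apply: submonomialM => //; exact: tinvmx_sub.
have Af : tmulmx A (hmat f) = hmat h.
  apply: (tmulmx_invlK hf) => k i hki.
  have : Some i \notin ker f.
    apply: contraTN hki => /kf; rewrite mem_ker => /eqP hi.
    by rewrite negbK; apply/eqP; apply: (underNP hh _); rewrite -/(act h (Some i)) hi.
  by rewrite mem_ker; case e : (act f (Some i)) => [j|] // _; exists j; apply/act_someP.
have vA (V : {ffun gs Z -> trop R}) : is_vector (del_point Z) V -> is_vector (del_point W) (tapp A V).
  by move=> /lift[U vU <-]; rewrite -tappM Af; exact: (hmat_vector h).
have filA rho (j : int) : under A @: fil Z rho j \subset fil W rho (j + pairing u (gen S rho)).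
  apply/subsetP => _ /imsetP[z zj ->].
  case: z zj => [i|] zj; last exact: fil_point.
  case e : (under A (Some i)) => [k|]; last exact: fil_point.
  have uE : u = hshift h - hshift f.
    rewrite /u; case: eqP => // A0.
    by move/eqP: e; rewrite (under_some hA) A0 ffunE.
  have [|x xc fx] := fi rho (j - pairing (hshift f) (gen S rho)) (Some i).
    by rewrite subrK.
  have -> : Some k = act h x by rewrite /act -Af underMs // -/(act f x) fx e.
  have -> : j + pairing u (gen S rho) = j - pairing (hshift f) (gen S rho) + pairing (hshift h) (gen S rho).
    have -> : pairing (hshift h) (gen S rho) = pairing (hshift f) (gen S rho) + pairing u (gen S rho).
      by rewrite -pairingD uE addrC subrK.
    by rewrite addrA subrK.
  apply: (subsetP _ _ (act_cl h xc)).
  apply: (cl_min (gpP W)); first exact: (mtrs_flat (sheafP W)).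
  apply/subsetP => w /imsetP[y]; rewrite in_setU => /orP[/kf yk|yj] ->.
    by move: yk; rewrite mem_ker => /eqP ->; exact: fil_point.
  exact: act_fil.
have normA : A = tzero R (gs W) (gs Z) -> u = 0 by rewrite /u => ->; rewrite eqxx.
exists (@MtrsHom R d S _ _ A u hA vA filA normA); apply: mtrs_hom_eq => //=.
rewrite /comp_shift /comp_mat /= Af; case: eqP => [/hshift_norm //|nz].
rewrite /u; case: eqP => [A0|_]; last by rewrite addrC subrK.
by case: nz; rewrite -Af A0 tmulmx0l.
Qed.

Lemma embedding_mono K X (f : mtrs_hom K X) : embedding f -> @is_mono (MTRS S) K X f.
Proof. by case=> h _ _ _; exact: act_neq0_mono. Qed.

Lemma projection_epi X Z W (f : mtrs_hom X Z) (a b : mtrs_hom Z W) : projection f ->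
  a oc f = b oc f -> a = b.
Proof. by case=> h _ _; exact: act_onto_epi. Qed.

(** ** Flats along embeddings and projections *)

Lemma act_eq_some X Y (f : mtrs_hom X Y) x y z :
  act f x = Some z -> act f y = Some z -> x = y.
Proof. by move=> ex ey; apply: (@act_inj _ _ _ _ _ f); rewrite ex. Qed.

Lemma embedding_inj K X (f : mtrs_hom K X) : embedding f -> injective (act f).
Proof.
move=> [inj _ _ _] [x|] [y|] // e; first by apply: (act_inj e); exact: inj.
  by move: (inj x); rewrite e.
by move: (inj y); rewrite -e.
Qed.

(** A vector that leaves $f(H)$ in one element either lies over the image, and
    then comes from one that leaves $H$ in one element, or leaves the image
    itself in one element. *)
Lemma embedding_flat K X (f : mtrs_hom K X) H : embedding f ->
  flat (gp K) H -> flat (gp X) (act f @: H).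
Proof.
move=> ef fH; have fi := embedding_inj ef; have [inj fim lift _] := ef.
have NH := mtrs_flat_point (sheafP K) fH.
apply/(flat_evecP (sheafP X)); first by rewrite -(actN f) imset_f.
move=> V vV e eH Ve; apply: contrapT => no.
have out e' : e' != e -> V e' != None -> Some e' \in act f @: H.
  by move=> ne Ve'; apply: contraT => h; case: no; exists e'.
have HI : act f @: H \subset img f by apply: imsetS; exact: subsetT.
case: (boolP (Some e \in img f)) => eI.
  have [|U vU UV] := lift V vV.
    by move=> j Vj; have [->//|ne] := eqVneq j e; apply: (subsetP HI); exact: out.
  have /imsetP[[i|] _ // ei] := eI.
  have fie : hmat f (e, i) != None by apply/act_someP.
  have Ui : U i != None.
    by move: Ve; rewrite -UV (tappE (hmat_submonomial f) _ fie) tmul_neq0 => /andP[].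
  have iH : Some i \notin H by apply: contra eH => iH; rewrite ei imset_f.
  have [i' [ne iH' Ui']] := (flat_evecP (sheafP K) NH).1 fH U vU i iH Ui.
  case ei' : (act f (Some i')) (inj i') => [e'|] // _.
  have fie' : hmat f (e', i') != None by apply/act_someP.
  have Ve' : V e' != None by rewrite -UV (tappE (hmat_submonomial f) _ fie') tmul_neq0 fie'.
  have ne' : e' != e.
    by apply: contraNneq ne => ee'; have := fi (Some i') (Some i); rewrite ei' -ei ee' => /(_ erefl)[->].
  by move: (out _ ne' Ve'); rewrite -ei' mem_imset // (negbTE iH').
have [e' [ne eI' Ve']] := (flat_evecP (sheafP X) (img_point f)).1 fim V vV e eI Ve.
by move: (subsetP HI _ (out _ ne Ve')); rewrite (negbTE eI').
Qed.

Lemma embedding_cl K X (f : mtrs_hom K X) (A : {set option (gs K)}) x : embedding f ->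
  act f x \in cl (gp X) (act f @: A) -> x \in cl (gp K) A.
Proof.
move=> ef h; have fi := embedding_inj ef.
rewrite -(mem_imset _ _ fi); move: h; apply/subsetP.
apply: (cl_min (gpP X)); first by apply: embedding_flat => //; exact: (cl_flat (gpP K)).
by apply: imsetS; exact: (sub_cl (gpP K)).
Qed.

Lemma projection_flat X Z (f : mtrs_hom X Z) H : projection f ->
  flat (gp X) H -> ker f \subset H -> flat (gp Z) (act f @: H).
Proof.
move=> [onto lift _] fH /subsetP kH; have NH := mtrs_flat_point (sheafP X) fH.
have hf := hmat_submonomial f.
apply/(flat_evecP (sheafP Z)); first by rewrite -(actN f) imset_f.
move=> V vV z zH Vz; have [U vU UV] := lift V vV.
have [i iz] := onto z; have fiz : hmat f (z, i) != None by apply/act_someP.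
have Ui : U i != None by move: Vz; rewrite -UV (tappE hf _ fiz) tmul_neq0 => /andP[].
have iH : Some i \notin H by apply: contra zH => iH; rewrite -iz imset_f.
have [i' [ne iH' Ui']] := (flat_evecP (sheafP X) NH).1 fH U vU i iH Ui.
case ei' : (act f (Some i')) => [z'|]; last first.
  by move: iH'; rewrite kH // mem_ker ei'.
have fiz' : hmat f (z', i') != None by apply/act_someP.
exists z'; split.
- by apply: contraNneq ne => ee; have [->] := act_eq_some ei' (etrans iz (congr1 Some (esym ee))).
- apply: contra iH' => /imsetP[y yH e]; by rewrite (act_eq_some ei' (esym e)).
by rewrite -UV (tappE hf _ fiz') tmul_neq0 fiz'.
Qed.

Lemma projection_fil X Z (f : mtrs_hom X Z) rho j x : projection f ->
  act f x \in fil Z rho (j + pairing (hshift f) (gen S rho)) ->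
  x \in cl (gp X) (ker f :|: fil X rho j).
Proof.
move=> [_ _ fi] /fi[y yc e].
case ez : (act f x) => [z|]; first by rewrite (act_eq_some ez (etrans e ez)).
by apply: (subsetP (sub_cl (gpP X) _)); rewrite in_setU mem_ker ez.
Qed.

(** ** Composition and isomorphisms *)

Lemma embedding_comp K X Y (f : mtrs_hom K X) (g : mtrs_hom X Y) :
  embedding f -> embedding g -> embedding (g oc f).
Proof.
move=> ef eg; have [fin fim fli ffi] := ef; have [gin gim gli gfi] := eg.
have inj i : act (g oc f) (Some i) != None.
  by rewrite act_comp; case e: (act f (Some i)) (fin i).
have imE : img (g oc f) = act g @: img f.
  by rewrite /img -imset_comp; apply: eq_imset => x; exact: act_comp.
split=> //.
- by rewrite imE; exact: embedding_flat.
- move=> V vV; rewrite imE => sV; have [|U vU UV] := gli V vV.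
    by move=> j /sV; apply/subsetP; apply: imsetS; exact: subsetT.
  have [|T vT TU] := fli U vU; last by exists T; rewrite // tappM TU.
  move=> k Uk; case ek : (act g (Some k)) (gin k) => [j|] // _.
  have gk : hmat g (j, k) != None by apply/act_someP.
  have := sV j; rewrite -UV (tappE (hmat_submonomial g) _ gk) tmul_neq0 gk => /(_ Uk).
  by rewrite -ek mem_imset //; exact: embedding_inj.
move=> rho j [i|] h; last exact: fil_point.
by apply: ffi; apply: gfi; exact: act_fil_comp.
Qed.

Lemma projection_comp X Y Z (f : mtrs_hom X Y) (g : mtrs_hom Y Z) :
  projection f -> projection g -> projection (g oc f).
Proof.
move=> pf pg; have [fon fli ffi] := pf; have [gon gli gfi] := pg.
have on z : exists i, act (g oc f) (Some i) = Some z.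
  by have [j ej] := gon z; have [i ei] := fon j; exists i; rewrite act_comp ei.
split=> //.
  by move=> V /gli[U /fli[T vT TU] UV]; exists T; rewrite // tappM TU.
move=> rho j [z|] h; last first.
  exists None => //; apply: (mtrs_flat_point (sheafP X)); exact: (cl_flat (gpP X)).
have [i ei] := on z; exists (Some i) => //.
have := act_fil_comp (etrans (congr1 (fun x => x \in _) ei) h).
move=> /(projection_fil pg) hi.
set H := cl _ _; have fH : flat (gp X) H := cl_flat (gpP X) _.
have kfH : ker f \subset H.
  apply: subset_trans (sub_cl (gpP X) _); apply/subsetP => x; rewrite in_setU !mem_ker act_comp.
  by move=> /eqP ->.
have cH := cl_min (gpP Y) (projection_flat pf fH kfH).
have : act f (Some i) \in act f @: H.
  apply: (subsetP (cH _ _)) hi; apply/subsetP => y; rewrite in_setU => /orP[|yj].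
    case: y => [y|]; last by rewrite -(actN f) imset_f // (mtrs_flat_point (sheafP X)).
    have [k <-] := fon y; rewrite mem_ker -act_comp => kk; apply: imset_f.
    by apply: (subsetP (sub_cl (gpP X) _)); rewrite in_setU mem_ker kk.
  case: y yj => [y|] yj; last by rewrite -(actN f) imset_f // (mtrs_flat_point (sheafP X)).
  have [k ek] := fon y; rewrite -ek in yj *; apply: imset_f.
  have := projection_fil pf yj; apply/subsetP; apply: (clS (gpP X)).
  by apply: setSU; apply/subsetP => x; rewrite !mem_ker act_comp => /eqP ->.
case/imsetP => y yH e; have [e0|/(act_inj e) -> //] := eqVneq (act f (Some i)) None.
by apply: (subsetP kfH); rewrite mem_ker e0.
Qed.

Lemma iso_actK M N (s : mtrs_hom M N) (t : mtrs_hom N M) : t oc s = ide M ->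
  cancel (act s) (act t).
Proof. by move=> e x; rewrite -act_comp e act_id. Qed.

Lemma iso_shift M N (s : mtrs_hom M N) (t : mtrs_hom N M) (i : gs M) : t oc s = ide M ->
  hshift s + hshift t = 0.
Proof. by move=> e; rewrite -(@shift_comp _ _ _ _ _ _ t s i) e // act_id. Qed.

Lemma iso_tappK M N (s : mtrs_hom M N) (t : mtrs_hom N M) : t oc s = ide M ->
  cancel (tapp (hmat s)) (tapp (hmat t)).
Proof.
move=> e X; rewrite -tappM; have -> : tmulmx (hmat t) (hmat s) = tid R (gs M); last exact: tapp1.
exact: (congr1 (fun g : mtrs_hom M M => hmat g) e).
Qed.

Lemma iso_embedding M N (s : mtrs_hom M N) : @is_iso (MTRS S) M N s -> embedding s.
Proof.
move=> [t [ts st]]; have sK := iso_actK ts; have tK := iso_actK st; split.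
- by move=> i; apply/eqP => e; have := sK (Some i); rewrite e.
- suff -> : img s = setT by exact: (flatT (gpP N)).
  by apply/setP => y; rewrite inE -[y]tK mem_img.
- by move=> V vV _; exists (tapp (hmat t) V); [exact: (hmat_vector t)|exact: (iso_tappK st)].
move=> rho j [i|] h; last exact: fil_point.
have := act_fil t h; rewrite sK -addrA -pairingD (iso_shift i ts).
by rewrite pairing0 addr0.
Qed.

Lemma iso_projection M N (s : mtrs_hom M N) : @is_iso (MTRS S) M N s -> projection s.
Proof.
move=> [t [ts st]]; have sK := iso_actK ts; have tK := iso_actK st; split.
- move=> z; case e : (act t (Some z)) => [i|]; first by exists i; rewrite -e tK.
  by have := tK (Some z); rewrite e.
- by move=> V vV; exists (tapp (hmat t) V); [exact: (hmat_vector t)|exact: (iso_tappK st)].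
move=> rho j z h; exists (act t z); last exact: tK.
case: z h => [z|] h; last first.
  by apply: (mtrs_flat_point (sheafP M)); exact: (cl_flat (gpP M)).
apply: (subsetP (sub_cl (gpP M) _)); rewrite inE; apply/orP; right.
have := act_fil t h; rewrite -addrA -pairingD (addrC (hshift s)) (iso_shift z st).
by rewrite pairing0 addr0.
Qed.

Lemma embedding_unique K K' X (f : mtrs_hom K X) (f' : mtrs_hom K' X) :
  embedding f -> embedding f' -> img f = img f' ->
  exists2 s : mtrs_hom K K', @is_iso (MTRS S) K K' s & f' oc s = f.
Proof.
move=> ef ef' e.
have [|s es] := @embedding_lift _ _ _ f' f ef'; first by move=> x; rewrite -e mem_img.
have [|t et] := @embedding_lift _ _ _ f f' ef; first by move=> x; rewrite e mem_img.
exists s => //; exists t; split.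
- by apply: (embedding_mono ef); rewrite ocA et es oc1r.
- by apply: (embedding_mono ef'); rewrite ocA es et oc1r.
Qed.

Lemma projection_unique X Z Z' (f : mtrs_hom X Z) (f' : mtrs_hom X Z') :
  projection f -> projection f' -> ker f = ker f' ->
  exists2 s : mtrs_hom Z Z', @is_iso (MTRS S) Z Z' s & s oc f = f'.
Proof.
move=> pf pf' e.
have [|s es] := @projection_lift _ _ _ f f' pf; first by rewrite e.
have [|t et] := @projection_lift _ _ _ f' f pf'; first by rewrite e.
exists s => //; exists t; split.
- by apply: (projection_epi pf); rewrite -ocA es et oc1l.
- by apply: (projection_epi pf'); rewrite -ocA et es oc1l.
Qed.

End Strict.

(** * The quasi-proto-abelian structure *)

Section ProtoAbelian.
Context {R : realType} {d : nat} {S : fan R d}.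
Implicit Types M N P K W X Y Z Q : mtrs_ob S.

Local Notation "g 'oc' f" := (@compose (MTRS S) _ _ _ g f) (at level 50, left associativity).
Local Notation gpP M := (mtrs_gpP (sheafP M)).
Local Notation ide M := (@idm (MTRS S) M).

Lemma img_sub_ker X Y Z (f : mtrs_hom X Y) (g : mtrs_hom Y Z) :
  @is_zerom (MTRS S) X Z (g oc f) <-> img f \subset ker g.
Proof.
rewrite is_zeromP; split=> [h|/subsetP h x].
  by apply/subsetP => _ /imsetP[x _ ->]; rewrite mem_ker -act_comp h.
by rewrite act_comp; apply/eqP; rewrite -mem_ker h // mem_img.
Qed.

Lemma embedding_kernel K X Y (k : mtrs_hom K X) (f : mtrs_hom X Y) :
  embedding k -> img k = ker f -> @is_kernel (MTRS S) X Y f K k.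
Proof.
move=> ek e; split; first by apply/img_sub_ker; rewrite e.
move=> W a /img_sub_ker /subsetP im.
have [|t et] := @embedding_lift _ _ _ _ _ _ k a ek; first by move=> x; rewrite e im // mem_img.
by exists t; split=> // t' et'; apply: (embedding_mono ek); rewrite et et'.
Qed.

(** A morphism that kills the image of [f] kills its closure, because kernels
    are flats. *)
Lemma projection_cokernel X Y Q (q : mtrs_hom Y Q) (f : mtrs_hom X Y) :
  projection q -> ker q = cl (gp Y) (img f) -> @is_cokernel (MTRS S) X Y f Q q.
Proof.
move=> pq e; split; first by apply/img_sub_ker; rewrite e; exact: (sub_cl (gpP Y)).
move=> W a /img_sub_ker im.
have [|t et] := @projection_lift _ _ _ _ _ _ q a pq.
  by rewrite e; apply: (cl_min (gpP Y)) => //; exact: ker_flat.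
by exists t; split=> // t' et'; apply: (projection_epi pq); rewrite et et'.
Qed.

Lemma kernel_exists X Y (f : mtrs_hom X Y) :
  @is_kernel (MTRS S) X Y f (restr_ob (ker_flat f)) (incl_hom (ker_flat f)).
Proof. by apply: embedding_kernel; [exact: incl_embedding|exact: img_incl]. Qed.

Lemma cokernel_exists X Y (f : mtrs_hom X Y) :
  @is_cokernel (MTRS S) X Y f (contr_ob (cl_flat (gpP Y) (img f))) (proj_hom (cl_flat (gpP Y) (img f))).
Proof. by apply: projection_cokernel; [exact: proj_projection|exact: ker_proj]. Qed.

Lemma kernel_embedding K X Y (k : mtrs_hom K X) (f : mtrs_hom X Y) :
  @is_kernel (MTRS S) X Y f K k -> embedding k /\ img k = ker f.
Proof.
move=> [kz ku].
have ei := incl_embedding (ker_flat f); set i := incl_hom _ in ei.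
have [|s es] := @embedding_lift _ _ _ _ _ _ i k ei.
  by move=> x; rewrite img_incl; have /img_sub_ker/subsetP := kz; apply; exact: mem_img.
have [iz _] := kernel_exists f; have [t [et _]] := ku _ i iz.
have st : s oc t = ide _ by apply: (embedding_mono ei); rewrite ocA es oc1r.
have ts : t oc s = ide _.
  have [t0 [_ ut]] := ku _ k kz.
  by rewrite -(ut (t oc s)) ?ocA ?et // (ut (ide _)) // oc1r.
have es' : embedding s by apply: iso_embedding; exists t.
have ek : embedding k by rewrite -es; exact: embedding_comp.
split=> //; rewrite -(img_incl (ker_flat f)) -/i; apply/eqP; rewrite eqEsubset; apply/andP; split.
  by apply/subsetP => _ /imsetP[x _ ->]; rewrite -es act_comp mem_img.
by apply/subsetP => _ /imsetP[x _ ->]; rewrite -et act_comp mem_img.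
Qed.

Lemma cokernel_projection X Y Q (q : mtrs_hom Y Q) (f : mtrs_hom X Y) :
  @is_cokernel (MTRS S) X Y f Q q -> projection q /\ ker q = cl (gp Y) (img f).
Proof.
move=> [qz qu].
have fF := cl_flat (gpP Y) (img f).
have pp := proj_projection fF; set p := proj_hom _ in pp.
have kp : ker p = cl (gp Y) (img f) := ker_proj fF.
have [|s es] := @projection_lift _ _ _ _ _ _ p q pp.
  rewrite kp; apply: (cl_min (gpP Y)); first exact: ker_flat.
  by apply/img_sub_ker.
have pz : @is_zerom (MTRS S) X _ (p oc f) by apply/img_sub_ker; rewrite kp; exact: (sub_cl (gpP Y)).
have [t [et _]] := qu _ p pz.
have ts : t oc s = ide _ by apply: (projection_epi pp); rewrite -ocA es et oc1l.
have st : s oc t = ide _.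
  have [t0 [_ ut]] := qu _ q qz.
  by rewrite -(ut (s oc t)) -?ocA ?et // (ut (ide _)) // oc1l.
have ps : projection s by apply: iso_projection; exists t.
have pq : projection q by rewrite -es; exact: projection_comp.
split=> //; rewrite -kp; apply/setP => x; rewrite !mem_ker -et act_comp.
have ct := iso_actK st.
by apply/eqP/eqP => [->//|e]; rewrite -[act q x]ct e.
Qed.

Lemma strict_monoP K X (f : mtrs_hom K X) : @strict_mono (MTRS S) K X f <-> embedding f.
Proof.
split=> [[Y [g /kernel_embedding[]]]//|ef].
have [_ fim _ _] := ef.
exists (contr_ob fim), (proj_hom fim); apply: embedding_kernel => //.
by rewrite ker_proj.
Qed.

Lemma strict_epiP X Z (f : mtrs_hom X Z) : @strict_epi (MTRS S) X Z f <-> projection f.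
Proof.
split=> [[W [g /cokernel_projection[]]]//|pf].
exists (restr_ob (ker_flat f)), (incl_hom (ker_flat f)); apply: projection_cokernel => //.
by rewrite img_incl (cl_id (gpP X)) //; exact: ker_flat.
Qed.

Lemma zero_kernel_mono X Y (f : mtrs_hom X Y) K (k : mtrs_hom K X) :
  @is_kernel (MTRS S) X Y f K k -> @is_zero (MTRS S) K -> @is_mono (MTRS S) X Y f.
Proof.
move=> /kernel_embedding[ek e] /is_zeroP K0; apply: act_neq0_mono => i; apply/negP => h.
have : Some i \in img k by rewrite e mem_ker.
by case/imsetP => -[j|] // _; case: (K0 j).
Qed.

Lemma tapp_inj K X (f : mtrs_hom K X) : embedding f -> injective (tapp (hmat f)).
Proof.
move=> [inj _ _ _] U V e; apply/ffunP => i.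
case ej : (act f (Some i)) (inj i) => [j|] // _; move/act_someP: ej => h.
have := congr1 (fun U : {ffun gs X -> trop R} => U j) e.
rewrite !(tappE (hmat_submonomial f) _ h).
by case: (hmat f _) h (U i) (V i) => // a _ [x|] [y|] //= [] /addrI ->.
Qed.

(** Here [p] is the restriction of $X$ to the preimage $G$ of the image of [g].
    With $F$ the kernel of [f], the projection property of [q] asks for the
    filtration $F\vee(G\wedge E_j)$ where [f] and [g] provide
    $G\wedge(F\vee E_j)$; the modular law identifies them. *)
Lemma pullback_projection X Y Z P (f : mtrs_hom X Z) (g : mtrs_hom Y Z) (q : mtrs_hom P Y)
    (p : mtrs_hom P X) : projection f -> embedding g -> embedding p ->
  img p = act f @^-1: img g -> hshift p = 0 -> g oc q = f oc p -> projection q.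
Proof.
move=> pf eg ep imp sp e; have [fon fli ffi] := pf; have [gin gim gli gfi] := eg.
have [pin pim pli pfi] := ep; have gi := embedding_inj eg; have pi := embedding_inj ep.
have ac x : act g (act q x) = act f (act p x) by rewrite -!act_comp e.
have on z : exists i, act q (Some i) = Some z.
  case ez : (act g (Some z)) (gin z) => [w|] // _.
  have [x fx] := fon w.
  have : Some x \in img p by rewrite imp inE fx -ez mem_img.
  case/imsetP => -[i|] // _ ex; exists i; apply: gi.
  by rewrite ac -ex fx ez.
split=> //.
  move=> V vV; have vgV : evec (tapp (hmat g) V) := hmat_vector g vV.
  have [U vU UV] := fli _ vgV.
  have [|T vT TU] := pli U vU.
    move=> x Ux; rewrite imp inE; case ex : (act f (Some x)) => [w|]; last exact: img_point.
    have h : hmat f (w, x) != None by apply/act_someP.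
    have : tapp (hmat g) V w != None by rewrite -UV (tappE (hmat_submonomial f) _ h) tmul_neq0 h.
    by case/tapp_neq0 => y /act_someP <- _; exact: mem_img.
  exists T => //; apply: (tapp_inj eg); rewrite -tappM -UV -TU -tappM.
  by congr (tapp _ T); exact: (congr1 (fun k : mtrs_hom P Z => hmat k) e).
move=> rho j [z|] zj; last first.
  by exists None => //; apply: (mtrs_flat_point (sheafP P)); exact: (cl_flat (gpP P)).
have [i ei] := on z; exists (Some i) => //.
have nz : act (g oc q) (Some i) != None by rewrite act_comp ei.
have sh : hshift q + hshift g = hshift f.
  by rewrite -(shift_comp nz) e (@shift_comp _ _ _ _ _ _ f p i) ?sp ?add0r // -e.
have fzj : act f (act p (Some i)) \in fil Z rho (j + pairing (hshift f) (gen S rho)).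
  by rewrite -ac ei -sh pairingD addrA; exact: act_fil.
have kq : ker f \subset img p.
  by apply/subsetP => x; rewrite mem_ker imp inE => /eqP ->; exact: img_point.
apply: (embedding_cl ep).
have : act p (Some i) \in cl (gp X) (ker f :|: (img p :&: fil X rho j)).
  rewrite (modular_law (gpP X) (mtrs_modular (sheafP X)) (ker_flat f) pim (mtrs_flat (sheafP X) _ _) kq).
  by rewrite inE mem_img /=; exact: projection_fil.
apply/subsetP; apply: (clS (gpP X)); apply/subsetP => x; rewrite in_setU => /orP[kx|].
  have /imsetP[y _ ey] := subsetP kq x kx; rewrite ey imset_f // in_setU mem_ker.
  by rewrite -(inj_eq gi) ac -ey -mem_ker kx.
rewrite in_setI => /andP[/imsetP[y _ ey] xj]; rewrite ey imset_f // in_setU.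
by apply/orP; right; apply: pfi; rewrite sp pairing0 addr0 -ey.
Qed.

Lemma strict_epi_pullback X Y Z P (f : mtrs_hom X Z) (g : mtrs_hom Y Z)
    (p : mtrs_hom P X) (q : mtrs_hom P Y) :
  projection f -> embedding g -> @is_pullback (MTRS S) X Y Z P f g p q -> projection q.
Proof.
move=> pf eg [e pu]; have [_ gim _ _] := eg.
have fG := flat_preim f gim.
have e0 := incl_embedding fG; have im0 := img_incl fG; set p0 := incl_hom fG in e0 im0.
have in0 x : act p0 x \in act f @^-1: img g by have := mem_img p0 x; rewrite im0.
have [|q0 eq0] := @embedding_lift _ _ _ _ _ _ g (f oc p0) eg.
  by move=> x; rewrite act_comp; have := in0 x; rewrite inE.
have pq0 : projection q0 by apply: (pullback_projection pf eg e0 im0 erefl).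
have [|phi ephi] := @embedding_lift _ _ _ _ _ _ p0 p e0.
  by move=> x; rewrite im0 inE -act_comp e act_comp mem_img.
have qphi : q0 oc phi = q by apply: (embedding_mono eg); rewrite ocA eq0 -ocA ephi.
have [psi [[epsi1 epsi2] _]] := pu _ p0 q0 (esym eq0).
rewrite -qphi; apply: projection_comp => //; apply: iso_projection; exists psi; split.
  have [t [_ ut]] := pu _ p q e.
  rewrite -(ut (psi oc phi)); last by rewrite !ocA epsi1 epsi2.
  by apply: ut; rewrite !oc1r.
by apply: (embedding_mono e0); rewrite ocA ephi epsi1 oc1r.
Qed.

(** Dual to the pullback: a lift along [p] of a vector over the image of [q] has
    its support in the image of [f], because that image contains the kernel of
    [p]; and the modular law again identifies the two filtrations. *)
Lemma pushout_embedding X Y Z P (f : mtrs_hom Z X) (g : mtrs_hom Z Y) (p : mtrs_hom X P)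
    (q : mtrs_hom Y P) : embedding f -> projection g -> projection p ->
  ker p = act f @: ker g -> hshift p = 0 -> q oc g = p oc f -> embedding q.
Proof.
move=> ef pg pp kp sp e; have [fin fim fli ffi] := ef; have [gon gli gfi] := pg.
have [pon pli pfi] := pp; have fi := embedding_inj ef.
have ac x : act q (act g x) = act p (act f x) by rewrite -!act_comp e.
have gonN y : exists x, act g x = y.
  by case: y => [y|]; [have [x] := gon y; exists (Some x)|exists None].
have kpim : ker p \subset img f by rewrite kp; apply: imsetS; exact: subsetT.
have inj i : act q (Some i) != None.
  have [x ex] := gon i; rewrite -ex ac -mem_ker kp mem_imset //.
  by rewrite mem_ker ex.
have imq : img q = act p @: img f.
  apply/setP => y; apply/imsetP/imsetP.
    move=> [x _ ->]; have [z <-] := gonN x; exists (act f z); [exact: mem_img|exact: ac].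
  by move=> [x /imsetP[z _ ->] ->]; exists (act g z).
split=> //.
- by rewrite imq; apply: projection_flat.
- move=> V vV; rewrite imq => sV; have [U vU UV] := pli V vV.
  have [|T vT TU] := fli U vU.
    move=> x Ux; case ex : (act p (Some x)) => [w|]; last first.
      by apply: (subsetP kpim); rewrite mem_ker ex.
    have h : hmat p (w, x) != None by apply/act_someP.
    have /imsetP[y yf ey] : Some w \in act p @: img f.
      by apply: sV; rewrite -UV (tappE (hmat_submonomial p) _ h) tmul_neq0 h.
    by rewrite (act_eq_some ex (esym ey)).
  exists (tapp (hmat g) T); first exact: (hmat_vector g).
  rewrite -tappM -UV -TU -tappM.
  by congr (tapp _ T); exact: (congr1 (fun k : mtrs_hom Z P => hmat k) e).
move=> rho j [y|] yj; last exact: fil_point.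
have [i ei] := gon y; rewrite -ei in yj *.
have nz : act (q oc g) (Some i) != None by rewrite act_comp ei.
have sh : hshift q = hshift f - hshift g.
  apply/eqP; rewrite eq_sym subr_eq addrC -(shift_comp nz) e.
  by rewrite (@shift_comp _ _ _ _ _ _ p f i) ?sp ?addr0 // -e.
set j' := j - pairing (hshift g) (gen S rho).
have ej : j + pairing (hshift q) (gen S rho) =
    j' + pairing (hshift f) (gen S rho) + pairing (hshift p) (gen S rho).
  have -> : pairing (hshift f) (gen S rho) = pairing (hshift q) (gen S rho) + pairing (hshift g) (gen S rho).
    by rewrite -pairingD sh subrK.
  by rewrite sp pairing0 addr0 /j' addrACA [- _ + _]addrC subrr addr0.
rewrite ac ej in yj; have := projection_fil pp yj => hf.
have fz : Some i \in cl (gp Z) (ker g :|: fil Z rho j').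
  apply: (embedding_cl ef).
  have : act f (Some i) \in cl (gp X) (ker p :|: (img f :&: fil X rho (j' + pairing (hshift f) (gen S rho)))).
    rewrite (modular_law (gpP X) (mtrs_modular (sheafP X)) (ker_flat p) fim (mtrs_flat (sheafP X) _ _) kpim).
    by rewrite inE mem_img.
  apply/subsetP; apply: (clS (gpP X)); rewrite kp imsetU setUS //.
  apply/subsetP => x; rewrite in_setI => /andP[/imsetP[z _ ->] zj].
  by apply: imset_f; apply: ffi.
have := act_cl g fz; apply/subsetP; apply: (cl_min (gpP Y)); first exact: (mtrs_flat (sheafP Y)).
apply/subsetP => w /imsetP[z]; rewrite in_setU => /orP[zk|zj] ->.
  by move: zk; rewrite mem_ker => /eqP ->; exact: fil_point.
by have := act_fil g zj; rewrite /j' subrK.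
Qed.

Lemma strict_mono_pushout X Y Z P (f : mtrs_hom Z X) (g : mtrs_hom Z Y)
    (p : mtrs_hom X P) (q : mtrs_hom Y P) :
  embedding f -> projection g -> @is_pushout (MTRS S) X Y Z P f g p q -> embedding q.
Proof.
move=> ef pg [e pu].
have fF := embedding_flat ef (ker_flat g).
have pp0 := proj_projection fF; have k0 := ker_proj fF; set p0 := proj_hom fF in pp0 k0.
have [|q0 eq0] := @projection_lift _ _ _ _ _ _ g (p0 oc f) pg.
  by apply/subsetP => x xk; rewrite mem_ker act_comp -mem_ker k0 imset_f.
have eq0' : embedding q0 by apply: (pushout_embedding ef pg pp0 k0 erefl).
have [|phi ephi] := @projection_lift _ _ _ _ _ _ p0 p pp0.
  rewrite k0; apply/subsetP => _ /imsetP[x xk ->]; rewrite mem_ker -act_comp e act_comp.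
  by move: xk; rewrite mem_ker => /eqP ->.
have qphi : phi oc q0 = q by apply: (projection_epi pg); rewrite -ocA eq0 ocA ephi.
have [psi [[epsi1 epsi2] _]] := pu _ p0 q0 (esym eq0).
rewrite -qphi; apply: embedding_comp => //; apply: iso_embedding; exists psi; split.
  by apply: (projection_epi pp0); rewrite -ocA ephi epsi1 oc1l.
have [t [_ ut]] := pu _ p q e.
rewrite -(ut (phi oc psi)); last by rewrite -!ocA epsi1 epsi2.
by apply: ut; rewrite !oc1l.
Qed.

Lemma mtrs_quasi_proto_abelian : quasi_proto_abelian (MTRS S).
Proof.
split.
- by exists (Mtrs zero_sheafP); apply/is_zeroP.
- split=> X Y f.
    exists (restr_ob (ker_flat f)), (incl_hom (ker_flat f)); exact: kernel_exists.
  exists (contr_ob (cl_flat (gpP Y) (img f))), (proj_hom (cl_flat (gpP Y) (img f))).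
  exact: cokernel_exists.
- by move=> X Y f K k; exact: zero_kernel_mono.
- move=> X Y Z P f g p q /strict_epiP pf /strict_monoP eg h.
  by apply/strict_epiP; exact: (strict_epi_pullback pf eg h).
- move=> X Y Z P f g p q /strict_monoP ef /strict_epiP pg h.
  by apply/strict_monoP; exact: (strict_mono_pushout ef pg h).
Qed.

(** ** Strict subobjects and flats *)

Lemma sub_leP M (N N' : @sub (MTRS S) M) : embedding (sarr N') ->
  sub_le N N' <-> img (sarr N) \subset img (sarr N').
Proof.
move=> eN'; split=> [[t et]|/subsetP h].
  by apply/subsetP => _ /imsetP[x _ ->]; rewrite -et act_comp mem_img.
have [|t et] := @embedding_lift _ _ _ _ _ _ (sarr N') (sarr N) eN'; last by exists t.
by move=> x; apply: h; exact: mem_img.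
Qed.

Lemma sub_eqP M (N N' : @sub (MTRS S) M) : embedding (sarr N) -> embedding (sarr N') ->
  sub_eq N N' <-> img (sarr N) = img (sarr N').
Proof.
move=> eN eN'; split=> [[/(sub_leP _ eN') h1 /(sub_leP _ eN) h2]|e].
  by apply/eqP; rewrite eqEsubset h1.
by split; apply/sub_leP => //; rewrite e.
Qed.

Lemma chain_stable (T : finType) (F : nat -> {set T}) : (forall i, F i \subset F i.+1) ->
  exists m, forall i, (m <= i)%N -> F i = F m.
Proof.
move=> inc.
have mono i j : (i <= j)%N -> F i \subset F j.
  elim: j => [|j IH]; first by rewrite leqn0 => /eqP ->.
  by rewrite leq_eqVlt => /orP[/eqP ->//|/IH h]; exact: subset_trans h (inc j).
have [m hm] : exists m, forall i, (#|F i| <= #|F m|)%N.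
  have ex : exists c, `[< exists m, #|F m| = c >] by exists #|F 0%N|; apply/asboolP; exists 0%N.
  have ub c : `[< exists m, #|F m| = c >] -> (c <= #|T|)%N.
    by move/asboolP => [m <-]; exact: max_card.
  case: (ex_maxnP ex ub) => c /asboolP[m <-] h; exists m => i.
  by apply: h; apply/asboolP; exists i.
by exists m => i mi; apply/esym/eqP; rewrite eqEcard mono //= hm.
Qed.

Lemma mtrs_noetherian M : @noetherian (MTRS S) M.
Proof.
move=> N sN le.
have eN i : embedding (sarr (N i)) by apply/strict_monoP.
have [|m hm] := @chain_stable _ (fun i => img (sarr (N i))).
  by move=> i; apply/(sub_leP _ (eN _)).
by exists m => i mi; apply/sub_eqP => //; exact: hm.
Qed.

Lemma mtrs_artinian M : @artinian (MTRS S) M.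
Proof.
move=> N sN le.
have eN i : embedding (sarr (N i)) by apply/strict_monoP.
have [|m hm] := @chain_stable _ (fun i => ~: img (sarr (N i))).
  by move=> i; rewrite setCS; apply/(sub_leP _ (eN _)).
by exists m => i mi; apply/sub_eqP => //; apply: setC_inj; exact: hm.
Qed.

End ProtoAbelian.

(** * Degrees *)

Section DegreeSum.

Definition degsum (f : int -> int) : int :=
  \sum_(j \in [set: int]%classic) j * (f j - f (j + 1)).

Definition step_profile (f : int -> int) (p : int) : Prop :=
  exists a b : int, (forall j, j <= a -> f j = p) /\ (forall j, b <= j -> f j = 0).

Lemma step_profileD f p g q : step_profile f p -> step_profile g q ->
  step_profile (fun j => f j + g j) (p + q).
Proof.
move=> [a [b [fa fb]]] [a' [b' [ga gb]]].
exists (Num.min a a'), (Num.max b b'); split=> j hj.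
  by rewrite fa ?ga //; lia.
by rewrite fb ?gb //; lia.
Qed.

Lemma abel_sum (f : int -> int) (a : int) n :
  \sum_(i < n) (a + i%:Z) * (f (a + i%:Z) - f (a + i%:Z + 1)) =
  \sum_(i < n) f (a + i%:Z) + (a - 1) * f a - (a + n%:Z - 1) * f (a + n%:Z).
Proof.
elim: n => [|n IH]; first by rewrite !big_ord0 addr0; lia.
rewrite !big_ord_recr /= IH.
have -> : a + n.+1%:Z = a + n%:Z + 1 by lia.
by move: (f _) (f _) (f _) (\sum_(_ < _) _) => x y z s; nia.
Qed.

(** Summation by parts turns the degree of a filtration into a sum of ranks, in
    which additivity, monotonicity and the effect of a shift are visible. *)
Lemma degsum_abel (f : int -> int) (a : int) n p :
  (forall j, j <= a -> f j = p) -> (forall j, a + n%:Z <= j -> f j = 0) ->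
  degsum f = \sum_(i < n) f (a + i%:Z) + (a - 1) * p.
Proof.
move=> fa fb; pose r := [seq a + i%:Z | i <- iota 0 n].
rewrite /degsum (@fsbigE _ _ _ _ _ r) //; last first.
- move=> j _ jr; have [ja|ja] := ltrP j a.
    by rewrite !fa ?subrr ?mulr0 //; lia.
  have [jn|jn] := lerP (a + n%:Z) j.
    by rewrite !fb ?subrr ?mulr0 //; lia.
  case/negP: jr; apply/mapP; exists `|j - a|%N; last by lia.
  by rewrite mem_iota; lia.
- by rewrite map_inj_uniq ?iota_uniq // => i j /addrI [].
transitivity (\sum_(i < n) (a + i%:Z) * (f (a + i%:Z) - f (a + i%:Z + 1))).
  rewrite big_map -{1}(subn0 n) -/(index_iota 0 n) big_mkord.
  by apply: eq_bigl => i; rewrite classical_sets.in_setT.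
rewrite abel_sum.
by rewrite (fa a) // (fb (a + n%:Z)) // mulr0 subr0.
Qed.

Lemma profile_window f p : step_profile f p -> exists a0 b0 : int, forall a n,
  a <= a0 -> b0 <= a + n%:Z ->
  degsum f = \sum_(i < n) f (a + i%:Z) + (a - 1) * p.
Proof.
move=> [a [b [fa fb]]]; exists a, b => a' n le1 le2.
apply: degsum_abel => j hj; [apply: fa|apply: fb]; lia.
Qed.

Lemma profile2_window f p g q : step_profile f p -> step_profile g q ->
  exists a n, degsum f = \sum_(i < n) f (a + i%:Z) + (a - 1) * p /\
              degsum g = \sum_(i < n) g (a + i%:Z) + (a - 1) * q.
Proof.
move=> /profile_window[a [b h]] /profile_window[a' [b' h']].
exists (Num.min a a'), `|Num.max b b' - Num.min a a'|%N.
by split; [apply: h|apply: h']; lia.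
Qed.

Lemma degsumD f p g q : step_profile f p -> step_profile g q ->
  degsum (fun j => f j + g j) = degsum f + degsum g.
Proof.
move=> hf hg; have hfg := step_profileD hf hg.
have [a [b h]] := profile_window hf; have [a' [b' h']] := profile_window hg.
have [a'' [b'' h'']] := profile_window hfg.
pose x := Num.min a (Num.min a' a''); pose y := Num.max b (Num.max b' b'').
pose n := `|y - x|%N.
rewrite (h x n) ?(h' x n) ?(h'' x n); try by rewrite /n /x /y; lia.
by rewrite big_split /= mulrDr addrACA.
Qed.

Lemma degsum_le f g p : step_profile f p -> step_profile g p ->
  (forall j, f j <= g j) -> degsum f <= degsum g.
Proof.
move=> hf hg le; have [a [n [-> ->]]] := profile2_window hf hg.
by rewrite lerD2r; apply: ler_sum => i _; exact: le.
Qed.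

Lemma degsum_shift f g p (u : int) : step_profile f p -> (forall j, g (j + u) = f j) ->
  degsum g = degsum f + u * p.
Proof.
move=> [a [b [fa fb]]] e; pose n := `|Num.max a b - a|%N.
rewrite (@degsum_abel f a n p) // ; last by move=> j hj; apply: fb; rewrite /n in hj; lia.
rewrite (@degsum_abel g (a + u) n p).
- have -> : \sum_(i < n) g (a + u + i%:Z) = \sum_(i < n) f (a + i%:Z).
    by apply: eq_bigr => i _; rewrite -e; congr g; lia.
  by move: (\sum_(_ < _) _) => s; nia.
- by move=> j hj; rewrite -(subrK u j) e; apply: fa; lia.
by move=> j hj; rewrite -(subrK u j) e; apply: fb; rewrite /n in hj; lia.
Qed.

End DegreeSum.

Section Slopes.
Context {R : realType} {d : nat} {S : fan R d}.
Variable h : ray S -> int.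

Section SheafDegree.
Variable E : tsheaf S.
Hypothesis EP : is_mtrs E.
Local Notation rk := (mrank (gp E)).
Local Notation gpE := (mtrs_gpP EP).
Implicit Types F G H : {set option (gs E)}.

(** The degree of the restriction to [F]. *)
Definition fdeg F : int :=
  \sum_rho h rho * degsum (fun j => (rk (F :&: fil E rho j))%:Z).

Lemma sdegE : sdeg h E = \sum_rho h rho * degsum (fun j => (rk (fil E rho j))%:Z).
Proof. by []. Qed.

Lemma fil_profile F rho : flat (gp E) F ->
  step_profile (fun j => (rk (F :&: fil E rho j))%:Z) (rk F)%:Z.
Proof.
move=> fF; have [b hb] := mtrs_bot EP rho; have [a ha] := mtrs_top EP rho.
exists a, b; split=> j hj; first by rewrite ha // setIT.
rewrite hb // (_ : F :&: _ = [set None]) ?(rk_point EP) //.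
by apply/setIidPr; rewrite sub1set (mtrs_flat_point EP fF).
Qed.

Lemma sdeg_fdegT : sdeg h E = fdeg setT.
Proof.
rewrite sdegE /fdeg; apply: eq_bigr => rho _; congr (_ * degsum _).
by apply/funext => j; rewrite setTI.
Qed.

Section Restr.
Variable F : {set option (gs E)}.
Hypothesis fF : flat (gp E) F.
Local Notation emb := (omap val : option (gs (restr E F)) -> option (gs E)).

Lemma restr_fdeg (A : {set option (gs (restr E F))}) :
  \sum_rho h rho * degsum (fun j => (mrank (gp (restr E F)) (A :&: fil (restr E F) rho j))%:Z)
  = fdeg (emb @: A).
Proof.
apply: eq_bigr => rho _; congr (_ * degsum _); apply/funext => j.
have emb_inj := @omap_val_inj _ (fun x => Some x \in F).
rewrite (rk_restr EP fF); congr (Posz (mrank _ _)).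
rewrite imsetI; last exact: in2W.
rewrite /restr /= /fmeet (remb_preimK EP fF); last first.
  by rewrite in_setI !(mtrs_flat_point EP) //; exact: (mtrs_flat EP).
rewrite (setIA F F) setIid setIA; congr (_ :&: _).
by apply/setIidPl/subsetP => x /imsetP[y _ ->]; exact: (remb_in EP fF).
Qed.

Lemma srank_restr : srank (restr E F) = rk F.
Proof. by rewrite /srank (rk_restr EP fF) (remb_img EP fF). Qed.

Lemma sdeg_restr : sdeg h (restr E F) = fdeg F.
Proof.
rewrite -[in RHS](remb_img EP fF) -restr_fdeg /sdeg; apply: eq_bigr => rho _.
by congr (_ * degsum _); apply/funext => j; rewrite setTI.
Qed.

End Restr.

Section Contr.
Variable F : {set option (gs E)}.
Hypothesis fF : flat (gp E) F.
Local Notation emb := (omap val : option (gs (contr E F)) -> option (gs E)).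

Lemma srank_contr : (srank (contr E F) + rk F)%N = srank E.
Proof. by rewrite /srank (rk_contr EP fF) (cemb_img EP fF). Qed.

(** In a modular lattice $\mathrm{rk}(F\vee(H\wedge E_j))-\mathrm{rk}(F)
    =\mathrm{rk}(H\wedge E_j)-\mathrm{rk}(F\wedge E_j)$, so degrees are
    additive. *)
Lemma contr_fdeg (A : {set option (gs (contr E F))}) : flat (gp (contr E F)) A ->
  \sum_rho h rho * degsum (fun j => (mrank (gp (contr E F)) (A :&: fil (contr E F) rho j))%:Z)
  + fdeg F = fdeg (emb @: A :|: F).
Proof.
move=> fA; have emb_inj := @omap_val_inj _ (fun x => Some x \notin F).
have CP := contr_mtrs EP fF.
have NA := mtrs_flat_point CP fA.
set H := emb @: A :|: F.
have fH : flat (gp E) H by rewrite -(flat_contr EP fF).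
have FH : F \subset H := subsetUr _ _.
rewrite -big_split /=; apply: eq_bigr => rho _; rewrite -mulrDr; congr (_ * _).
pose f1 j : int := (mrank (gp (contr E F)) (A :&: fil (contr E F) rho j))%:Z.
pose f2 j : int := (rk (F :&: fil E rho j))%:Z.
pose f3 j : int := (rk (H :&: fil E rho j))%:Z.
have key j : f1 j + f2 j = f3 j.
  have fj := mtrs_flat EP rho j.
  have e1 := rk_contr EP fF (A :&: fil (contr E F) rho j).
  have e2 := modular_rk3 gpE (mtrs_modular EP) fF fH fj FH.
  have e3 : emb @: (A :&: fil (contr E F) rho j) :|: F = cl (gp E) (F :|: (H :&: fil E rho j)).
    rewrite (modular_law gpE (mtrs_modular EP) fF fH fj FH) imsetI; last exact: in2W.
    rewrite setUIl; congr (_ :&: _); rewrite /contr /= (cemb_preimK EP fF) //.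
    exact: subset_trans (subsetUl _ _) (sub_cl gpE _).
  rewrite e3 (rk_cl gpE) in e1; rewrite /f1 /f2 /f3 -!PoszD; congr Posz.
  by apply/eqP; rewrite -(eqn_add2r (rk F)) addnAC e1 e2 addnC.
have p2 : step_profile f2 (rk F)%:Z := fil_profile rho fF.
have p3 : step_profile f3 (rk H)%:Z := fil_profile rho fH.
have p1 : step_profile f1 ((rk H)%:Z - (rk F)%:Z).
  have [a [b [ha hb]]] := p2; have [a' [b' [ha' hb']]] := p3.
  exists (Num.min a a'), (Num.max b b'); split=> j hj.
    by rewrite -(addrK (f2 j) (f1 j)) key ha' ?ha //; lia.
  by rewrite -(addrK (f2 j) (f1 j)) key hb' ?hb //; lia.
rewrite -(degsumD p1 p2); congr degsum; apply/funext => j; exact: key.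
Qed.

Lemma sdeg_contr : sdeg h (contr E F) + fdeg F = sdeg h E.
Proof.
have CP := contr_mtrs EP fF.
rewrite [RHS]sdeg_fdegT -[in RHS](cemb_img EP fF) -contr_fdeg; last exact: (flatT (mtrs_gpP CP)).
congr (_ + _); rewrite /sdeg; apply: eq_bigr => rho _.
by congr (_ * degsum _); apply/funext => j; rewrite setTI.
Qed.

End Contr.

(** For each $j$ the rank of $(F\vee G)\wedge E_j$ is at least that of
    $(F\wedge E_j)\vee(G\wedge E_j)$, which modularity computes. The sums over
    $j$ compare because both sides have the same rank for $j\ll0$. *)
Lemma fdeg_supermod F G : (forall rho, 0 <= h rho) -> flat (gp E) F -> flat (gp E) G ->
  fdeg F + fdeg G <= fdeg (fjoin (gp E) F G) + fdeg (F :&: G).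
Proof.
move=> h0 fF fG; set J := fjoin _ F G.
have fJ : flat (gp E) J := cl_flat gpE _.
have fI : flat (gp E) (F :&: G) := flatI gpE fF fG.
rewrite /fdeg -!big_split /=; apply: ler_sum => rho _.
have pF := fil_profile rho fF; have pG := fil_profile rho fG.
have pJ := fil_profile rho fJ; have pI := fil_profile rho fI.
rewrite -!mulrDr -(degsumD pF pG) -(degsumD pJ pI); apply: ler_wpM2l => //.
have eqp : ((rk F)%:Z + (rk G)%:Z = (rk J)%:Z + (rk (F :&: G))%:Z).
  by rewrite -!PoszD (mtrs_modular EP fF fG).
apply: (degsum_le (step_profileD pF pG)); first by rewrite eqp; exact: step_profileD.
move=> j; have fj := mtrs_flat EP rho j; rewrite -!PoszD lez_nat.
have := modular_rk gpE (mtrs_modular EP) (flatI gpE fF fj) (flatI gpE fG fj).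
rewrite setIACA setIid => ->; rewrite leq_add2r; apply: (rkS gpE).
rewrite -setIUl; apply: setSI; exact: (sub_cl gpE).
Qed.

End SheafDegree.

(** ** Slopes of subquotients *)

Definition fslope (E : tsheaf S) (F G : {set option (gs E)}) : R :=
  (fdeg G - fdeg F)%:~R / (mrank (gp E) G - mrank (gp E) F)%:R.

Section Subquotient.
Variable E : tsheaf S.
Hypothesis EP : is_mtrs E.
Local Notation rk := (mrank (gp E)).
Local Notation gpE := (mtrs_gpP EP).
Variables F G : {set option (gs E)}.
Hypotheses (fF : flat (gp E) F) (fG : flat (gp E) G) (FG : F \subset G).
Local Notation embG := (omap val : option (gs (restr E G)) -> option (gs E)).
Local Notation F' := (embG @^-1: F).
Local Notation emb' := (omap val : option (gs (subquo E F G)) -> option (gs (restr E G))).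

Let RP := restr_mtrs EP fG.

Lemma subquo_flat : flat (gp (restr E G)) F'. Proof. exact: flat_restr_preim. Qed.

Lemma subquo_mtrs : is_mtrs (subquo E F G).
Proof. exact: (contr_mtrs RP subquo_flat). Qed.

Lemma preimK_sub (H : {set option (gs E)}) : flat (gp E) H -> H \subset G -> embG @: (embG @^-1: H) = H.
Proof.
move=> fH HG; rewrite (remb_preimK EP fG) ?(mtrs_flat_point EP) //.
exact/setIidPr.
Qed.

Lemma restr_fdegE (A : {set option (gs (restr E G))}) : fdeg A = fdeg (embG @: A).
Proof. exact: (restr_fdeg EP fG). Qed.

Lemma srank_subquo : srank (subquo E F G) = (rk G - rk F)%N.
Proof.
have := srank_contr RP subquo_flat.
by rewrite (rk_restr EP fG) (preimK_sub fF FG) (srank_restr EP fG) => <-; rewrite addnK.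
Qed.

Lemma sdeg_subquo : sdeg h (subquo E F G) = fdeg G - fdeg F.
Proof.
have := sdeg_contr RP subquo_flat.
by rewrite restr_fdegE (preimK_sub fF FG) (sdeg_restr EP fG) => <-; rewrite addrK.
Qed.

Lemma sslope_subquo : sslope h (subquo E F G) = fslope F G.
Proof. by rewrite /sslope srank_subquo sdeg_subquo. Qed.

(** The bijection from the flats of the subquotient to the flats between [F]
    and [G]. *)
Definition subquo_lift (A : {set option (gs (subquo E F G))}) : {set option (gs E)} :=
  embG @: (emb' @: A :|: F').

Lemma subquo_liftP A : flat (gp (subquo E F G)) A ->
  [/\ flat (gp E) (subquo_lift A), F \subset subquo_lift A & subquo_lift A \subset G].
Proof.
move=> fA; have NA := mtrs_flat_point subquo_mtrs fA; split.
- by rewrite -(flat_restr EP fG) -(flat_contr RP subquo_flat).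
- by rewrite -(preimK_sub fF FG); apply: imsetS; exact: subsetUr.
by apply/subsetP => x /imsetP[y _ ->]; exact: (remb_in EP fG).
Qed.

Lemma subquo_lift_onto H : flat (gp E) H -> F \subset H -> H \subset G ->
  exists2 A, flat (gp (subquo E F G)) A & subquo_lift A = H.
Proof.
move=> fH FH HG; exists (emb' @^-1: (embG @^-1: H)).
  apply: (flat_contr_preim RP subquo_flat); first exact: flat_restr_preim.
  exact: preimsetS.
rewrite /subquo_lift (cemb_preimK RP subquo_flat); last exact: preimsetS.
exact: preimK_sub.
Qed.

Lemma srank_subquo_restr A : flat (gp (subquo E F G)) A ->
  srank (restr (subquo E F G) A) = (rk (subquo_lift A) - rk F)%N.
Proof.
move=> fA; rewrite (srank_restr subquo_mtrs fA).
have := rk_contr RP subquo_flat A.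
by rewrite !(rk_restr EP fG) (preimK_sub fF FG) => <-; rewrite addnK.
Qed.

Lemma sslope_subquo_restr A : flat (gp (subquo E F G)) A ->
  sslope h (restr (subquo E F G) A) = fslope F (subquo_lift A).
Proof.
move=> fA; rewrite /sslope srank_subquo_restr // (sdeg_restr subquo_mtrs fA) /fslope.
have := contr_fdeg RP subquo_flat fA; rewrite -/(fdeg A).
by rewrite !restr_fdegE (preimK_sub fF FG) => <-; rewrite addrK.
Qed.

Lemma km_semistable_subquo : km_semistable h (subquo E F G) <->
  (rk F < rk G)%N /\ forall H, flat (gp E) H -> F \subset H -> H \subset G ->
    (rk F < rk H)%N -> fslope F H <= fslope F G.
Proof.
rewrite /km_semistable srank_subquo sslope_subquo; split=> -[rFG hs]; split.
- by lia.
- move=> H fH FH HG rH; have [A fA eA] := subquo_lift_onto fH FH HG.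
  by rewrite -eA -sslope_subquo_restr //; apply: hs => //; rewrite srank_subquo_restr // eA; lia.
- by lia.
move=> A fA; rewrite srank_subquo_restr // sslope_subquo_restr // => r0.
by have [fH FH HG] := subquo_liftP fA; apply: hs => //; lia.
Qed.

End Subquotient.

(** ** Invariance under isomorphism *)

(** Independence is the absence of nonzero vectors in a set, and vectors in the
    image of an embedding lift. *)
Lemma embedding_indep (K X : mtrs_ob S) (f : mtrs_hom K X) (I : {set gs K}) (J : {set gs X}) :
  embedding f -> act f @: (Some @: I) = Some @: J ->
  mrank (gp K) (Some @: I) = #|I| <-> mrank (gp X) (Some @: J) = #|J|.
Proof.
move=> ef e; have [fin _ fli _] := ef; have fi := embedding_inj ef.
have hf := hmat_submonomial f.
have JI i j : hmat f (j, i) != None -> (j \in J) = (i \in I).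
  move=> /act_someP eij; rewrite -(mem_imset J j (@Some_inj _)) -e -eij mem_imset //.
  exact: (mem_imset I i (@Some_inj _)).
rewrite (indep_evecP (sheafP K)) (indep_evecP (sheafP X)); split=> H V vV sV.
  have [|U vU UV] := fli V vV.
    move=> j /sV; rewrite -(mem_imset J j (@Some_inj _)) -e; apply/subsetP.
    by apply: imsetS; exact: subsetT.
  have U0 : forall i, U i = None.
    apply: H => // i Ui; case ej : (act f (Some i)) (fin i) => [j|] // _.
    move/act_someP: ej => h'; rewrite -(JI _ _ h'); apply: sV.
    by rewrite -UV (tappE hf _ h') tmul_neq0 h'.
  by move=> j; apply/eqP; apply: contraT; rewrite -UV => /tapp_neq0[i _]; rewrite U0.
have V0 : forall j, tapp (hmat f) V j = None.
  apply: (H _ (hmat_vector f vV)) => j' /tapp_neq0[i' h'' /sV].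
  by rewrite (JI _ _ h'').
move=> i; apply/eqP; apply: contraT => Vi.
case ej : (act f (Some i)) (fin i) => [j|] // _; move/act_someP: ej => h'.
have := V0 j; rewrite (tappE hf _ h') => /eqP.
by rewrite -[_ == _]negbK tmul_neq0 h' Vi.
Qed.

Lemma indep_some (E : mtrs_ob S) (I : {set option (gs E)}) : mrank (gp E) I = #|I| ->
  exists2 J : {set gs E}, I = Some @: J & #|J| = #|I|.
Proof.
move=> rI; have gpE := mtrs_gpP (sheafP E).
have NI : None \notin I.
  apply/negP => NI; have := rkU_card gpE [set None] (I :\ None).
  by rewrite setD1K // rI (rk_point (sheafP E)) (cardsD1 None I) NI add0n add1n ltnn.
have e : I = Some @: (Some @^-1: I).
  apply/setP => x; apply/idP/imsetP => [xI|[y]]; last by rewrite inE => yI ->.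
  by case: x xI => [x|] xI; [exists x; rewrite ?inE|rewrite xI in NI].
exists (Some @^-1: I) => //.
by rewrite {2}e card_imset //; exact: Some_inj.
Qed.

Lemma rk_embedding (K X : mtrs_ob S) (f : mtrs_hom K X) (A : {set option (gs K)}) :
  embedding f -> mrank (gp X) (act f @: A) = mrank (gp K) A.
Proof.
move=> ef; have fi := embedding_inj ef; have [fin _ _ _] := ef.
have gpK := mtrs_gpP (sheafP K); have gpX := mtrs_gpP (sheafP X).
apply/eqP; rewrite eqn_leq; apply/andP; split.
  have [I0 [sI <- rI]] := rk_indep gpX (act f @: A).
  have [J eJ <-] := indep_some rI.
  pose I := [set i | act f (Some i) \in Some @: J].
  have e : act f @: (Some @: I) = Some @: J.
    apply/setP => y; apply/imsetP/idP => [[_ /imsetP[i iI ->] ->]|yJ]; first by rewrite inE in iI.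
    have /imsetP[x xA ex] : y \in act f @: A by apply: (subsetP sI); rewrite eJ.
    case: x xA ex => [x|] _ ex; last by move: yJ; rewrite ex => /imsetP[].
    by exists (Some x) => //; rewrite imset_f // inE -ex.
  have cI : #|I| = #|J|.
    by rewrite -(card_imset I (@Some_inj _)) -(card_imset _ fi) e card_imset //; exact: Some_inj.
  rewrite -cI; have rJ : mrank (gp X) (Some @: J) = #|J|.
    by rewrite -eJ rI eJ card_imset //; exact: Some_inj.
  rewrite -((embedding_indep ef e).2 rJ); apply: (rkS gpK).
  apply/subsetP => _ /imsetP[i iI ->]; rewrite -(mem_imset A _ fi).
  by apply: (subsetP sI); rewrite eJ -e !imset_f.
have [I0 [sI <- rI]] := rk_indep gpK A.
have [I eI cI] := indep_some rI.
pose J := [set j | Some j \in act f @: (Some @: I)].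
have e : act f @: (Some @: I) = Some @: J.
  apply/setP => y; apply/idP/imsetP => [yI|[j]]; last by rewrite inE => jI ->.
  case: y yI => [y|] yI; first by exists y; rewrite // inE.
  by case/imsetP: yI => _ /imsetP[i _ ->] ei; move: (fin i); rewrite -ei.
have cJ : #|J| = #|I|.
  by rewrite -(card_imset J (@Some_inj _)) -e card_imset // card_imset //; exact: Some_inj.
have rI' : mrank (gp K) (Some @: I) = #|I| by rewrite -eI rI cI.
rewrite -cI -cJ -((embedding_indep ef e).1 rI'); apply: (rkS gpX).
by rewrite -e -eI; exact: imsetS.
Qed.

(** An isomorphism may shift the filtrations by some $u\in\Lambda$; the degree
    then changes by $\mathrm{rk}\cdot\sum_\rho h_\rho\langle u,v_\rho\rangle$,
    which vanishes for a polarization. *)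
Lemma iso_sslope (M N : mtrs_ob S) (s : mtrs_hom M N) :
  (forall u : 'cV[int]_d, \sum_rho h rho * pairing u (gen S rho) = 0) ->
  @is_iso (MTRS S) M N s -> sslope h M = sslope h N.
Proof.
move=> hpol iso; have es := iso_embedding iso; have ps := iso_projection iso.
have [_ _ _ fi] := es; have [on _ _] := ps; have si := embedding_inj es.
have onN y : exists x, act s x = y.
  by case: y => [y|]; [have [x] := on y; exists (Some x)|exists None].
have imT : act s @: setT = setT.
  by apply/setP => y; rewrite inE; have [x <-] := onN y; rewrite imset_f.
have filE rho j : fil N rho (j + pairing (hshift s) (gen S rho)) = act s @: fil M rho j.
  apply/setP => y; have [x <-] := onN y; rewrite mem_imset //; apply/idP/idP; first exact: fi.
  exact: act_fil.
have er : srank N = srank M by rewrite /srank -imT rk_embedding.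
have ed : sdeg h N = sdeg h M.
  rewrite !sdegE.
  have shift rho : degsum (fun j => (mrank (gp N) (fil N rho j))%:Z) =
      degsum (fun j => (mrank (gp M) (fil M rho j))%:Z) + pairing (hshift s) (gen S rho) * (srank M)%:Z.
    apply: degsum_shift.
      have := fil_profile (sheafP M) rho (flatT (mtrs_gpP (sheafP M))).
      by congr step_profile; apply/funext => j; rewrite setTI.
    by move=> j; rewrite filE rk_embedding.
  under eq_bigr do rewrite shift mulrDr mulrA.
  by rewrite big_split /= -mulr_suml hpol mul0r addr0.
by rewrite /sslope er ed.
Qed.

End Slopes.

(** * Slopes in the category *)

Section CategorySlope.
Context {R : realType} {d : nat} {S : fan R d}.
Implicit Types M N P K W X Y Z Q : mtrs_ob S.
Variable h : ray S -> int.
Hypothesis hpol : forall u : 'cV[int]_d, \sum_rho h rho * pairing u (gen S rho) = 0.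
Hypothesis h0 : forall rho, 0 <= h rho.

Local Notation "g 'oc' f" := (@compose (MTRS S) _ _ _ g f) (at level 50, left associativity).
Local Notation gpP M := (mtrs_gpP (sheafP M)).
Local Notation ide M := (@idm (MTRS S) M).
Local Notation mu := (@mtrs_slope R d S h).

Lemma mtrs_iso_invariant : @iso_invariant (MTRS S) R mu.
Proof. by move=> X Y f _ fi; exact: (iso_sslope hpol fi). Qed.

Lemma is_zero_srank X : @is_zero (MTRS S) X <-> srank X = 0%N.
Proof. by rewrite is_zeroP; split=> /(srank0P (sheafP X)). Qed.

Section SubquotientObject.
Variables (M : mtrs_ob S) (F G : {set option (gs M)}).
Hypotheses (fF : flat (gp M) F) (fG : flat (gp M) G) (FG : F \subset G).

Definition subquo_ob : mtrs_ob S := contr_ob (M := restr_ob fG) (subquo_flat (sheafP M) fF fG).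

Definition subquo_proj : mtrs_hom (restr_ob fG) subquo_ob :=
  proj_hom (M := restr_ob fG) (subquo_flat (sheafP M) fF fG).

Lemma subquo_projection : projection subquo_proj.
Proof. exact: proj_projection. Qed.

Lemma mem_ker_subquo x : (x \in ker subquo_proj) = (act (incl_hom fG) x \in F).
Proof. by rewrite ker_proj act_incl inE. Qed.

Lemma quotient_incl :
  @is_quotient (MTRS S) M (Defs.Sub (incl_hom fF : @Defs.hom (MTRS S) _ M))
    (Defs.Sub (incl_hom fG : @Defs.hom (MTRS S) _ M)) subquo_ob.
Proof.
have eF := incl_embedding fF; have eG := incl_embedding fG.
have [|t et] := @embedding_lift _ _ _ _ _ _ (incl_hom fG) (incl_hom fF) eG.
  by move=> x; rewrite img_incl; apply: (subsetP FG); have := mem_img (incl_hom fF) x; rewrite img_incl.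
exists t, subquo_proj; split=> //; apply: projection_cokernel; first exact: subquo_projection.
have e : ker subquo_proj = img t.
  apply/setP => x; rewrite mem_ker_subquo -{1}(img_incl fF); apply/imsetP/imsetP => -[y _ ey].
    by exists y => //; apply: (embedding_inj eG); rewrite ey -et act_comp.
  by exists y; rewrite // ey -et act_comp.
by rewrite -e (cl_id (gpP _)) //; exact: ker_flat.
Qed.

End SubquotientObject.

Lemma quotient_iso M (N N' : @sub (MTRS S) M) Q
    (fF : flat (gp M) (img (sarr N))) (fG : flat (gp M) (img (sarr N'))) :
  embedding (sarr N) -> embedding (sarr N') -> @is_quotient (MTRS S) M N N' Q ->
  exists s : mtrs_hom Q (subquo_ob fF fG), @is_iso (MTRS S) Q (subquo_ob fF fG) s.
Proof.
move=> eN eN' [t [q [et cq]]]; have [pq kq] := cokernel_projection cq.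
have eG := incl_embedding fG; have iG := img_incl fG.
have [s iso es] := embedding_unique eN' eG (esym iG).
have ps := projection_comp (iso_projection iso) (subquo_projection fF fG).
have [|phi iphi _] := projection_unique pq ps; last by exists phi.
have e : ker (subquo_proj fF fG oc s) = img t.
  apply/setP => x; rewrite mem_ker act_comp -mem_ker mem_ker_subquo -act_comp es.
  apply/imsetP/imsetP => -[y _ ey].
    by exists y => //; apply: (embedding_inj eN'); rewrite ey -et act_comp.
  by exists y; rewrite // ey -et act_comp.
rewrite kq e (cl_id (gpP _)) // -e; exact: ker_flat.
Qed.

Lemma quotient_slope M (N N' : @sub (MTRS S) M) Q :
  embedding (sarr N) -> embedding (sarr N') -> img (sarr N) \subset img (sarr N') ->
  @is_quotient (MTRS S) M N N' Q -> mu Q = fslope h (img (sarr N)) (img (sarr N')).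
Proof.
move=> eN eN' le hQ; have [_ fF _ _] := eN; have [_ fG _ _] := eN'.
have [s iso] := quotient_iso fF fG eN eN' hQ.
by rewrite /mtrs_slope (iso_sslope hpol iso) (sslope_subquo h (sheafP M) fF fG le).
Qed.

(** ** The strong slope inequality *)

(** The restriction to the meet of the two flats is a pullback, and pullbacks
    are unique. *)
Lemma intersection_img M (N1 N2 I : @sub (MTRS S) M) :
  embedding (sarr N1) -> embedding (sarr N2) -> @is_intersection (MTRS S) M N1 N2 I ->
  embedding (sarr I) /\ img (sarr I) = img (sarr N1) :&: img (sarr N2).
Proof.
move=> e1 e2 [p1 [p2 [[ep pu] eI]]].
have [_ f1 _ _] := e1; have [_ f2 _ _] := e2.
have fI := flatI (gpP M) f1 f2.
have e0 := incl_embedding fI; have im0 := img_incl fI; set i0 := incl_hom fI in e0 im0.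
have in0 x : act i0 x \in img (sarr N1) :&: img (sarr N2) by have := mem_img i0 x; rewrite im0.
have [|a ea] := @embedding_lift _ _ _ _ _ _ (sarr N1) i0 e1.
  by move=> x; have := in0 x; rewrite in_setI => /andP[].
have [|b eb] := @embedding_lift _ _ _ _ _ _ (sarr N2) i0 e2.
  by move=> x; have := in0 x; rewrite in_setI => /andP[].
have [|t [[et1 et2] _]] := pu _ a b; first by rewrite ea eb.
have [|s es] := @embedding_lift _ _ _ _ _ _ i0 (sarr I) e0.
  move=> x; rewrite im0 in_setI; apply/andP; split; first by rewrite eI act_comp mem_img.
  by rewrite eI ep act_comp mem_img.
have It : sarr I oc t = i0 by rewrite eI -ocA et1 ea.
have st : s oc t = ide _ by apply: (embedding_mono e0); rewrite ocA es It oc1r.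
have ts : t oc s = ide _.
  have [t0 [_ ut]] := pu _ p1 p2 ep.
  rewrite -(ut (t oc s)); first by apply: ut; rewrite !oc1r.
  rewrite !ocA et1 et2; split.
    by apply: (embedding_mono e1); rewrite ocA ea es eI.
  by apply: (embedding_mono e2); rewrite ocA eb es eI ep.
have es' : embedding s by apply: iso_embedding; exists t.
split; first by rewrite -es; exact: embedding_comp.
apply/eqP; rewrite -im0 eqEsubset; apply/andP; split.
  by apply/subsetP => _ /imsetP[x _ ->]; rewrite -es act_comp mem_img.
by apply/subsetP => _ /imsetP[x _ ->]; rewrite -It act_comp mem_img.
Qed.

(** The contraction by the join of the two flats factors through the pushout,
    so the kernel of the map to the pushout is no larger than the join. *)
Lemma sum_img M (N1 N2 J : @sub (MTRS S) M) :
  embedding (sarr N1) -> embedding (sarr N2) -> @is_sum (MTRS S) M N1 N2 J ->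
  embedding (sarr J) /\ img (sarr J) = fjoin (gp M) (img (sarr N1)) (img (sarr N2)).
Proof.
move=> e1 e2 [Q1 [Q2 [M' [q1 [q2 [r1 [r2 [c1 c2 [er pu] ck]]]]]]]].
have [_ f1 _ _] := e1; have [_ f2 _ _] := e2.
have [eJ imJ] := kernel_embedding ck; split=> //.
have [p1 k1] := cokernel_projection c1; have [p2 k2] := cokernel_projection c2.
rewrite (cl_id (gpP M)) // in k1; rewrite (cl_id (gpP M)) // in k2.
have fj : flat (gp M) (fjoin (gp M) (img (sarr N1)) (img (sarr N2))) := cl_flat (gpP M) _.
have s1 : img (sarr N1) \subset fjoin (gp M) (img (sarr N1)) (img (sarr N2)).
  exact: subset_trans (subsetUl _ _) (sub_cl (gpP M) _).
have s2 : img (sarr N2) \subset fjoin (gp M) (img (sarr N1)) (img (sarr N2)).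
  exact: subset_trans (subsetUr _ _) (sub_cl (gpP M) _).
rewrite imJ; apply/eqP; rewrite eqEsubset; apply/andP; split; last first.
  apply: (cl_min (gpP M)); first exact: ker_flat.
  rewrite subUset -k1 -k2; apply/andP; split; apply/subsetP => x; rewrite !mem_ker.
    by rewrite act_comp => /eqP ->.
  by rewrite er act_comp => /eqP ->.
have kp := ker_proj fj; set p := proj_hom fj in kp.
have [|a1 ea1] := @projection_lift _ _ _ _ _ _ q1 p p1; first by rewrite k1 kp.
have [|a2 ea2] := @projection_lift _ _ _ _ _ _ q2 p p2; first by rewrite k2 kp.
have [|t [[et _] _]] := pu _ a1 a2; first by rewrite ea1 ea2.
apply/subsetP => x; rewrite mem_ker => /eqP hx.
by rewrite -kp mem_ker -ea1 -et -ocA act_comp hx.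
Qed.

(** With $F_1,F_2$ the flats of $N_1,N_2$, modularity gives both quotients the
    same rank and supermodularity of the degree compares the numerators. *)
Lemma mtrs_strong_slope : @strong_slope_inequality (MTRS S) R mu.
Proof.
move=> M N1 N2 I J Q1 Q2 /strict_monoP e1 /strict_monoP e2 hI hJ hQ1 hQ2 _ _.
have [eI imI] := intersection_img e1 e2 hI; have [eJ imJ] := sum_img e1 e2 hJ.
rewrite (quotient_slope eI e1 _ hQ1) ?imI ?subsetIl //.
have s2 : img (sarr N2) \subset fjoin (gp M) (img (sarr N1)) (img (sarr N2)).
  exact: subset_trans (subsetUr _ _) (sub_cl (gpP M) _).
rewrite (quotient_slope e2 eJ _ hQ2) ?imJ // /fslope.
have [_ f1 _ _] := e1; have [_ f2 _ _] := e2.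
have := mtrs_modular (sheafP M) f1 f2; rewrite /fmeet => em.
have -> : (mrank (gp M) (img (sarr N1)) - mrank (gp M) (img (sarr N1) :&: img (sarr N2)) =
   mrank (gp M) (fjoin (gp M) (img (sarr N1)) (img (sarr N2))) - mrank (gp M) (img (sarr N2)))%N.
  have eq4 (a b x y : nat) : (a + b = x + y -> y <= a -> b <= x -> a - y = x - b)%N by clear; lia.
  by apply: eq4 em _ _; apply: (rkS (gpP M)) => //; exact: subsetIl.
apply: ler_wpM2r; first by rewrite invr_ge0 ler0n.
have le4 (a b x y : int) : a + b <= x + y -> a - y <= x - b by clear; lia.
by rewrite ler_int; apply: le4; exact: (fdeg_supermod (sheafP M) h0 f1 f2).
Qed.

(** ** Semistability *)

Lemma semistable_km X : @semistable (MTRS S) R mu X <-> km_semistable h X.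
Proof.
rewrite /semistable is_zero_srank; split=> -[nz hs]; split=> //.
  move=> F fF rF; have := hs (Defs.Sub (incl_hom fF : @Defs.hom (MTRS S) _ X)); apply.
    by apply/strict_monoP; exact: incl_embedding.
  by rewrite is_zero_srank.
move=> N /strict_monoP eN nzN; have [_ fF _ _] := eN.
have [s iso _] := embedding_unique eN (incl_embedding fF) (esym (img_incl fF)).
rewrite /mtrs_slope (iso_sslope hpol iso); apply: hs => //.
move=> r0; apply: nzN; apply/is_zero_srank.
apply/eqP; rewrite -leqn0 -r0 /srank -(rk_embedding _ (iso_embedding iso)).
by apply: (rkS (gpP (restr_ob fF))); exact: subsetT.
Qed.

Lemma semistable_iso X Y (s : mtrs_hom X Y) : @is_iso (MTRS S) X Y s ->
  @semistable (MTRS S) R mu X -> @semistable (MTRS S) R mu Y.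
Proof.
move=> iso [nz hs]; have [t [ts st]] := iso.
have isot : @is_iso (MTRS S) Y X t by exists s.
split.
  move=> /is_zeroP Y0; apply: nz; apply/is_zeroP => x.
  have [inj _ _ _] := iso_embedding iso.
  by case e : (act s (Some x)) (inj x) => [y|] //; case: (Y0 y).
move=> N /strict_monoP eN nzN; rewrite -[mu Y]/(sslope h Y) -(iso_sslope hpol iso).
apply: (hs (Defs.Sub (t oc sarr N))) => //.
by apply/strict_monoP; apply: embedding_comp => //; exact: iso_embedding.
Qed.

Lemma quotient_semistable M (N N' : @sub (MTRS S) M) Q :
  embedding (sarr N) -> embedding (sarr N') -> @is_quotient (MTRS S) M N N' Q ->
  @semistable (MTRS S) R mu Q <-> km_semistable h (subquo M (img (sarr N)) (img (sarr N'))).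
Proof.
move=> eN eN' hQ; have [_ fF _ _] := eN; have [_ fG _ _] := eN'.
have [s iso] := quotient_iso fF fG eN eN' hQ.
have [t [ts st]] := iso.
rewrite -[subquo M _ _]/(sheaf (subquo_ob fF fG)) -semistable_km; split.
  exact: semistable_iso iso.
by apply: (semistable_iso (s := t)); exists s.
Qed.

End CategorySlope.

(** * Harder--Narasimhan filtrations in a modular lattice of sets *)

Section HarderNarasimhan.
Context {R : realType} {T : finType}.
Variables (fl : pred {set T}) (rk : {set T} -> nat) (deg : {set T} -> int).
Variable join : {set T} -> {set T} -> {set T}.
Implicit Types A B F G H : {set T}.
Hypothesis flT : fl setT.
Hypothesis flI : forall F G, fl F -> fl G -> fl (F :&: G).
Hypothesis flJ : forall F G, fl F -> fl G -> fl (join F G).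
Hypothesis subJr : forall F G, fl F -> fl G -> G \subset join F G.
Hypothesis rk_eq : forall F G, fl F -> F \subset G -> (rk G <= rk F)%N -> F = G.
Hypothesis rk_le : forall F G, F \subset G -> (rk F <= rk G)%N.
Hypothesis rk_mod : forall F G, fl F -> fl G -> (rk F + rk G = rk (join F G) + rk (F :&: G))%N.
Hypothesis deg_sup : forall F G, fl F -> fl G -> deg F + deg G <= deg (join F G) + deg (F :&: G).

Definition hn_slope F G : R := (deg G - deg F)%:~R / (rk G - rk F)%:R.

Definition hn_semistable F G : Prop := (rk F < rk G)%N /\
  forall H, fl H -> F \subset H -> H \subset G -> (rk F < rk H)%N ->
    hn_slope F H <= hn_slope F G.

(** A filtration that starts anywhere, to allow induction on its length. *)
Definition hn_chain (k : nat) (F : nat -> {set T}) : Prop :=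
  [/\ forall i, (i <= k)%N -> fl (F i), F k = setT,
      forall i, (i < k)%N -> F i \subset F i.+1,
      forall i, (i < k)%N -> hn_semistable (F i) (F i.+1)
    & forall i, (i.+1 < k)%N -> hn_slope (F i.+1) (F i.+2) < hn_slope (F i) (F i.+1)].

Local Notation dg F := ((deg F)%:~R : R).
Local Notation r F := ((rk F)%:R : R).

Lemma hn_slope_le F G (l : R) : (rk F < rk G)%N ->
  (hn_slope F G <= l) = (dg G - dg F <= l * (r G - r F)).
Proof.
move=> lt; rewrite /hn_slope ler_pdivrMr ?ltr0n ?subn_gt0 //.
by rewrite intrB natrB // ltnW.
Qed.

Lemma hn_slopeE F G : (rk F < rk G)%N ->
  dg G - dg F = hn_slope F G * (r G - r F).
Proof.
move=> lt; rewrite /hn_slope intrB natrB ?(ltnW lt) // divfK //.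
by rewrite subr_eq0 eqr_nat gtn_eqF.
Qed.

Lemma hn_semistable_le F G H : fl F -> fl H -> hn_semistable F G -> F \subset H -> H \subset G ->
  dg H - dg F <= hn_slope F G * (r H - r F).
Proof.
move=> fF fH [lt ss] FH HG; case: (ltnP (rk F) (rk H)) => rFH.
  by rewrite -hn_slope_le //; exact: ss.
by rewrite -(rk_eq fF FH rFH) !subrr mulr0.
Qed.

Lemma hn_chain_tail k (F : nat -> {set T}) : hn_chain k.+1 F -> hn_chain k (F \o succn).
Proof.
move=> [h1 h2 h3 h4 h5]; split=> //= i ik.
- by apply: h1.
- by apply: h3.
- by apply: h4.
by apply: h5.
Qed.

(** Supermodularity moves the part of $G$ outside $F_1$ to $G\vee F_1$, where
    the rest of the filtration bounds its slope by a smaller number. This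
    determines the first step: it is the largest flat of maximal slope. *)
Lemma hn_chain_bound k (F : nat -> {set T}) G : hn_chain k.+1 F -> fl G -> F 0%N \subset G ->
  dg G - dg (F 0%N) <= hn_slope (F 0%N) (F 1%N) * (r G - r (F 0%N)) /\
  (dg G - dg (F 0%N) = hn_slope (F 0%N) (F 1%N) * (r G - r (F 0%N)) -> G \subset F 1%N).
Proof.
elim: k F G => [|k IH] F G hc fG F0G; have [h1 h2 h3 h4 h5] := hc.
  split; last by rewrite h2 subsetT.
  by apply: hn_semistable_le => //; [exact: h1|exact: h4|rewrite h2 subsetT].
have f0 : fl (F 0%N) by exact: h1.
have f1 : fl (F 1%N) by exact: h1.
have [b1 _] := IH (F \o succn) (join G (F 1%N)) (hn_chain_tail hc) (flJ fG f1) (subJr fG f1).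
rewrite /= in b1.
have fI := flI fG f1.
have F0I : F 0%N \subset G :&: F 1%N by rewrite subsetI F0G h3.
have b0 := hn_semistable_le f0 fI (h4 0%N isT) F0I (subsetIr _ _).
have lt : hn_slope (F 1%N) (F 2%N) < hn_slope (F 0%N) (F 1%N) := h5 0%N isT.
have sup : dg G + dg (F 1%N) <= dg (join G (F 1%N)) + dg (G :&: F 1%N).
  by rewrite -!intrD ler_int; exact: deg_sup.
have md : r G + r (F 1%N) = r (join G (F 1%N)) + r (G :&: F 1%N).
  by rewrite -!natrD rk_mod.
have le : r (G :&: F 1%N) <= r G by rewrite ler_nat rk_le // subsetIl.
have diff : r (join G (F 1%N)) - r (F 1%N) = r G - r (G :&: F 1%N) by lra.
rewrite diff in b1.
move: (hn_slope _ _) (hn_slope _ _) lt b1 b0 => l1 l0 lt b1 b0.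
split; first by nra.
move=> e; have rle : r G <= r (G :&: F 1%N) by nra.
rewrite ler_nat in rle.
by rewrite -(rk_eq fI (subsetIl _ _) rle) subsetIr.
Qed.

Lemma hn_chain_first k k' (F F' : nat -> {set T}) : hn_chain k.+1 F -> hn_chain k'.+1 F' -> F 0%N = F' 0%N ->
  F 1%N = F' 1%N.
Proof.
move=> hc hc' e0.
suff half k1 k2 (F1 F2 : nat -> {set T}) : hn_chain k1.+1 F1 -> hn_chain k2.+1 F2 -> F1 0%N = F2 0%N ->
    hn_slope (F2 0%N) (F2 1%N) <= hn_slope (F1 0%N) (F1 1%N) /\
    (hn_slope (F2 0%N) (F2 1%N) = hn_slope (F1 0%N) (F1 1%N) -> F2 1%N \subset F1 1%N).
  have [l1 s1] := half _ _ _ _ hc hc' e0; have [l2 s2] := half _ _ _ _ hc' hc (esym e0).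
  have e : hn_slope (F' 0%N) (F' 1%N) = hn_slope (F 0%N) (F 1%N).
    by apply: le_anti; rewrite l1 l2.
  by apply/eqP; rewrite eqEsubset s1 // s2.
move=> c1 c2 e; have [h1 _ h3 h4 _] := c2.
have [lt _] := h4 0%N isT.
have s : F1 0%N \subset F2 1%N by rewrite e; exact: h3.
have [b1 b2] := hn_chain_bound c1 (h1 1%N isT) s.
rewrite e in b1 b2 *; split; first by rewrite hn_slope_le.
by move=> el; apply: b2; rewrite -el hn_slopeE.
Qed.

Lemma hn_chain_unique k k' (F F' : nat -> {set T}) : hn_chain k F -> hn_chain k' F' -> F 0%N = F' 0%N ->
  k' = k /\ forall i, (i <= k)%N -> F' i = F i.
Proof.
have top0 n (G : nat -> {set T}) G' : hn_chain n.+1 G -> G 0%N = G' -> G' = setT -> False.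
  move=> [_ _ _ h4 _] e1 e2; have [lt _] := h4 0%N isT.
  by move: lt; rewrite e1 e2 ltnNge rk_le // subsetT.
elim: k k' F F' => [|k IH] [|k'] F F' hc hc' e0.
- by split=> // i; rewrite leqn0 => /eqP ->.
- by case: (top0 _ _ _ hc' (esym e0)); case: hc.
- by case: (top0 _ _ _ hc e0); case: hc'.
have e1 := hn_chain_first hc hc' e0.
have [-> h] := IH _ _ _ (hn_chain_tail hc) (hn_chain_tail hc') e1.
by split=> // -[|i] ik; [rewrite e0|exact: h].
Qed.

(** The next member of the filtration that exists: maximality of the slope
    makes the step semistable, and maximality of the rank makes the slopes
    decrease. *)
Definition hn_step F G : Prop := [/\ fl G, F \subset G, (rk F < rk G)%N &
  forall H, fl H -> F \subset H -> (rk F < rk H)%N ->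
    hn_slope F H <= hn_slope F G /\ (hn_slope F H = hn_slope F G -> (rk H <= rk G)%N)].

Lemma hn_step_exists F : fl F -> F != setT -> exists G, hn_step F G.
Proof.
move=> fF FT; pose P G := [&& fl G, F \subset G & (rk F < rk G)%N].
have PT : P setT.
  rewrite /P flT subsetT ltnNge /=; apply: contra FT => le.
  by apply/eqP; exact: rk_eq (subsetT F) le.
have [G0 P0 m0] : exists2 G0, P G0 & forall H, P H -> hn_slope F H <= hn_slope F G0.
  by case: (Order.TotalTheory.arg_maxP (hn_slope F) PT) => G0 P0 m0; exists G0.
pose Q G := P G && (hn_slope F G == hn_slope F G0).
have Q0 : Q G0 by rewrite /Q P0 eqxx.
case: (arg_maxnP rk Q0) => G /andP[/and3P[fG FG rFG] /eqP eG] mG; exists G; split=> //.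
move=> H fH FH rFH; have PH : P H by rewrite /P fH FH.
rewrite eG; split; first exact: m0.
by move=> e; apply: mG; rewrite /Q PH e eqxx.
Qed.

Lemma hn_step_semistable F G : hn_step F G -> hn_semistable F G.
Proof. by move=> [fG FG lt m]; split=> // H fH FH _ rFH; case: (m H fH FH rFH). Qed.

Lemma hn_step_decr F G H : hn_step F G -> hn_step G H -> hn_slope G H < hn_slope F G.
Proof.
move=> [fG FG lt m] [fH GH lt' _]; rewrite ltNge; apply/negP => le.
have ltH := ltn_trans lt lt'.
have [le1 e1] := m H fH (subset_trans FG GH) ltH.
suff e : hn_slope F H = hn_slope F G by have := e1 e; rewrite leqNgt lt'.
apply: le_anti; rewrite le1 /=.
rewrite -[_ <= _]/(hn_slope F G <= hn_slope F H).
have a1 := hn_slopeE lt; have a2 := hn_slopeE lt'; have a3 := hn_slopeE ltH.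
have p1 : r F < r G by rewrite ltr_nat.
have p2 : r G < r H by rewrite ltr_nat.
by move: (hn_slope F G) (hn_slope G H) (hn_slope F H) le a1 a2 a3 => x y z *; nra.
Qed.

Lemma hn_chain_exists F : fl F -> exists k C, hn_chain k C /\ C 0%N = F.
Proof.
suff gen : fl F -> exists k C, [/\ C 0%N = F, C k = setT, forall i, (i <= k)%N -> fl (C i)
    & forall i, (i < k)%N -> hn_step (C i) (C i.+1)].
  move=> /gen[k [C [C0 Ck fC st]]]; exists k, C; split=> //; split=> // i ik.
  - by case: (st i ik).
  - exact: hn_step_semistable (st i ik).
  by apply: hn_step_decr; apply: st; rewrite // ltnW.
move: {2}(rk setT - rk F)%N (leqnn (rk setT - rk F)) => n.
elim: n F => [|n IH] F le fF; have [->|FT] := eqVneq F setT;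
  try by exists 0%N, (fun=> setT).
  case/eqP: FT; apply: rk_eq (subsetT F) _ => //.
  by move: le; rewrite leqn0 subn_eq0.
have [G sG] := hn_step_exists fF FT; have [fG FG lt _] := sG.
have [|k [C [C0 Ck fC st]]] := IH G _ fG; first by have := rk_le (subsetT G); lia.
exists k.+1, (fun i => if i is j.+1 then C j else F); split=> //.
  by case=> [|i] //; exact: fC.
by case=> [|i] ik; [rewrite C0|exact: st].
Qed.

End HarderNarasimhan.

Section Main.
Context {R : realType} {d : nat} {S : fan R d}.
Variable h : ray S -> int.
Hypothesis hpol : forall u : 'cV[int]_d, \sum_rho h rho * pairing u (gen S rho) = 0.
Hypothesis h0 : forall rho, 0 <= h rho.
Variable E : mtrs_ob S.
Local Notation gpE := (mtrs_gpP (sheafP E)).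
Local Notation chain := (@hn_chain R _ (flat (gp E)) (mrank (gp E)) (@fdeg _ _ _ h E)).

Lemma km_filtrationP k F : km_filtration h E k F <-> chain k F /\ F 0%N = [set None].
Proof.
have EP := sheafP E; split.
  move=> [h1 [h2 h3] h4 h5 h6]; split=> //; split=> // i ik.
    have f1 := h1 i (ltnW ik); have f2 := h1 i.+1 ik.
    exact: (km_semistable_subquo h EP f1 f2 (h4 i ik)).1 (h5 i ik).
  have f1 := h1 i (ltnW (ltnW ik)); have f2 := h1 i.+1 (ltnW ik); have f3 := h1 i.+2 ik.
  have := h6 i ik; rewrite (sslope_subquo h EP f1 f2 (h4 i (ltnW ik))).
  by rewrite (sslope_subquo h EP f2 f3 (h4 i.+1 ik)).
move=> [[h1 h2 h3 h4 h5] e0]; split=> // i ik.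
  have f1 := h1 i (ltnW ik); have f2 := h1 i.+1 ik.
  exact: (km_semistable_subquo h EP f1 f2 (h3 i ik)).2 (h4 i ik).
have f1 := h1 i (ltnW (ltnW ik)); have f2 := h1 i.+1 (ltnW ik); have f3 := h1 i.+2 ik.
rewrite (sslope_subquo h EP f1 f2 (h3 i (ltnW ik))).
rewrite (sslope_subquo h EP f2 f3 (h3 i.+1 ik)); exact: h5.
Qed.

Lemma flat_chain_exists : exists k F, chain k F /\ F 0%N = [set None].
Proof.
apply: (@hn_chain_exists R _ (flat (gp E)) (mrank (gp E)) (@fdeg _ _ _ h E)).
- exact: (flatT gpE).
- exact: (flat_rk_eq gpE).
- exact: (rkS gpE).
exact: (flat_bot (sheafP E)).
Qed.

Lemma flat_chain_unique k k' F F' : chain k F -> chain k' F' -> F 0%N = F' 0%N ->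
  k' = k /\ forall i, (i <= k)%N -> F' i = F i.
Proof.
apply: (@hn_chain_unique R _ (flat (gp E)) (mrank (gp E)) (@fdeg _ _ _ h E) (fjoin (gp E))).
- exact: (flatI gpE).
- by move=> G H _ _; exact: (cl_flat gpE).
- by move=> G H _ _; exact: subset_trans (subsetUr _ _) (sub_cl gpE _).
- exact: (flat_rk_eq gpE).
- exact: (rkS gpE).
- exact: (mtrs_modular (sheafP E)).
by move=> G H fG fH; exact: (fdeg_supermod (sheafP E) h0 fG fH).
Qed.

Local Notation mu := (@mtrs_slope R d S h).

(** Strict subobjects correspond to flats, and the notions of quotient,
    semistability and slope agree on both sides. So a categorical slope
    filtration is a filtration by flats of the same kind, and uniqueness for
    flats is uniqueness in the category. *)
Lemma slope_filtration_chain k (N : nat -> @sub (MTRS S) E) :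
  @slope_filtration (MTRS S) R mu E k N ->
  [/\ forall i, (i <= k)%N -> embedding (sarr (N i)),
      chain k (fun i => img (sarr (N i))) & img (sarr (N 0%N)) = [set None]].
Proof.
move=> [sN [z0 isok] le [Q [qQ sQ dQ]]].
have eN i : (i <= k)%N -> embedding (sarr (N i)) by move/sN/strict_monoP.
have sub i : (i < k)%N -> img (sarr (N i)) \subset img (sarr (N i.+1)).
  by move=> ik; apply/(sub_leP _ (eN _ ik)); exact: le.
split=> //; last first.
  apply/setP => x; rewrite inE; apply/imsetP/eqP => [[[y|] _ ->] //|->]; last by exists None.
  by move/is_zeroP: z0 => /(_ y).
split=> //.
- by move=> i /eN[].
- have [on _ _] := iso_projection isok.
  apply/setP => -[x|]; rewrite inE; last exact: img_point.
  by have [y <-] := on x; exact: mem_img.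
- move=> i ik; have e1 := eN i (ltnW ik); have e2 := eN i.+1 ik.
  have [_ f1 _ _] := e1; have [_ f2 _ _] := e2.
  apply/(km_semistable_subquo h (sheafP E) f1 f2 (sub i ik)).
  exact: (quotient_semistable hpol e1 e2 (qQ i ik)).1 (sQ i ik).
move=> i ik; have ik' := ltnW ik.
have e1 := eN i (ltnW ik'); have e2 := eN i.+1 ik'; have e3 := eN i.+2 ik.
have := dQ i ik; rewrite (quotient_slope hpol e1 e2 (sub _ ik') (qQ _ ik')).
by rewrite (quotient_slope hpol e2 e3 (sub _ ik) (qQ _ ik)).
Qed.

Lemma embedding_onto_iso (K X : mtrs_ob S) (f : mtrs_hom K X) : embedding f ->
  img f = setT -> @is_iso (MTRS S) K X f.
Proof.
move=> ef imf; have ei : embedding (mtrs_id X).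
  by apply: iso_embedding; exists (mtrs_id X); split; exact: mtrs_idl.
have [|s iso es] := embedding_unique ef ei.
  by rewrite imf; apply/setP => x; rewrite inE -[x]act_id mem_img.
by have -> : f = s by rewrite -es; exact: mtrs_idl.
Qed.

Lemma chain_slope_filtration k F : chain k F -> F 0%N = [set None] ->
  exists N : nat -> @sub (MTRS S) E,
    [/\ forall i, (i <= k)%N -> @is_restriction R d S E (F i) (N i),
        forall i, (i <= k)%N -> embedding (sarr (N i)) /\ img (sarr (N i)) = F i
      & @slope_filtration (MTRS S) R mu E k N].
Proof.
move=> [fF FT inc ss dec] F0.
have /choice[N hN] : forall i, exists Ni : @sub (MTRS S) E, (i <= k)%N ->
    exists f : flat (gp E) (F i), Ni = Defs.Sub (incl_hom f : @Defs.hom (MTRS S) _ E).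
  move=> i.
  case: (boolP (i <= k)%N) => [ik|_].
    by exists (Defs.Sub (incl_hom (fF i ik) : @Defs.hom (MTRS S) _ E)) => _; exists (fF i ik).
  by exists (Defs.Sub (mtrs_id E : @Defs.hom (MTRS S) E E)).
have hN' i : (i <= k)%N -> embedding (sarr (N i)) /\ img (sarr (N i)) = F i.
  by move=> /hN[f ->]; split; [exact: incl_embedding|exact: img_incl].
exists N; split=> //.
  move=> i /hN[f ->].
  by exists (restr_mtrs (sheafP E) f), (incl_hom f).
have /choice[Q hQ] : forall i, exists Qi : mtrs_ob S, (i < k)%N ->
    [/\ @is_quotient (MTRS S) E (N i) (N i.+1) Qi, @semistable (MTRS S) R mu Qi
      & mu Qi = fslope h (F i) (F i.+1)].
  move=> i.
  case: (boolP (i < k)%N) => [ik|_]; last by exists E.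
  have [f1 e1] := hN i (ltnW ik); have [f2 e2] := hN i.+1 ik.
  exists (subquo_ob f1 f2) => _; rewrite e1 e2; split.
  - exact: quotient_incl (inc i ik).
  - apply/(semistable_km hpol).
    exact: (km_semistable_subquo h (sheafP E) f1 f2 (inc i ik)).2 (ss i ik).
  exact: (sslope_subquo h (sheafP E) f1 f2 (inc i ik)).
split.
- by move=> i /hN'[e _]; apply/strict_monoP.
- split; last by have [e im] := hN' k (leqnn k); apply: embedding_onto_iso => //; rewrite im.
  have [f ->] := hN 0%N (leq0n k); apply/is_zero_srank.
  by rewrite /= (srank_restr (sheafP E) f) F0 (rk_point (sheafP E)).
- move=> i ik; have [_ im1] := hN' i (ltnW ik); have [e2 im2] := hN' i.+1 ik.
  by apply/(sub_leP _ e2); rewrite im1 im2 inc.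
exists Q; split.
- by move=> i /hQ[].
- by move=> i /hQ[].
move=> i ik; have [_ _ ->] := hQ i (ltnW ik); have [_ _ ->] := hQ i.+1 ik.
exact: dec.
Qed.

End Main.

Theorem theoremD (R : realType) (d : nat) (S : fan R d) (c : int)
    (hsmooth : smooth_fan S) (hcomplete : complete_fan S)
    (hpol : polarization (fun _ : ray S => c)) :
  let h : ray S -> int := fun _ => c in
  let mu : MTRS S -> R := mtrs_slope h in
  [/\ quasi_proto_abelian (MTRS S),
      forall E : MTRS S, artinian E /\ noetherian E,
      iso_invariant mu
    & strong_slope_inequality mu]
  /\
  forall E : MTRS S, ~ is_zero E ->
    (exists (k : nat) (F : nat -> {set option (gs (sheaf E))}),
      km_filtration h E k F /\
      forall (k' : nat) (F' : nat -> {set option (gs (sheaf E))}),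
        km_filtration h E k' F' ->
        k' = k /\ forall i, (i <= k)%N -> F' i = F i)
    /\
    forall (k : nat) (F : nat -> {set option (gs (sheaf E))}),
      km_filtration h E k F ->
      exists N : nat -> sub E,
        [/\ forall i, (i <= k)%N -> is_restriction E (F i) (N i),
            slope_filtration mu k N
          & forall (k' : nat) (N' : nat -> sub E),
              slope_filtration mu k' N' ->
              k' = k /\ forall i, (i <= k)%N -> sub_eq (N' i) (N i)].
Proof.
move=> h mu; have [hpos hsum] := hpol.
have h0 rho : 0 <= h rho by rewrite ltW // (hpos rho).
split.
  split.
  - exact: mtrs_quasi_proto_abelian.
  - by move=> E; split; [exact: mtrs_artinian|exact: mtrs_noetherian].
  - exact: mtrs_iso_invariant.
  exact: mtrs_strong_slope.
move=> E _; split.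
  have [k [F [cF F0]]] := flat_chain_exists h E.
  exists k, F; split; first exact/km_filtrationP.
  move=> k' F' /km_filtrationP[cF' F0'].
  by apply: (flat_chain_unique h0 cF cF'); rewrite F0.
move=> k F /km_filtrationP[cF F0].
have [N [rN eN sN]] := chain_slope_filtration hsum cF F0.
exists N; split=> // k' N' sN'.
have [eN' cN' N0'] := slope_filtration_chain hsum sN'.
have [|ek e] := flat_chain_unique h0 cF cN'; first by rewrite F0 N0'.
subst k'; split=> // i ik; have [eNi imNi] := eN i ik.
by apply/(sub_eqP (eN' i ik) eNi); rewrite imNi; exact: e.
Qed.
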